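(* Let $E$ be an admissible sequentially complete $\mathbb{C}$-lcHs and let $A\colon F:=D(A)\subset E\to E$ be a sequentially closed linear operator such that $F_{A}=(F,\tau_{A})$ is admissible. The abstract Cauchy problem $x'(t)=Ax(t)$, $t>0$, $x(0)=x_0$, has the uniqueness property (in the sense of hyperfunctions) if there is an asymptotic left resolvent $(R_{\alpha}(t,A))_{\alpha\in\mathfrak{A}}$ (with associated numbers $t_\alpha>0$) such that for every $\alpha\in\mathfrak{A}$ there exist $\gamma\in\mathfrak{A}$, $k\in\mathbb{N}$ and $C_{3},C_{4}>0$ such that for all $t\geq t_{\alpha}$ and $x\in E$ $$\|R_{\alpha}(t,A)x\|_{\alpha,A}\leq C_{3}\, p_{\gamma}(x)\quad\text{and}\quad \|R_{\alpha}^{\gamma}(t,A)\|_{L(E_{\gamma},F_{\alpha})}\leq C_{4}\, e^{kt},$$ where $R_{\alpha}^{\gamma}(t,A)\colon E_{\gamma}\to F_{\alpha}$ is the continuous linear extension of the map $E/\ker p_{\gamma}\to F_{\alpha}$, $x+\ker p_{\gamma}\mapsto R_{\alpha}(t,A)x$.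
   Context: Conventions: $\mathbb{N}=\{1,2,\dots\}$, $\mathbb{N}_0=\mathbb{N}\cup\{0\}$. A $\mathbb{C}$-lcHs is a locally convex Hausdorff space $E$ over $\mathbb{C}$, whose topology is given by a directed system of seminorms $(p_\alpha)_{\alpha\in\mathfrak{A}}$. $L(X,Y)$ is the space of continuous linear maps $X\to Y$. $\mathcal{O}(\Omega,E)$ is the space of $E$-valued holomorphic functions on an open set $\Omega\subset\mathbb{C}$, $\mathcal{C}^\infty(\Omega,E)$ the space of infinitely continuously partially differentiable $E$-valued functions on $\Omega\subset\mathbb{C}=\mathbb{R}^2$. Admissibility. Let $\overline{\mathbb{R}}=\mathbb{R}\cup\{\pm\infty\}$ be the two-point compactification of $\mathbb{R}$. For compact $K\subset\overline{\mathbb{R}}$ and $n\in\mathbb{N}$ let $U_n(K)$ be the union of $\{z\in\mathbb{C}\mid \mathrm{d}(z,K\cap\mathbb{C})<1/n\}$ (with $\mathrm{d}(z,\emptyset)=\infty$), of $]n,\infty[+i]-\tfrac1n,\tfrac1n[$ if $\infty\in K$, and of $]-\infty,-n[+i]-\tfrac1n,\tfrac1n[$ if $-\infty\in K$. Let $S_n(K)=(\mathbb{C}\setminus\overline{U_n(K)})\cap\{z\mid |\mathrm{Im}(z)|<n\}$. Let $\mathcal{E}^{exp}(\overline{\mathbb{C}}\setminus K,E)$ be the space of all $f\in\mathcal{C}^\infty(\mathbb{C}\setminus K,E)$ such that $\sup\{p_\alpha(\partial^\beta f(z))e^{-\frac1n|\mathrm{Re}(z)|}\mid z\in S_n(K),\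 \beta\in\mathbb{N}_0^2,\ |\beta|\le m\}<\infty$ for all $n\in\mathbb{N}$, $m\in\mathbb{N}_0$, $\alpha\in\mathfrak{A}$. $E$ is called admissible if the Cauchy–Riemann operator $\overline\partial\colon\mathcal{E}^{exp}(\overline{\mathbb{C}}\setminus K,E)\to\mathcal{E}^{exp}(\overline{\mathbb{C}}\setminus K,E)$ is surjective for every compact $K\subset\overline{\mathbb{R}}$. The space $F_A$. For a sequentially complete $\mathbb{C}$-lcHs $E$ and a sequentially closed linear operator $A\colon F=D(A)\subset E\to E$ (sequentially closed graph), $\tau_A$ is the graph topology on $F$ given by the seminorms $p_{\alpha,A}(x)=p_\alpha(x)+p_\alpha(Ax)$, $\alpha\in\mathfrak{A}$, and $F_A=(F,\tau_A)$; it is a sequentially complete $\mathbb{C}$-lcHs and $A\colon F_A\to E$ is continuous. Hyperfunctions and the uniqueness property. $\mathcal{B}([0,\infty[,E)=\mathcal{O}(\mathbb{C}\setminus[0,\infty[,E)/\mathcal{O}(\mathbb{C},E)$, with classes $[u]$. A solution (in the sense of hyperfunctions) of the abstract Cauchy problem $x'(t)=Ax(t)$, $t>0$, $x(0)=x_0\in E$, is an element $[u]\in\mathcal{B}([0,\infty[,F_A)$ with $\frac{d}{dt}[u]-A[u]=x_0\otimes\delta_0$ in $\mathcal{B}([0,\infty[,E)$, where $\frac{d}{dt}[u]=[\frac{d}{dz}u]$, $A[u]=[z\mapsto Au(z)]$ and $x_0\otimes\delta_0=[z\mapsto-\frac{1}{2\pi i z}x_0]$. The problem has the uniqueness property (in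 the sense of hyperfunctions) if $[u]=0$ is the only solution for $x_0=0$. Local Banach spaces. $E_\alpha$ is the completion of $E/\ker p_\alpha$ with respect to the norm $\|x+\ker p_\alpha\|_\alpha=p_\alpha(x)$; $F_\alpha$ is the completion of $F/\ker p_{\alpha,A}$ with respect to $\|x+\ker p_{\alpha,A}\|_{\alpha,A}=p_{\alpha,A}(x)$; the norms are extended to the completions under the same symbols. $\kappa_\alpha^F\colon F_A\to F_\alpha$, $x\mapsto x+\ker p_{\alpha,A}$. Asymptotic left resolvent. A set of operators $(R_\alpha(t,A))_{\alpha\in\mathfrak{A}}$ is an asymptotic left resolvent if for all $\alpha\in\mathfrak{A}$ there is $t_\alpha>0$ such that $R_\alpha(t,A)\in L(E,F_\alpha)$ for all $t\ge t_\alpha$ and the continuous linear maps $S_\alpha(t)\colon F_A\to F_\alpha$, $S_\alpha(t):=R_\alpha(t,A)(t-A)-\kappa_\alpha^F$, $t\ge t_\alpha$, satisfy: for every $n\in\mathbb{N}$ there exist $\beta\in\mathfrak{A}$, $t_{\alpha,n}\ge t_\alpha$ and $C_1,C_2>0$ such that for all $t\ge t_{\alpha,n}$ and $x\in F$: $\|S_\alpha(t)x\|_{\alpha,A}\le C_1p_{\beta,A}(x)$ and $\|S_\alpha^\beta(t)\|_{L(F_\beta,F_\alpha)}\le C_2e^{-nt}$, where $S_\alpha^\beta(t)\colon F_\beta\to F_\alpha$ is the continuous linear extension of $F/\ker p_{\beta,A}\to F_\alpha$, $x+\ker p_{\beta,A}\mapsto S_\alpha(t)x$. *)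

(* Defs.v *)
From HB Require Import structures.
From mathcomp Require Import all_boot all_order all_algebra.
From mathcomp Require Import generic_quotient ring_quotient complex.
From mathcomp Require Import all_classical all_reals all_analysis.
From mathcomp Require Import lra.
Set Implicit Arguments.
Unset Strict Implicit.
Unset Printing Implicit Defensive.
Import Order.TTheory GRing.Theory Num.Theory.
Import numFieldNormedType.Exports.
Local Open Scope classical_set_scope.
Local Open Scope ring_scope.
Local Open Scope complex_scope.
Local Open Scope quotient_scope.
Local Notation Re := complex.Re.
Local Notation Im := complex.Im.

(* Norms over [R[i]] take their values in [R[i]]; [rnorm] and [cabs] are the
   corresponding real-valued functions. *)
Definition rnorm (R : realType) (V : normedModType R[i]) (x : V) : R := Re `|x|.
Definition cabs (R : realType) (z : R[i]) : R := Re `|z|.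

Lemma ReK (R : realType) (z : R[i]) : 0 <= z -> (Re z)%:C = z.
Proof. by case: z => a b; rewrite lecE /= => /andP[/eqP -> _]. Qed.

Section rnorm.
Context {R : realType}.

Lemma cabsE (z : R[i]) : (cabs z)%:C = `|z|.
Proof. by rewrite /cabs ReK. Qed.

Lemma cabsD (a b : R[i]) : cabs (a + b) <= cabs a + cabs b.
Proof. by rewrite -lecR rmorphD /= !cabsE ler_normD. Qed.

Lemma cabsM (a b : R[i]) : cabs (a * b) = cabs a * cabs b.
Proof. by apply: complexI; rewrite rmorphM /= !cabsE normrM. Qed.

Lemma cabs_ge0 (a : R[i]) : 0 <= cabs a.
Proof. by rewrite -lecR cabsE; exact: normr_ge0. Qed.

Context {V : normedModType R[i]}.

Lemma rnormE (x : V) : (rnorm x)%:C = `|x|.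
Proof. by rewrite /rnorm ReK. Qed.

Lemma rnormD (x y : V) : rnorm (x + y) <= rnorm x + rnorm y.
Proof. by rewrite -lecR rmorphD /= !rnormE ler_normD. Qed.

Lemma rnormZ (a : R[i]) (x : V) : rnorm (a *: x) = cabs a * rnorm x.
Proof. by apply: complexI; rewrite rmorphM /= !rnormE cabsE normrZ. Qed.

Lemma rnorm_ge0 (x : V) : 0 <= rnorm x.
Proof. by rewrite -lecR rnormE; exact: normr_ge0. Qed.

Lemma rnorm0_eq0 (x : V) : rnorm x = 0 -> x = 0.
Proof. by move=> x0; apply/normr0_eq0; rewrite -rnormE x0. Qed.

Lemma rdistC (x y : V) : rnorm (x - y) = rnorm (y - x).
Proof. by rewrite /rnorm distrC. Qed.

End rnorm.

Structure seminorm (R : realType) (V : lmodType R[i]) := Seminorm {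
  seminorm_fun :> V -> R ;
  seminormD : forall x y, seminorm_fun (x + y) <= seminorm_fun x + seminorm_fun y ;
  seminormZ : forall a x, seminorm_fun (a *: x) = cabs a * seminorm_fun x }.

Section seminorm_theory.
Context {R : realType} {V : lmodType R[i]} (p : seminorm V).

Lemma seminorm0 : p 0 = 0.
Proof.
rewrite -(scale0r 0) seminormZ (_ : cabs 0 = 0) ?mul0r//.
by apply: complexI; rewrite cabsE normr0.
Qed.

Lemma seminormN x : p (- x) = p x.
Proof.
rewrite -scaleN1r seminormZ (_ : cabs _ = 1) ?mul1r//.
by apply: complexI; rewrite cabsE normrN1.
Qed.

Lemma seminorm_ge0 x : 0 <= p x.
Proof.
have := seminormD p x (- x); rewrite subrr seminorm0 seminormN -mulr2n.
by rewrite pmulrn_lge0.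
Qed.

Lemma seminormB x y : p (x - y) = p (y - x).
Proof. by rewrite -opprB seminormN. Qed.

Lemma ler_dist_seminorm x y : `|p x - p y| <= p (x - y).
Proof.
rewrite ler_norml; apply/andP; split.
  by rewrite lerNl opprB lerBlDr seminormB -{1}(subrK x y) seminormD.
by rewrite lerBlDr -{1}(subrK y x) seminormD.
Qed.

End seminorm_theory.

Section normed_quot.
Context {R : realType} {V : lmodType R[i]} (p : seminorm V).

(* [normed_quot p] is V / ker p with the norm induced by [p]. *)
Definition seminorm_ker : {pred V} := [pred x | p x == 0].

Fact seminorm_ker_zmod_closed : zmod_closed seminorm_ker.
Proof.
split; first by rewrite inE seminorm0.
move=> x y; rewrite !inE => /eqP x0 /eqP y0.
rewrite eq_le seminorm_ge0 andbT (le_trans (seminormD _ _ _))//.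
by rewrite seminormN x0 y0 addr0.
Qed.

HB.instance Definition _ :=
  GRing.isZmodClosed.Build V seminorm_ker seminorm_ker_zmod_closed.

Definition normed_quot : Type := Quotient.quot seminorm_ker.

HB.instance Definition _ := GRing.Zmodule.on normed_quot.
HB.instance Definition _ := EqQuotient.on normed_quot.
HB.instance Definition _ := ZmodQuotient.on normed_quot.

Definition normed_quot_pi (x : V) : normed_quot := \pi_normed_quot x.

Lemma normed_quot_piP x y :
  normed_quot_pi x = normed_quot_pi y <-> p (x - y) = 0.
Proof.
split; first by move/eqP; rewrite -Quotient.idealrBE inE => /eqP.
by move=> xy; apply/eqP; rewrite -Quotient.idealrBE inE xy.
Qed.

Lemma normed_quot_ind (P : normed_quot -> Prop) :
  (forall x, P (normed_quot_pi x)) -> forall x, P x.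
Proof. by move=> Ppi x; rewrite -[x]reprK; exact: Ppi. Qed.

Lemma normed_quot_repr x : p (repr (normed_quot_pi x) - x) = 0.
Proof. by apply/normed_quot_piP; rewrite /normed_quot_pi reprK. Qed.

Definition normed_quot_scale (a : R[i]) (x : normed_quot) : normed_quot :=
  normed_quot_pi (a *: repr x).

Lemma normed_quot_piZ_subproof a x :
  normed_quot_scale a (normed_quot_pi x) = normed_quot_pi (a *: x).
Proof.
apply/normed_quot_piP.
by rewrite -scalerBr seminormZ normed_quot_repr mulr0.
Qed.

Lemma normed_quot_piD x y :
  normed_quot_pi (x + y) = normed_quot_pi x + normed_quot_pi y.
Proof. exact: pi_addr. Qed.

Let scaleA a b x :
  normed_quot_scale a (normed_quot_scale b x) = normed_quot_scale (a * b) x.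
Proof.
elim/normed_quot_ind: x => x.
by rewrite !normed_quot_piZ_subproof scalerA.
Qed.

Let scale1 : left_id 1 normed_quot_scale.
Proof.
by elim/normed_quot_ind => x; rewrite normed_quot_piZ_subproof scale1r.
Qed.

Let scaleDr : right_distributive normed_quot_scale +%R.
Proof.
move=> a; elim/normed_quot_ind => x; elim/normed_quot_ind => y.
rewrite -normed_quot_piD !normed_quot_piZ_subproof -normed_quot_piD.
by rewrite scalerDr.
Qed.

Let scaleDl x : {morph normed_quot_scale^~ x : a b / a + b}.
Proof.
move=> a b; elim/normed_quot_ind: x => x.
by rewrite !normed_quot_piZ_subproof -normed_quot_piD scalerDl.
Qed.

HB.instance Definition _ := GRing.Zmodule_isLmodule.Build R[i] normed_quot
  scaleA scale1 scaleDr scaleDl.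

Lemma normed_quot_pi_linear : linear normed_quot_pi.
Proof.
by move=> a x y; rewrite normed_quot_piD -normed_quot_piZ_subproof.
Qed.

HB.instance Definition _ :=
  GRing.isLinear.Build R[i] V normed_quot _ normed_quot_pi
    normed_quot_pi_linear.

Definition normed_quot_norm (x : normed_quot) : R[i] := (p (repr x))%:C.

Lemma normed_quot_normE (x : V) :
  normed_quot_norm (normed_quot_pi x) = (p x)%:C.
Proof.
congr (_%:C); apply/eqP; rewrite -subr_eq0 -normr_le0.
by rewrite (le_trans (ler_dist_seminorm _ _ _))// normed_quot_repr.
Qed.

Let normD x y :
  normed_quot_norm (x + y) <= normed_quot_norm x + normed_quot_norm y.
Proof.
elim/normed_quot_ind: x => x; elim/normed_quot_ind: y => y.
by rewrite -linearD !normed_quot_normE -rmorphD lecR seminormD.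
Qed.

Let normZ (a : R[i]) x : normed_quot_norm (a *: x) = `|a| * normed_quot_norm x.
Proof.
elim/normed_quot_ind: x => x; rewrite -linearZ !normed_quot_normE.
by rewrite seminormZ rmorphM/= cabsE.
Qed.

Let norm0 x : normed_quot_norm x = 0 -> x = 0.
Proof.
elim/normed_quot_ind: x => x; rewrite normed_quot_normE => /complexI x0.
by rewrite -(linear0 normed_quot_pi); apply/normed_quot_piP; rewrite subr0.
Qed.

HB.instance Definition _ :=
  Lmodule_isNormed.Build R[i] normed_quot normD normZ norm0.

Lemma rnorm_normed_quot_pi x : rnorm (normed_quot_pi x) = p x.
Proof. by rewrite /rnorm [`|_|]normed_quot_normE. Qed.

End normed_quot.

Section cauchy_sequences.
Context {R : realType} (N : normedModType R[i]).

Definition cauchyseq_pred : {pred nat -> N} :=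
  [pred u : nat -> N | `[< cauchy (u @ \oo) >] ].

Lemma cauchyseqP (u : nat -> N) : cauchy (u @ \oo) <->
  forall e : R, 0 < e ->
    exists n, forall i j, (n <= i)%N -> (n <= j)%N -> rnorm (u i - u j) < e.
Proof.
split => [/cauchy_ballP cu e e0|cu].
  have /cu : 0 < e%:C by rewrite ltcR.
  move=> [[A B]] /= [[n1 _ An] [n2 _ Bn]] AB.
  exists (maxn n1 n2) => i j; rewrite !geq_max => /andP[ni _] /andP[_ nj].
  have := AB (u i, u j); rewrite /= -ball_normE /= -rnormE ltcR; apply.
  by split; [exact: An|exact: Bn].
apply/cauchy_ballP => e e0.
have eE : (Re e)%:C = e by rewrite ReK// ltW.
have /cu[n nu] : 0 < Re e by rewrite -ltcR eE.
exists (u @` [set i | (n <= i)%N], u @` [set i | (n <= i)%N]) => /=.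
  by split; exists n => // i /= ni; exists i.
move=> [x y]/= [[i ni <-] [j nj <-]].
by rewrite -ball_normE /= -rnormE -eE ltcR; exact: nu.
Qed.

Fact cauchyseq_submod_closed : submod_closed cauchyseq_pred.
Proof.
split.
  apply/asboolP/cauchyseqP => e e0; exists 0%N => i j _ _.
  by rewrite subrr /rnorm normr0.
move=> a u v /asboolP/cauchyseqP cu /asboolP/cauchyseqP cv.
apply/asboolP/cauchyseqP => e e0.
have a0 : 0 < cabs a + 1 by rewrite ltr_wpDl// cabs_ge0.
have [|n1 nu] := cu (e / 2 / (cabs a + 1)); first by rewrite !divr_gt0.
have [|n2 nv] := cv (e / 2); first by rewrite divr_gt0.
exists (maxn n1 n2) => i j; rewrite !geq_max => /andP[i1 i2] /andP[j1 j2].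
have -> : (a *: u + v) i - (a *: u + v) j = a *: (u i - u j) + (v i - v j).
  by rewrite scalerBr -[LHS]/(a *: u i + v i - (a *: u j + v j)) opprD addrACA.
rewrite (le_lt_trans (rnormD _ _))// (splitr e) ler_ltD ?nv// rnormZ.
rewrite (@le_trans _ _ ((cabs a + 1) * rnorm (u i - u j)))//.
  by rewrite ler_wpM2r ?rnorm_ge0// lerDl.
by rewrite mulrC -ler_pdivlMr// ltW// nu.
Qed.

HB.instance Definition _ :=
  GRing.isSubmodClosed.Build R[i] (nat -> N) cauchyseq_pred
    cauchyseq_submod_closed.

Record cauchyseq := CauchySeq {
  cauchyseq_fun :> nat -> N ; _ : cauchyseq_fun \in cauchyseq_pred }.

HB.instance Definition _ := [isSub for cauchyseq_fun].
HB.instance Definition _ := [Choice of cauchyseq by <:].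
HB.instance Definition _ := [SubChoice_isSubLmodule of cauchyseq by <:].

Lemma cauchyseq_rnorm (u : cauchyseq) : cvgn (fun n => rnorm (u n)).
Proof.
apply/cauchy_cvgP/cauchy_ballP => e e0.
have /asboolP/cauchyseqP/(_ _ e0)[n nu] := valP u.
pose A := (fun n => rnorm (u n)) @` [set i | (n <= i)%N].
exists (A, A) => /=; first by split; exists n => // i /= ni; exists i.
move=> [x y]/= [[i ni <-] [j nj <-]]; rewrite -ball_normE /=.
apply: le_lt_trans (nu i j ni nj); rewrite ler_norml; apply/andP; split.
  by rewrite lerNl opprB lerBlDr rdistC -{1}(subrK (u i) (u j)) rnormD.
by rewrite lerBlDr -{1}(subrK (u j) (u i)) rnormD.
Qed.

Definition cauchyseq_limnorm (u : cauchyseq) : R :=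
  limn (fun n => rnorm (u n)).

Let limnormD u v : cauchyseq_limnorm (u + v) <=
  cauchyseq_limnorm u + cauchyseq_limnorm v.
Proof.
rewrite /cauchyseq_limnorm -limD; [|exact: cauchyseq_rnorm..].
apply: ler_lim; [exact: cauchyseq_rnorm| |by apply: nearW => n; exact: rnormD].
by apply: is_cvgD; exact: cauchyseq_rnorm.
Qed.

Let limnormZ a u :
  cauchyseq_limnorm (a *: u) = cabs a * cauchyseq_limnorm u.
Proof.
apply: cvg_lim => //; apply: cvg_trans; last first.
  exact: (cvgM (cvg_cst (cabs a)) (@cauchyseq_rnorm u)).
by apply: near_eq_cvg; apply: nearW => n /=; rewrite -rnormZ.
Qed.

Definition cauchyseq_seminorm : seminorm cauchyseq :=
  Seminorm limnormD limnormZ.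

(* Cauchy sequences modulo those with limit norm zero. *)
Definition completion : Type := normed_quot cauchyseq_seminorm.

HB.instance Definition _ := NormedModule.on completion.

Fact cst_cauchyseq (x : N) : (fun=> x) \in cauchyseq_pred.
Proof.
apply/asboolP/cauchyseqP => e e0; exists 0%N => i j _ _.
by rewrite subrr /rnorm normr0.
Qed.

Definition to_completion (x : N) : completion :=
  normed_quot_pi cauchyseq_seminorm (CauchySeq (cst_cauchyseq x)).

Lemma to_completion_linear : linear to_completion.
Proof.
move=> a x y; rewrite /to_completion -linearP; congr normed_quot_pi.
exact: val_inj.
Qed.

HB.instance Definition _ := GRing.isLinear.Build R[i] N completion _
  to_completion to_completion_linear.

Lemma rnorm_to_completion x : rnorm (to_completion x) = rnorm x.
Proof. by rewrite rnorm_normed_quot_pi /= /cauchyseq_limnorm /=; apply: lim_cst. Qed.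

Lemma to_completion_dense (y : completion) (e : R) : 0 < e ->
  exists x, rnorm (y - to_completion x) < e.
Proof.
move=> e0; move: y; apply: normed_quot_ind => u.
have /asboolP/cauchyseqP/(_ (e / 2))[|n nu] := valP u; first by rewrite divr_gt0.
exists (u n); rewrite /to_completion -linearB rnorm_normed_quot_pi.
rewrite (@le_lt_trans _ _ (e / 2))//; last by rewrite ltr_pdivrMr// ltr_pMr// ltr1n.
apply: limr_le; first exact: (@cauchyseq_rnorm (u - CauchySeq (cst_cauchyseq (u n)))).
by exists n => // i /= ni; apply/ltW/nu.
Qed.

Lemma cauchyseq_cvg_completion (u : cauchyseq) (e : R) : 0 < e ->
  exists n, forall i, (n <= i)%N ->
    rnorm (normed_quot_pi cauchyseq_seminorm u - to_completion (u i)) < e.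
Proof.
move=> e0.
have /asboolP/cauchyseqP/(_ (e / 2))[|n nu] := valP u; first by rewrite divr_gt0.
exists n => i ni; rewrite /to_completion -linearB rnorm_normed_quot_pi.
rewrite (@le_lt_trans _ _ (e / 2))//; last by rewrite ltr_pdivrMr// ltr_pMr// ltr1n.
apply: limr_le; first exact: (@cauchyseq_rnorm (u - CauchySeq (cst_cauchyseq (u i)))).
by exists n => // j /= nj; apply/ltW/nu.
Qed.

Let completion_cauchy_cvg (F : set_system completion) :
  ProperFilter F -> cauchy F -> cvg F.
Proof.
move=> FF /cauchyP cF.
have d_gt0 n : 0 < n.+1%:R^-1 :> R by rewrite invr_gt0.
have /choice[x Fx] n : exists x, F (ball x (n.+1%:R^-1)%:C).
  by apply: cF; rewrite ltcR.
have /choice[y xy] n : exists y, rnorm (x n - to_completion y) < n.+1%:R^-1.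
  exact: to_completion_dense.
have small (e : R) : 0 < e -> exists n, forall i, (n <= i)%N -> i.+1%:R^-1 < e.
  move=> e0; have [n _ ne] : \forall n \near \oo, n.+1%:R^-1 < e.
    by apply: (cvgr_lt 0) => //; exact: cvg_harmonic.
  by exists n => i ni; exact: ne.
have cy : y \in cauchyseq_pred.
  apply/asboolP/cauchyseqP => e e0.
  have [|n ne] := small (e / 4); first by rewrite divr_gt0.
  exists n => i j ni nj.
  have [z []] := filter_ex (filterI (Fx i) (Fx j)).
  rewrite -!ball_normE /= -!rnormE !ltcR => xiz xjz.
  rewrite -rnorm_to_completion linearB /=.
  have -> : to_completion (y i) - to_completion (y j) =
      (to_completion (y i) - x i) + (x i - z) + (z - x j) +
      (x j - to_completion (y j)) by rewrite !addrA !subrK.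
  rewrite rdistC in xjz; have := xy i; rewrite rdistC => xyi.
  have := rnormD (to_completion (y i) - x i + (x i - z) + (z - x j))
    (x j - to_completion (y j)).
  have := rnormD (to_completion (y i) - x i + (x i - z)) (z - x j).
  have := rnormD (to_completion (y i) - x i) (x i - z).
  have := lt_trans (xy j) (ne j nj); have := lt_trans xjz (ne j nj).
  have := lt_trans xiz (ne i ni); have := lt_trans xyi (ne i ni).
  lra.
apply/cvg_ex; exists (normed_quot_pi cauchyseq_seminorm (CauchySeq cy)).
apply/cvgrPdist_lt => e e0.
have eE : (Re e)%:C = e by rewrite ReK// ltW.
have e'0 : 0 < Re e by rewrite -ltcR eE.
have [|n1 n1e] := small (Re e / 3); first by rewrite divr_gt0.
have [|n2 n2e] := @cauchyseq_cvg_completion (CauchySeq cy) (Re e / 3).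
  by rewrite divr_gt0.
pose n := maxn n1 n2.
have := Fx n; apply: filterS => z; rewrite -ball_normE /= -!rnormE -eE !ltcR.
move=> xz.
have := n2e n (leq_maxr _ _); set Y := normed_quot_pi _ _ => /= Yn.
have -> : Y - z = (Y - to_completion (y n)) + (to_completion (y n) - x n) +
  (x n - z) by rewrite !addrA !subrK.
have := xy n; rewrite rdistC => xyn.
have ne := n1e n (leq_maxl _ _).
have := rnormD (Y - to_completion (y n) + (to_completion (y n) - x n)) (x n - z).
have := rnormD (Y - to_completion (y n)) (to_completion (y n) - x n).
have := lt_trans xyn ne; have := lt_trans xz ne; move: Yn; lra.
Qed.

HB.instance Definition _ :=
  Uniform_isComplete.Build completion completion_cauchy_cvg.

End cauchy_sequences.

Structure seminorm_system (R : realType) (I : Type) (V : lmodType R[i]) :=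
  SeminormSystem {
    system_seminorm :> I -> seminorm V ;
    system_inhabited : inhabited I ;
    system_directed : forall a b, exists c, exists2 C : R, 0 < C &
      forall x, system_seminorm a x <= C * system_seminorm c x /\
                system_seminorm b x <= C * system_seminorm c x }.

(* A single seminorm suffices in a neighborhood because systems are directed. *)
Definition seminorm_nbhs (R : realType) (I : Type) (V : lmodType R[i])
    (P : seminorm_system I V) (x : V) : set_system V :=
  [set U | exists a, exists2 e : R, 0 < e & forall y, P a (y - x) < e -> U y].

Definition seminorms_generate (R : realType) (I : Type) (E : tvsType R[i])
  (P : seminorm_system I E) := forall x : E, nbhs x = seminorm_nbhs P x.
Arguments seminorms_generate {R I} E P.

Definition lc_space (R : realType) (I : Type) (V : lmodType R[i])
  (P : seminorm_system I V) : Type := V.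

Section lc_space.
Context {R : realType} {I : Type} {V : lmodType R[i]}.
Variable P : seminorm_system I V.
Local Notation W := (lc_space P).
Local Open Scope convex_scope.

HB.instance Definition _ := GRing.Lmodule.on W.
HB.instance Definition _ := hasNbhs.Build W (seminorm_nbhs P).

Let nbhs_pfilter (x : W) : ProperFilter (nbhs x).
Proof.
split.
  move=> [a [e e0]] /(_ x); apply.
  by rewrite subrr seminorm0.
split.
- case: (system_inhabited P) => a; exists a, 1 => //.
- move=> U1 U2 [a [e e0 U1e]] [b [d d0 U2d]].
  have [c [C C0 abc]] := system_directed P a b.
  exists c, (Num.min e d / C); first by rewrite divr_gt0// lt_min e0.
  move=> y; rewrite ltr_pdivlMr// mulrC lt_min => /andP[ye yd].
  have [ya yb] := abc (y - x).
  by split; [apply: U1e; apply: le_lt_trans ye|apply: U2d; apply: le_lt_trans yd].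
- move=> U1 U2 U12 [a [e e0 Ue]]; exists a, e => // y ye.
  exact/U12/Ue.
Qed.

Let nbhs_singleton (x : W) (U : set W) : nbhs x U -> U x.
Proof. by move=> [a [e e0]]; apply; rewrite subrr seminorm0. Qed.

Let ball_nbhs (a : I) (x z : W) (e : R) : P a (z - x) < e ->
  seminorm_nbhs P z [set y | P a (y - x) < e].
Proof.
move=> ze; exists a, (e - P a (z - x)); first by rewrite subr_gt0.
move=> y; rewrite ltrBrDr => yz /=.
rewrite (le_lt_trans _ yz)//.
by rewrite (_ : y - x = (y - z) + (z - x)) ?seminormD// addrA subrK.
Qed.

Let nbhs_nbhs (x : W) (U : set W) : nbhs x U -> nbhs x (nbhs^~ U).
Proof.
move=> [a [e e0 Ue]]; exists a, e => // z ze.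
have [b [d d0 zd]] := ball_nbhs ze.
by exists b, d => // y yd; apply/Ue/zd.
Qed.

HB.instance Definition _ :=
  Nbhs_isNbhsTopological.Build W nbhs_pfilter nbhs_singleton nbhs_nbhs.

Let lc_add_continuous : continuous (fun x : W * W => x.1 + x.2).
Proof.
move=> [x y] U [a [e e0 Ue]].
have e2 : 0 < e / 2 by rewrite divr_gt0.
exists ([set z | P a (z - x) < e / 2], [set z | P a (z - y) < e / 2]) => /=.
  by split; exists a, (e / 2).
move=> [x' y'] /= [xe ye]; apply: Ue.
rewrite opprD addrACA (le_lt_trans (seminormD _ _ _))//.
by rewrite (splitr e) ltrD.
Qed.

Let lc_scale_continuous : continuous (fun z : R[i]^o * W => z.1 *: z.2).
Proof.
move=> [k x] U [a [e e0 Ue]].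
pose d := e / 2 / (P a x + 1).
have Px0 : 0 < P a x + 1 by rewrite ltr_wpDl// seminorm_ge0.
have d0 : 0 < d by rewrite !divr_gt0.
pose M := cabs k + d.
have M0 : 0 < M by rewrite ltr_wpDl// cabs_ge0.
exists ([set l | cabs (l - k) < d], [set z | P a (z - x) < e / 2 / M]) => /=.
  split; last by exists a, (e / 2 / M) => //; rewrite !divr_gt0.
  apply/nbhs_ballP; exists d%:C; first by rewrite /= ltcR.
  move=> l; rewrite -ball_normE /= => kl.
  by rewrite -ltcR cabsE -normrN opprB.
move=> [l z] /= [lk zx]; apply: Ue.
have -> : l *: z - k *: x = l *: (z - x) + (l - k) *: x.
  by rewrite scalerBr scalerBl addrA subrK.
rewrite (le_lt_trans (seminormD _ _ _))// !seminormZ (splitr e) ltr_leD//.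
- rewrite (@le_lt_trans _ _ (M * P a (z - x)))//; last first.
    by rewrite mulrC -ltr_pdivlMr.
  rewrite ler_wpM2r ?seminorm_ge0//.
  rewrite (_ : l = k + (l - k)); last by rewrite addrC subrK.
  by rewrite (le_trans (cabsD _ _))// lerD2l ltW.
- rewrite (@le_trans _ _ (d * (P a x + 1)))//.
    by rewrite ler_pM ?cabs_ge0 ?seminorm_ge0 ?lerDl// ltW.
  by rewrite /d divfK// gt_eqF.
Qed.

Let lc_locally_convex :
  exists2 B : set_system W, (forall b, b \in B -> convex_set b) & basis B.
Proof.
exists [set U | exists a x, exists e : R, U = [set y | P a (y - x) < e]].
  move=> U; rewrite inE => -[a [x [e ->]]]; apply/convex_setW => y z.
  rewrite !inE /= => ye ze l l0 l1; rewrite inE /=.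
  have lE : (Re l%:num)%:C = l%:num by rewrite ReK.
  set r := Re l%:num in lE.
  have r0 : 0 < r by rewrite -ltcR lE.
  have r1 : 0 < 1 - r by rewrite subr_gt0 -ltcR lE.
  have -> : (y : convex_lmodType W) <| l |> (z : convex_lmodType W) - x =
      r%:C *: (y - x) + (1 - r)%:C *: (z - x).
    rewrite lE rmorphB /= lE !scalerBr addrACA -opprD -scalerDl.
    by rewrite [X in X *: x]addrC subrK scale1r.
  rewrite (le_lt_trans (seminormD _ _ _))// !seminormZ.
  have cabsR s : 0 < s -> cabs s%:C = s.
    by move=> s0; rewrite /cabs gtr0_norm// ltcR.
  rewrite !cabsR// (_ : e = r * e + (1 - r) * e); last first.
    by rewrite -mulrDl addrC subrK mul1r.
  by rewrite ltrD// ltr_pM2l.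
split.
  move=> U [a [x [e ->]]]; rewrite openE => y /= ye.
  exact: ball_nbhs.
move=> x U [a [e e0 Ue]]; exists [set y | P a (y - x) < e]; last first.
  by move=> y; exact: Ue.
split; first by exists a, x, e.
by rewrite /= subrr seminorm0.
Qed.

HB.instance Definition _ := PreTopologicalLmod_isTvs.Build R[i] W
  lc_add_continuous lc_scale_continuous lc_locally_convex.
(* The factory above only provides the uniform structure. *)
HB.instance Definition _ := PreTopologicalNmodule_isTopologicalNmodule.Build W
  lc_add_continuous.
HB.instance Definition _ := TopologicalNmodule_isTopologicalLmodule.Build R[i] W
  lc_scale_continuous.
HB.instance Definition _ := Uniform_isTvs.Build R[i] W lc_locally_convex.

End lc_space.

Lemma lc_space_generate (R : realType) (I : Type) (V : lmodType R[i])
    (P : seminorm_system I V) (x : lc_space P) :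
  nbhs x = seminorm_nbhs P x.
Proof. by []. Qed.

(* The uniform structure of a [tvsType] is not required to be the
   translation-invariant one, so the library's [cauchy] cannot be used here. *)
Definition seq_complete (R : realType) (E : tvsType R[i]) :=
  forall u : nat -> E,
    u mn.1 - u mn.2 @[mn --> (\oo, \oo)] --> (0 : E) ->
    exists l : E, u @ \oo --> l.

(* The complex plane is [R[i]^o], which carries the topology given by the
   modulus. Functions on an open set are total functions of which
   only the values on that set are considered; [xget 0] is the limit when it
   exists (and 0 otherwise). *)
Section functions.
Context {R : realType} {E : tvsType R[i]}.
Implicit Types (f g : R[i]^o -> E) (z v : R[i]^o) (U : set R[i]^o).

Definition is_cderive f z (l : E) :=
  h^-1 *: (f (z + h) - f z) @[h --> 0^'] --> l.

Definition cderivable f z := exists l, is_cderive f z l.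

Definition cderive f z : E := xget 0 [set l | is_cderive f z l].

Definition holomorphic U f := forall z, U z -> cderivable f z.

Definition is_pderive v f z (l : E) :=
  (t%:C)^-1 *: (f (z + t%:C * v) - f z) @[t --> (0 : R)^'] --> l.

Definition pderivable v f z := exists l, is_pderive v f z l.

Definition pderive v f z : E := xget 0 [set l | is_pderive v f z l].

Definition dx f := pderive 1 f.
Definition dy f := pderive 'i f.

Fixpoint contdiff (k : nat) U f : Prop :=
  (forall z, U z -> {for z, continuous f}) /\
  if k is k'.+1 then
    [/\ forall z, U z -> pderivable 1 f z /\ pderivable 'i f z,
        contdiff k' U (dx f) & contdiff k' U (dy f)]
  else True.

Definition smooth U f := forall k, contdiff k U f.

Definition mderive (b : nat * nat) f := iter b.1 dx (iter b.2 dy f).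

Definition dbar f z : E := 2^-1 *: (dx f z + 'i *: dy f z).

End functions.

Section admissible.
Context {R : realType}.
Implicit Types (K : set (\bar R)) (n : nat) (z : R[i]^o).

Definition finite_part K : set R[i]^o := [set x%:C | x in [set x : R | K x%:E]].

(* The infimum of the empty set is +oo. *)
Definition cdist z (A : set R[i]^o) : \bar R :=
  ereal_inf [set (cabs (z - w))%:E | w in A].

Definition U_ n K : set R[i]^o := [set z |
  [\/ (cdist z (finite_part K) < (n%:R^-1)%:E)%E,
      [/\ K +oo%E, n%:R < Re z & - n%:R^-1 < Im z < n%:R^-1] |
      [/\ K -oo%E, Re z < - n%:R & - n%:R^-1 < Im z < n%:R^-1]]].

Definition S_ n K : set R[i]^o :=
  ~` closure (U_ n K) `&` [set z | `|Im z| < n%:R].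

Context {I : Type} {E : tvsType R[i]}.
Variable P : seminorm_system I E.

Definition Eexp K : set (R[i]^o -> E) := [set f |
  smooth (~` finite_part K) f /\
  forall (n m : nat) (a : I), (0 < n)%N ->
    (ereal_sup [set (P a (mderive zb.2 f zb.1) *
                     expR (- (n%:R^-1 * `|Re zb.1|)))%:E |
                zb in [set zb : R[i]^o * (nat * nat) |
                       S_ n K zb.1 /\ (zb.2.1 + zb.2.2 <= m)%N]] < +oo)%E].

Definition admissible := forall K, compact K ->
  forall g, Eexp K g ->
  exists2 f, Eexp K f & forall z, ~ finite_part K z -> dbar f z = g z.

End admissible.
Arguments admissible {R I} E P.

Record opdom (R : realType) (E : lmodType R[i]) (D : submodClosed E) :=
  OpDom { opval : E ; _ : opval \in D }.

HB.instance Definition _ (R : realType) (E : lmodType R[i])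
  (D : submodClosed E) := [isSub for @opval R E D].
HB.instance Definition _ (R : realType) (E : lmodType R[i])
  (D : submodClosed E) := [Choice of opdom D by <:].
HB.instance Definition _ (R : realType) (E : lmodType R[i])
  (D : submodClosed E) := [SubChoice_isSubLmodule of opdom D by <:].

Definition seq_closed_op (R : realType) (E : tvsType R[i])
    (D : submodClosed E) (A : opdom D -> E) :=
  forall (u : nat -> opdom D) (x y : E),
    opval (u n) @[n --> \oo] --> x -> A (u n) @[n --> \oo] --> y ->
    exists2 v : opdom D, opval v = x & A v = y.

(* [graph_space] carries the seminorms x |-> p_a x + p_a (A x). *)
Section graph.
Context {R : realType} {I : Type} {E : lmodType R[i]} (P : seminorm_system I E).
Context {D : submodClosed E} (A : {linear opdom D -> E}).

Definition graph_seminorm_fun (p : seminorm E) (x : opdom D) : R :=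
  p (opval x) + p (A x).

Fact graph_seminormD p x y : graph_seminorm_fun p (x + y) <=
  graph_seminorm_fun p x + graph_seminorm_fun p y.
Proof.
by rewrite /graph_seminorm_fun addrACA linearD lerD// seminormD.
Qed.

Fact graph_seminormZ p a x :
  graph_seminorm_fun p (a *: x) = cabs a * graph_seminorm_fun p x.
Proof. by rewrite /graph_seminorm_fun linearZ /= !seminormZ mulrDr. Qed.

Definition graph_seminorm (p : seminorm E) : seminorm (opdom D) :=
  Seminorm (graph_seminormD p) (graph_seminormZ p).

Fact graph_directed a b : exists c, exists2 C : R, 0 < C &
  forall x, graph_seminorm (P a) x <= C * graph_seminorm (P c) x /\
            graph_seminorm (P b) x <= C * graph_seminorm (P c) x.
Proof.
have [c [C C0 abc]] := system_directed P a b; exists c, C => // x.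
have [? ?] := abc (opval x); have [? ?] := abc (A x).
by rewrite /= /graph_seminorm_fun !mulrDr; split; rewrite lerD.
Qed.

Definition graph_system : seminorm_system I (opdom D) :=
  SeminormSystem (system_inhabited P) graph_directed.

Definition graph_space := lc_space graph_system.

End graph.

Section hyperfunctions.
Context {R : realType}.

Definition slit_plane : set R[i]^o := [set z | ~ (Im z = 0 /\ 0 <= Re z)].

(* The class of [f] in O(C \ [0, +oo[, E) / O(C, E). *)
Definition hyperclass (E : tvsType R[i]) (f : R[i]^o -> E) :
    set (R[i]^o -> E) :=
  [set g | exists2 h, holomorphic setT h &
           forall z, slit_plane z -> g z = f z + h z].

Context {I : Type} {E : tvsType R[i]} (P : seminorm_system I E).
Context {D : submodClosed E} (A : {linear opdom D -> E}).

(* [opval] embeds the derivative, taken in the graph space, into E. *)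
Definition acp_solution (x0 : E) : set (set (R[i]^o -> graph_space P A)) :=
  [set hyperclass u | u in [set u : R[i]^o -> graph_space P A |
    holomorphic slit_plane u /\
    hyperclass (fun z => opval (cderive u z : opdom D) - A (u z) : E) =
    hyperclass (fun z => - (2 * pi%:C * 'i * z)^-1 *: x0)]].

Definition acp_uniqueness :=
  acp_solution 0 = [set hyperclass (fun=> 0 : graph_space P A)].

End hyperfunctions.

Section local_banach.
Context {R : realType} {V : lmodType R[i]} (p : seminorm V).

Definition local_banach := completion (normed_quot p).

Definition local_map (x : V) : local_banach :=
  to_completion (normed_quot_pi p x).

End local_banach.

Definition continuous_linear (R : realType) (X Y : tvsType R[i]) (T : X -> Y) :=
  linear T /\ continuous T.

Definition opnorm (R : realType) (X Y : normedModType R[i]) (T : X -> Y) :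
    \bar R :=
  ereal_sup [set (rnorm (T x))%:E | x in [set x | rnorm x <= 1]].

(* [T] extends x + ker p |-> S x to the completion of V / ker p. *)
Definition continuous_extension (R : realType) (V : lmodType R[i])
    (p : seminorm V) (Y : normedModType R[i]) (S : V -> Y)
    (T : local_banach p -> Y) :=
  continuous_linear T /\ forall x, T (local_map p x) = S x.

Section resolvent.
Context {R : realType} {I : Type} {E : tvsType R[i]} (P : seminorm_system I E).
Context {D : submodClosed E} (A : {linear opdom D -> E}).

Local Notation pA a := (graph_seminorm A (P a)).

Variable Res : forall a : I, R -> E -> local_banach (pA a).
Variable t_ : I -> R.

(* S_a(t) = R_a(t) (t - A) - kappa_a *)
Definition resolvent_defect (a : I) (t : R) (x : opdom D) :
    local_banach (pA a) :=
  Res a t (t%:C *: opval x - A x) - local_map (pA a) x.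

Definition asymptotic_left_resolvent :=
  forall a, [/\ 0 < t_ a,
    forall t, t_ a <= t -> continuous_linear (Res a t) &
    forall n, (0 < n)%N -> exists b tn C1 C2,
      [/\ t_ a <= tn, 0 < C1, 0 < C2 & forall t, tn <= t ->
        (forall x, rnorm (resolvent_defect a t x) <= C1 * pA b x) /\
        exists2 S : local_banach (pA b) -> local_banach (pA a),
          continuous_extension (resolvent_defect a t) S &
          (opnorm S <= (C2 * expR (- (n%:R * t)))%:E)%E]].

End resolvent.

Lemma graph_system_generate (R : realType) (I : Type) (E : tvsType R[i])
    (P : seminorm_system I E) (D : submodClosed E)
    (A : {linear opdom D -> E}) :
  seminorms_generate (graph_space P A) (graph_system P A).
Proof. by []. Qed.

(* Main.v *)
Require Import Defs.
From HB Require Import structures.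
From mathcomp Require Import all_boot all_order all_algebra complex.
From mathcomp Require Import all_classical all_reals all_analysis.
From mathcomp Require Import ring lra.
Set Implicit Arguments.
Unset Strict Implicit.
Unset Printing Implicit Defensive.
Import Order.TTheory GRing.Theory Num.Theory.
Import numFieldNormedType.Exports.
Local Open Scope classical_set_scope.
Local Open Scope ring_scope.
Local Open Scope complex_scope.

(** Let [u] be a solution with initial value zero. It is holomorphic off the slit,
the half-line of nonnegative reals, where [u' - A u] coincides with an entire function [h]; uniqueness
says that [u] extends to an entire function.

Fix [T > 0] and a path from [T - i] to [T + i] around the left end of the slit,
and let [U(t)] be the integral of [e^(-tz) u(z)] along it. Integration by parts
turns [(t - A) U(t)] into boundary terms and the integral of [e^(-tz) h(z)], which
may be taken along the chord [Re z = T]: all of this is [O(e^(-tT))]. Apply the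
asymptotic left resolvent [R(t)], which is bounded uniformly in [t]. Since
[R(t) (t - A) = kappa + S(t)], where [S(t)] decays faster than any exponential and
[U(t)] grows at most like [e^t], the image of [U(t)] in each local Banach space of
the domain is [O(e^(-tT))] as well ([laplace_decay]). The resolvent is applied
before integrating, so that only integrals in these Banach spaces occur.

Conversely, this decay lets [u] cross the slit up to [T]. Cauchy's formula along
the path, closed by an outer path on the left, represents [u] between the two.
With the kernel [1 / (1 - e^(w - z))], a geometric series in [e^(w - z)] with the
same residue as [1 / (z - w)], the integral over the inner path is a power series
in [e^w] whose coefficients are the numbers [U(n)], [n] natural; by the decay it
converges for [Re w < T]. The integral over the outer path is holomorphic in the
whole triangle that this path cuts off. Their sum therefore extends the image of
[u] ([laplace_extension]), and it agrees with it off the slit because zeros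
propagate along segments ([zero_near_segment]). The extensions in the different
local Banach spaces come from one function with values in the domain of [A], which
is sequentially complete for the graph topology as [A] is sequentially closed
([entire_extension]).

The complex analysis is developed for functions with values in a sequentially
complete normed space. Integrals along segments are limits of dyadic midpoint
sums. These are exactly additive under halving, which suits arguments by
[bisection]: the convergence of the sums, the fundamental theorem of calculus,
Goursat's theorem, and the propagation of zeros are all obtained in this way.
Residues are computed in star-shaped quadrilaterals, by contraction towards the
pole ([star_quad_eq0], [star_residue]). *)

Local Notation Re := complex.Re.
Local Notation Im := complex.Im.

(** * Modulus, norm and limits *)

Section modulus.
Context {R : realType}.
Implicit Types (z w : R[i]).

Lemma cabs_i : cabs ('i : R[i]) = 1.
Proof. by rewrite /cabs normc_def /= expr0n expr1n add0r sqrtr1. Qed.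

Lemma cabs_real (x : R) : cabs x%:C = `|x|.
Proof. by rewrite /cabs normc_def /= expr0n addr0 sqrtr_sqr. Qed.

Lemma cabs0 : cabs (0 : R[i]) = 0.
Proof. by rewrite -(rmorph0 (real_complex R)) cabs_real normr0. Qed.

Lemma cabs1 : cabs (1 : R[i]) = 1.
Proof. by rewrite -(rmorph1 (real_complex R)) cabs_real normr1. Qed.

Lemma cabsN z : cabs (- z) = cabs z.
Proof. by rewrite /cabs normrN. Qed.

Lemma cabsC z w : cabs (z - w) = cabs (w - z).
Proof. by rewrite -opprB cabsN. Qed.

Lemma cabs_eq0 z : (cabs z == 0) = (z == 0).
Proof.
apply/eqP/eqP => [z0|->]; last exact: cabs0.
by apply/eqP; rewrite -normr_eq0 -cabsE z0.
Qed.

Lemma cabs_gt0 z : (0 < cabs z) = (z != 0).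
Proof. by rewrite lt_neqAle cabs_ge0 andbT eq_sym cabs_eq0. Qed.

Lemma cabsV z : cabs z^-1 = (cabs z)^-1.
Proof.
have [->|z0] := eqVneq z 0; first by rewrite invr0 cabs0 invr0.
apply: (mulfI (x := cabs z)); first by rewrite cabs_eq0.
by rewrite -cabsM !divff ?cabs1// cabs_eq0.
Qed.

Lemma cabsX z n : cabs (z ^+ n) = cabs z ^+ n.
Proof. by elim: n => [|n IH]; rewrite ?expr0 ?cabs1// !exprS cabsM IH. Qed.

Lemma cabsB_ge z w : cabs z - cabs w <= cabs (z - w).
Proof. by rewrite lerBlDr -{1}(subrK w z) cabsD. Qed.

Lemma norm_Re_le z : `|Re z| <= cabs z.
Proof. by rewrite -lecR cabsE normc_ge_Re. Qed.

Lemma norm_Im_le z : `|Im z| <= cabs z.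
Proof.
have := norm_Re_le ('i * z); rewrite cabsM cabs_i mul1r.
by case: z => a b /=; rewrite mul0r mul1r sub0r normrN.
Qed.

Lemma cabs_le z : cabs z <= `|Re z| + `|Im z|.
Proof.
rewrite {1}(complexE z) (le_trans (cabsD _ _))// cabsM cabs_i mul1r.
by rewrite !cabs_real.
Qed.

End modulus.

Section limits.
Context {R : realType} {X : normedModType R[i]}.
Implicit Types (u : nat -> X) (l : X).

Lemma rnorm0 : rnorm (0 : X) = 0.
Proof. by rewrite /rnorm normr0. Qed.

Lemma rnormN (x : X) : rnorm (- x) = rnorm x.
Proof. by rewrite /rnorm normrN. Qed.

Lemma rnormB (x y : X) : rnorm (x - y) <= rnorm x + rnorm y.
Proof. by rewrite -(rnormN y) rnormD. Qed.

Lemma rnorm_sum (J : Type) (s : seq J) (F : J -> X) :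
  rnorm (\sum_(j <- s) F j) <= \sum_(j <- s) rnorm (F j).
Proof.
elim: s => [|j s IH]; rewrite ?big_nil ?rnorm0// !big_cons.
by rewrite (le_trans (rnormD _ _))// lerD2l.
Qed.

(** Main tool for proving that an integral vanishes. *)
Lemma rnorm_le_eps_eq0 (x : X) (C : R) :
  (forall e, 0 < e -> rnorm x <= e * C) -> x = 0.
Proof.
move=> xe; apply: rnorm0_eq0; apply/eqP; rewrite eq_le rnorm_ge0 andbT.
have C1 : 0 < `|C| + 1 by rewrite ltr_wpDl.
apply/ler_addgt0Pr => e e0; rewrite add0r.
have := xe _ (divr_gt0 e0 C1) => /le_trans; apply.
rewrite -mulrA -[leRHS]mulr1 ler_wpM2l ?(ltW e0)// mulrC ler_pdivrMr// mul1r.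
by rewrite (le_trans (ler_norm _))// lerDl.
Qed.

Lemma cvg_rnormP u l : u @ \oo --> l <->
  forall e : R, 0 < e -> exists n, forall i, (n <= i)%N -> rnorm (u i - l) <= e.
Proof.
split=> [ul e e0|ul].
  move/cvgrPdist_le: ul => /(_ e%:C); rewrite ltcR => /(_ e0) [n _ nP].
  by exists n => i ni; rewrite rdistC -lecR rnormE; apply: nP.
apply/cvgrPdist_le => e e0; rewrite -(ReK (ltW e0)).
have [|n nP] := ul (Re e); first by rewrite -ltcR ReK// ltW.
by exists n => // i /= ni; rewrite -rnormE lecR rdistC nP.
Qed.

Lemma cvg_rnorm_le u l (C : R) : (forall n, rnorm (u n) <= C) ->
  u @ \oo --> l -> rnorm l <= C.
Proof.
move=> uC /cvg_rnormP ul; apply/ler_addgt0Pr => e e0.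
have [n /(_ n (leqnn _)) ne] := ul e e0.
rewrite -(subrK (u n) l) (le_trans (rnormD _ _))// addrC lerD//.
by rewrite rdistC.
Qed.

(** The usual Cauchy criterion: a neighbourhood in the filter of double sequences
contains a square tail. *)
Lemma seq_complete_cvg u : seq_complete X ->
  (forall e : R, 0 < e -> exists n, forall i j, (n <= i)%N -> (n <= j)%N ->
     rnorm (u i - u j) <= e) ->
  exists l, u @ \oo --> l.
Proof.
move=> Xc cu; apply: Xc; apply/cvgrPdist_le => e e0; rewrite -(ReK (ltW e0)).
have [|n nP] := cu (Re e); first by rewrite -ltcR ReK// ltW.
exists ([set i | (n <= i)%N], [set i | (n <= i)%N]).
  by split; exists n.
by move=> [i j] /= [ni nj]; rewrite sub0r normrN -rnormE lecR nP.
Qed.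

End limits.

Lemma double_tailP (Q : nat * nat -> Prop) :
  (\forall mn \near (\oo, \oo), Q mn) <->
  exists n, forall i j, (n <= i)%N -> (n <= j)%N -> Q (i, j).
Proof.
split=> [[[A B] /= [[a _ Aa] [b _ Bb]] AB]|[n nP]].
  exists (maxn a b) => i j; rewrite !geq_max => /andP[ai _] /andP[_ bj].
  by apply: AB; split; [exact: Aa|exact: Bb].
exists ([set i | (n <= i)%N], [set i | (n <= i)%N]).
  by split; exists n.
by move=> [i j] /= [ni nj]; exact: nP.
Qed.

Lemma banach_seq_complete (R : realType) (X : completeNormedModType R[i]) :
  seq_complete X.
Proof.
move=> u /cvgrPdist_lt cu; apply/cvg_ex/cauchy_cvgP/cauchyseqP => e e0.
have /cu/double_tailP[n nP] : 0 < e%:C by rewrite ltcR.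
exists n => i j ni nj; have := nP i j ni nj.
by rewrite /= sub0r normrN -rnormE ltcR.
Qed.

(** The real and imaginary parts form Cauchy sequences. *)
Lemma complex_seq_complete (R : realType) : seq_complete (R[i]^o).
Proof.
move=> u /cvgrPdist_lt cu.
have part (f : R[i] -> R) : (forall x y, `|f x - f y| <= cabs (x - y)) ->
    exists l : R, f (u n) @[n --> \oo] --> l.
  move=> fP; apply/cvg_ex/cauchy_cvgP/cauchy_ballP => e e0.
  have /cu/double_tailP[n nP] : 0 < e%:C by rewrite ltcR.
  pose A := [set f (u i) | i in [set i | (n <= i)%N]].
  exists (A, A) => /=; first by split; exists n => // i /= ni; exists i.
  move=> [_ _] /= [[i ni <-] [j nj <-]].
  have := nP i j ni nj; rewrite /= sub0r normrN -ball_normE /=.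
  by rewrite -cabsE ltcR => /(le_lt_trans _); apply; exact: fP.
have [|a /cvgrPdist_le ua] := part (@complex.Re R).
  by move=> x y; rewrite -raddfB norm_Re_le.
have [|b /cvgrPdist_le ub] := part (@complex.Im R).
  by move=> x y; rewrite -raddfB norm_Im_le.
exists (a +i* b); apply/cvg_rnormP => e e0.
have e2 : 0 < e / 2 by rewrite divr_gt0.
have [n _ nP] := filterI (ua _ e2) (ub _ e2).
exists n => i ni; have /= [] := nP i ni.
rewrite -[rnorm _]/(cabs (u i - (a +i* b))) => ha hb.
rewrite (le_trans (cabs_le _))// !raddfB/= distrC (distrC (Im _)).
by lra.
Qed.

(** * Bisection *)

Section bisection.
Context {R : realType}.
Implicit Types (z : R[i]).

Lemma geometric_small (C e : R) : 0 < e -> 0 <= C ->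
  exists n, C / 2 ^+ n < e.
Proof.
move=> e0 C0; have := @cvg_geometric R C (2^-1) _.
have h : `|2^-1 : R| < 1 by rewrite ger0_norm ?invf_lt1 ?ltr1n.
move=> /(_ h)/cvgrPdist_lt/(_ e e0)[n _ /(_ n (leqnn n))].
rewrite /= sub0r normrN ger0_norm ?mulr_ge0 ?exprn_ge0 ?invr_ge0//.
by rewrite exprVn; exists n.
Qed.

(** A cell [s] has a reference point [ctr s] and a size [len s]; refining it
halves the size and moves the point by at most the old size. A property which
a cell inherits from its refinements, and which holds for all small cells
near any point of the closed set [K], holds for every cell: otherwise some
infinite chain of refinements fails it, and its points converge in [K]. *)
Lemma bisection (S J : Type) (ctr : S -> R[i]) (len : S -> R)
    (child : J -> S -> S) (K : set R[i]^o) (Q P : S -> Prop) :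
  closed K -> (forall s, 0 <= len s) ->
  (forall s, Q s -> K (ctr s)) ->
  (forall j s, Q s -> Q (child j s)) ->
  (forall j s, len (child j s) <= len s / 2) ->
  (forall j s, cabs (ctr (child j s) - ctr s) <= len s) ->
  (forall s, Q s -> (forall j, P (child j s)) -> P s) ->
  (forall z, K z -> exists2 d, 0 < d & forall s, Q s ->
     cabs (ctr s - z) <= 2 * len s -> len s < d -> P s) ->
  forall s, Q s -> P s.
Proof.
move=> Kcl len0 QK Qch lench ctrch Pch Ploc s0 Qs0; apply: contrapT => nPs0.
have step (s : {s | Q s /\ ~ P s}) :
    exists t : {s | Q s /\ ~ P s}, exists j, sval t = child j (sval s).
  case: s => s [Qs nPs] /=; apply: contrapT => nex; apply: nPs.
  apply: Pch => // j; apply: contrapT => nPj; apply: nex.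
  by exists (exist _ (child j s) (conj (Qch _ _ Qs) nPj)), j.
have [next nextP] := choice step.
pose c n := sval (iter n next (exist _ s0 (conj Qs0 nPs0))).
have Qc n : Q (c n) by rewrite /c; case: (iter n next _) => ? [].
have nPc n : ~ P (c n) by rewrite /c; case: (iter n next _) => ? [].
have cS n : exists j, c n.+1 = child j (c n) by exact: nextP.
have lenS n : len (c n.+1) <= len (c n) / 2 by have [j ->] := cS n.
have len_c n : len (c n) <= len s0 / 2 ^+ n.
  elim: n => [|n IH]; first by rewrite expr0 divr1.
  rewrite (le_trans (lenS n))// exprS invfM (mulrC 2^-1) mulrA.
  by rewrite ler_pM2r ?invr_gt0.
have tail n k : cabs (ctr (c (n + k)%N) - ctr (c n)) <=
    2 * len (c n) - 2 * len (c (n + k)%N).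
  elim: k => [|k IH]; first by rewrite addn0 !subrr cabs0.
  have [j cj] := cS (n + k)%N; have := lenS (n + k)%N.
  have := ctrch j (c (n + k)%N); rewrite addnS cj.
  have := cabsD (ctr (child j (c (n + k)%N)) - ctr (c (n + k)%N))
     (ctr (c (n + k)%N) - ctr (c n)).
  rewrite addrA subrK; lra.
have tail2 n i : (n <= i)%N -> cabs (ctr (c i) - ctr (c n)) <= 2 * len (c n).
  move=> /subnKC <-; have := tail n (i - n)%N; have := len0 (c (n + (i - n))%N).
  lra.
have [z cz] : exists z : R[i]^o, ctr (c n) @[n --> \oo] --> z.
  apply: (seq_complete_cvg (@complex_seq_complete R)) => e e0.
  have [|n ne] := @geometric_small (4 * len s0) e e0; first by rewrite mulr_ge0.
  exists n => i j /tail2 ni /tail2 nj; rewrite -[rnorm _]/(cabs _).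
  rewrite -[X in cabs X](subrKA (ctr (c n))) -(opprB (ctr (c j))).
  rewrite (le_trans (cabsD _ _))// cabsN.
  have := len_c n; rewrite -mulrA in ne; lra.
have Kz : K z.
  have := @closed_cvg _ _ \oo _ (fun n => ctr (c n) : R[i]^o) K Kcl _ z cz.
  by apply; apply: nearW => n; exact/QK/Qc.
have [d d0 dP] := Ploc z Kz.
have [n nd] := geometric_small d0 (len0 s0).
apply: (nPc n); apply: dP; [exact: Qc| |exact: le_lt_trans (len_c n) nd].
rewrite cabsC; apply: (@cvg_rnorm_le _ (R[i]^o : normedModType R[i])
  (fun k => ctr (c (n + k)%N) - ctr (c n) : R[i]^o)).
  by move=> k; apply: tail2; rewrite leq_addr.
apply: cvgB; last exact: cvg_cst.
have := cz; rewrite -(cvg_shiftn n (fun k => ctr (c k) : R[i]^o)).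
by under eq_fun do rewrite addnC.
Qed.

End bisection.

(** * Complex derivatives *)

(* The rules of continuity in pointwise form, so that they apply to
   lambda-abstractions. *)
Section continuity_rules.
Context {R : realType} {T : topologicalType} {X : normedModType R[i]}.
Implicit Types (f g : T -> X).
Lemma cont_cst z (x : X) : {for z, continuous (fun _ : T => x)}.
Proof. exact: cst_continuous. Qed.
Lemma contD f g z : {for z, continuous f} -> {for z, continuous g} ->
  {for z, continuous (fun w => f w + g w)}.
Proof. exact: continuousD. Qed.
Lemma contN f z : {for z, continuous f} -> {for z, continuous (fun w => - f w)}.
Proof. exact: continuousN. Qed.
Lemma contB f g z : {for z, continuous f} -> {for z, continuous g} ->
  {for z, continuous (fun w => f w - g w)}.
Proof. exact: continuousB. Qed.
Lemma contZ (a : T -> R[i]^o) f z : 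
  {for z, continuous a} -> {for z, continuous f} ->
  {for z, continuous (fun w => a w *: f w)}.
Proof. exact: continuousZ. Qed.
Lemma cont_id (z : R[i]^o) : {for z, continuous (fun w : R[i]^o => w)}.
Proof. exact: cvg_id. Qed.
Lemma contM (a b : T -> R[i]^o) z : 
  {for z, continuous a} -> {for z, continuous b} ->
  {for z, continuous (fun w => a w * b w : R[i]^o)}.
Proof. exact: continuousM. Qed.
Lemma contV (a : T -> R[i]^o) z : 
  a z != 0 -> {for z, continuous a} ->
  {for z, continuous (fun w => (a w)^-1 : R[i]^o)}.
Proof. exact: continuousV. Qed.
Lemma cont_sum n (F : nat -> T -> X) z : (forall i, {for z, continuous (F i)}) ->
  {for z, continuous (fun w => \sum_(i < n) F i w)}.
Proof.
move=> Fc; elim: n => [|n IH].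
  have -> : (fun w => \sum_(i < 0) F i w) = fun=> 0.
    by apply/funext => w; rewrite big_ord0.
  exact: cont_cst.
have -> : (fun w => \sum_(i < n.+1) F i w) =
    fun w => \sum_(i < n) F i w + F n w.
  by apply/funext => w; rewrite big_ord_recr.
by apply: contD; [exact: IH|exact: Fc].
Qed.
Lemma contX (a : T -> R[i]^o) n z : {for z, continuous a} ->
  {for z, continuous (fun w => a w ^+ n : R[i]^o)}.
Proof.
move=> ac; elim: n => [|n IH].
  have -> : (fun w => a w ^+ 0 : R[i]^o) = fun=> 1.
    by apply/funext => w; rewrite expr0.
  exact: cst_continuous.
have -> : (fun w => a w ^+ n.+1 : R[i]^o) = fun w => a w * a w ^+ n.
  by apply/funext => w; rewrite exprS.
by apply: contM; [exact: ac|exact: IH].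
Qed.
End continuity_rules.

Section derivative.
Context {R : realType}.
Local Notation C := (R[i]^o).

Lemma continuous_rnormP (X : normedModType R[i]) (f : C -> X) (z : C) :
  {for z, continuous f} <-> forall e : R, 0 < e ->
    exists2 d : R, 0 < d & forall w, cabs (w - z) < d -> rnorm (f w - f z) <= e.
Proof.
split=> [fz e e0|fz].
  move/cvgrPdist_le: fz => /(_ e%:C); rewrite ltcR => /(_ e0).
  move=> /nbhs_ballP[d /= d0 dP]; exists (Re d); first by rewrite -ltcR ReK// ltW.
  move=> w wz; rewrite rdistC -lecR rnormE; apply: dP.
  by rewrite -ball_normE /= -normrN opprB -cabsE -(ReK (ltW d0)) ltcR.
apply/(@cvgrPdist_le _ X _ (nbhs z) _ f (f z)) => e e0; rewrite -(ReK (ltW e0)).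
have [|d d0 dP] := fz (Re e); first by rewrite -ltcR ReK// ltW.
apply: (nbhs_ballP z _).2; exists d%:C; first by rewrite /= ltcR.
move=> w; rewrite -ball_normE /= -normrN opprB -cabsE ltcR => /dP.
by rewrite -rnormE lecR rdistC.
Qed.

(** Carathéodory's form: [phi] is the difference quotient, extended by the
derivative. The rules of differentiation reduce to those of continuity. *)
Definition has_deriv (X : normedModType R[i]) (f : C -> X) (z : C) (l : X) :=
  exists phi : C -> X, [/\ phi 0 = l, {for 0, continuous phi} &
    forall h, f (z + h) = f z + h *: phi h].

Section theory.
Context {X : normedModType R[i]}.
Implicit Types (f g : C -> X) (a : C -> C) (z : C) (l m : X).

Lemma has_derivP f z l : has_deriv f z l <-> forall e : R, 0 < e ->
  exists2 d : R, 0 < d & forall w, cabs (w - z) < d ->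
    rnorm (f w - f z - (w - z) *: l) <= e * cabs (w - z).
Proof.
split=> [[phi [<- /continuous_rnormP phic phiE]] e e0|fz].
  have [d d0 dP] := phic e e0; exists d => // w wd.
  rewrite -{1}(subrKC z w) phiE (addrC (f z)) addrK -scalerBr rnormZ mulrC.
  by rewrite ler_wpM2r ?cabs_ge0// dP// subr0.
exists (fun h => if h == 0 then l else h^-1 *: (f (z + h) - f z)).
split; first by rewrite eqxx.
  apply/continuous_rnormP => e e0; have [d d0 dP] := fz e e0.
  exists d => // h; rewrite subr0 eqxx => hd; case: eqVneq => [_|h0].
    by rewrite subrr rnorm0 ltW.
  have := dP (z + h); rewrite (addrC z) addrK => /(_ hd).
  have hgt : 0 < cabs h by rewrite cabs_gt0.
  rewrite -{1}(scale1r (f _ - _)) -(divff h0) -scalerA -scalerBr rnormZ mulrC.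
  by rewrite ler_pM2r.
move=> h; case: eqVneq => [->|h0]; first by rewrite addr0 scale0r addr0.
by rewrite scalerA divff// scale1r subrKC.
Qed.

Lemma has_deriv_cont f z l : has_deriv f z l -> {for z, continuous f}.
Proof.
move=> [phi [_ phic phiE]].
have -> : f = (fun w => f z + (w - z) *: phi (w - z)).
  by apply/funext => w; rewrite -phiE subrKC.
apply: contD; first exact: cont_cst.
have Bc : {for z, continuous (fun w : C => w - z)}.
  by apply: contB; [exact: cont_id|exact: cont_cst].
apply: contZ; first exact: Bc.
by apply: (continuous_comp Bc); rewrite subrr.
Qed.

Lemma has_deriv_near f g z l : (exists2 d : R, 0 < d &
  forall w, cabs (w - z) < d -> g w = f w) -> has_deriv f z l -> has_deriv g z l.
Proof.
move=> [d d0 gf] /has_derivP fz; apply/has_derivP => e /fz[d' d'0 fd].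
exists (Num.min d d'); first by rewrite lt_min d0.
move=> w; rewrite lt_min => /andP[wd wd'].
by rewrite !gf ?fd// subrr cabs0.
Qed.

(** The converse of Carathéodory's expansion. *)
Lemma has_deriv_expansion (phi : C -> X) (x : X) z : {for 0, continuous phi} ->
  has_deriv (fun w => x + (w - z) *: phi (w - z)) z (phi 0).
Proof.
move=> phic; exists phi; split; [by []|exact: phic|move=> h].
by rewrite subrr scale0r addr0 (addrC z) addrK.
Qed.

Lemma has_deriv_cst (x : X) z : has_deriv (fun=> x) z 0.
Proof.
exists (fun=> 0); split => //; first exact: cont_cst.
by move=> h; rewrite scaler0 addr0.
Qed.

Lemma has_derivD f g z l m : has_deriv f z l -> has_deriv g z m ->
  has_deriv (fun w => f w + g w) z (l + m).
Proof.
move=> [p [<- pc pE]] [q [<- qc qE]]; exists (fun h => p h + q h).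
by split; [by []|exact: contD|move=> h; rewrite pE qE scalerDr addrACA].
Qed.

Lemma has_derivN f z l : has_deriv f z l -> has_deriv (fun w => - f w) z (- l).
Proof.
move=> [p [<- pc pE]]; exists (fun h => - p h).
by split; [by []|exact: contN|move=> h; rewrite pE scalerN opprD].
Qed.

Lemma has_derivB f g z l m : has_deriv f z l -> has_deriv g z m ->
  has_deriv (fun w => f w - g w) z (l - m).
Proof. by move=> fz gz; apply: has_derivD => //; apply: has_derivN. Qed.

Lemma has_derivZ a f z (b : C) l : has_deriv a z b -> has_deriv f z l ->
  has_deriv (fun w => a w *: f w) z (b *: f z + a z *: l).
Proof.
move=> [p [<- pc pE]] [q [<- qc qE]].
exists (fun h => p h *: f z + a z *: q h + h *: (p h *: q h)); split.
- by rewrite scale0r addr0.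
- apply: contD; last by apply: contZ; [exact: cont_id|exact: contZ].
  apply: contD; first by apply: contZ; [exact: pc|exact: cont_cst].
  by apply: contZ; [exact: cont_cst|exact: qc].
- move=> h; rewrite pE qE -[h *: p h]/(h * p h) scalerDl !scalerDr !scalerA.
  rewrite -!addrA; congr (_ + _); rewrite addrCA (mulrC (a z)); congr (_ + _).
  by congr (_ + _); congr (_ *: _); ring.
Qed.

Lemma has_deriv_comp a f z (b : C) l : has_deriv a z b -> has_deriv f (a z) l ->
  has_deriv (fun w => f (a w)) z (b *: l).
Proof.
move=> [p [<- pc pE]] [q [<- qc qE]].
exists (fun h => p h *: q (h *: p h)); split; first by rewrite scale0r.
  have hc : {for 0, continuous (fun h : C => h *: p h)}.
    by apply: contZ; [exact: cont_id|exact: pc].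
  apply: contZ; first exact: pc.
  apply: (continuous_comp (g := q) hc).
  by rewrite scale0r.
by move=> h; rewrite pE qE scalerA.
Qed.

End theory.

Lemma has_deriv_id (z : C) : has_deriv (X := C) id z 1.
Proof.
exists (fun=> 1); split => //; first exact: cont_cst.
by move=> h; rewrite -[h *: _]/(h * 1) mulr1.
Qed.

Lemma has_derivV (z : C) : z != 0 ->
  has_deriv (X := C) (fun w => w^-1) z (- z^-1 ^+ 2).
Proof.
move=> z0; apply/has_derivP => e e0.
have c : {for z, continuous (fun w : C => - (z^-1 * w^-1) : C)}.
  apply: contN; apply: contM; first exact: cont_cst.
  by apply: contV; [exact: z0|exact: cont_id].
move/continuous_rnormP: c => /(_ e e0)[d d0 dP].
exists (Num.min d (cabs z)); first by rewrite lt_min d0 cabs_gt0.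
move=> w; rewrite lt_min => /andP[wd wz].
have w0 : w != 0.
  by apply: contraTneq wz => ->; rewrite sub0r cabsN ltxx.
have -> : w^-1 - z^-1 - (w - z) *: (- z^-1 ^+ 2 : C) =
    (w - z) *: (- (z^-1 * w^-1) - - (z^-1 * z^-1) : C).
  rewrite -[(w - z) *: _]/((w - z) * _) -[RHS]/((w - z) * _).
  by field; rewrite w0 z0.
rewrite rnormZ mulrC ler_wpM2r ?cabs_ge0//; exact: dP.
Qed.

End derivative.

(** * Integrals along segments *)

Section segments.
Context {R : realType}.
Local Notation C := (R[i]^o).
Implicit Types (p q z : C).

Definition segment p q : set C :=
  [set z | exists2 s : R, 0 <= s <= 1 & z = p + s%:C * (q - p)].

Definition midpoint p q : C := 2^-1 * (p + q).

Lemma segment_left p q : segment p q p.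
Proof. by exists 0; rewrite ?lexx ?ler01// rmorph0 mul0r addr0. Qed.

Lemma segment_right p q : segment p q q.
Proof. by exists 1; rewrite ?lexx ?ler01// rmorph1 mul1r subrKC. Qed.

Lemma segment_sym p q : segment p q = segment q p.
Proof.
suff sub p' q' : segment p' q' `<=` segment q' p'.
  by apply/seteqP; split; exact: sub.
move=> _ [s /andP[s0 s1] ->]; exists (1 - s).
  by rewrite subr_ge0 s1 lerBlDr lerDl.
by rewrite rmorphB rmorph1; ring.
Qed.

Lemma half_complex : (2^-1 : R)%:C = 2^-1 :> R[i].
Proof. by rewrite fmorphV rmorphD rmorph1. Qed.

Lemma segment_midl p q : segment p (midpoint p q) `<=` segment p q.
Proof.
move=> _ [s /andP[s0 s1] ->]; exists (s / 2); first by lra.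
by rewrite rmorphM /= half_complex /midpoint; field.
Qed.

Lemma midpointC p q : midpoint p q = midpoint q p.
Proof. by rewrite /midpoint addrC. Qed.

Lemma segment_midr p q : segment (midpoint p q) q `<=` segment p q.
Proof.
by rewrite segment_sym (segment_sym p) midpointC; exact: segment_midl.
Qed.

Lemma segment_mid p q : segment p q (midpoint p q).
Proof. by apply: segment_midl; exact: segment_right. Qed.

Lemma segment_dist p q z : segment p q z -> cabs (z - p) <= cabs (q - p).
Proof.
move=> [s /andP[s0 s1] ->]; rewrite addrAC subrr add0r cabsM cabs_real ger0_norm//.
by rewrite ler_piMl ?cabs_ge0.
Qed.

Lemma midpoint_subl p q : midpoint p q - p = 2^-1 * (q - p).
Proof. by rewrite /midpoint; field. Qed.

Lemma midpoint_subr p q : q - midpoint p q = 2^-1 * (q - p).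
Proof. by rewrite /midpoint; field. Qed.

Lemma cabs_half z : cabs (2^-1 * z) = cabs z / 2.
Proof. by rewrite cabsM -half_complex cabs_real ger0_norm// mulrC. Qed.

Definition convex_region (K : set C) :=
  forall p q, K p -> K q -> segment p q `<=` K.

Definition triangle a b c : set C := [set z | exists s t : R,
  [/\ 0 <= s, 0 <= t, s + t <= 1 & z = a + s%:C * (b - a) + t%:C * (c - a)]].

Lemma segment_triangle p q : segment p q = triangle p q q.
Proof.
apply/seteqP; split=> [_ [s /andP[s0 s1] ->]|_ [s [t [s0 t0 st ->]]]].
  by exists s, 0; split; rewrite ?addr0// rmorph0 mul0r addr0.
by exists (s + t); rewrite ?addr_ge0// rmorphD /=; ring.
Qed.

Lemma triangle_convex a b c : convex_region (triangle a b c).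
Proof.
move=> _ _ [s [t [s0 t0 st ->]]] [s' [t' [s'0 t'0 st' ->]]] _ [r /andP[r0 r1] ->].
exists (s + r * (s' - s)), (t + r * (t' - t)); split; [nra|nra|nra|].
by rewrite !rmorphD !rmorphM !rmorphB /=; ring.
Qed.

Lemma real_complex_continuous : continuous (fun x : R => x%:C : C).
Proof.
move=> x; apply/(@cvgrPdist_le _ C _ (nbhs x) _ (fun y : R => y%:C) _) => e e0.
have eE := ReK (ltW e0); rewrite -eE; rewrite -eE ltcR in e0.
apply/nbhs_ballP; exists (Re e) => //= y; rewrite -ball_normE /= => xy.
by rewrite -cabsE -rmorphB cabs_real lecR ltW.
Qed.

Lemma triangle_closed a b c : closed (triangle a b c).
Proof.
pose g (x : R * R) : C := a + x.1%:C * (b + x.2%:C * (c - b) - a).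
have -> : triangle a b c = g @` (`[0, 1] `*` `[0, 1]).
  apply/seteqP; split=> [_ [s [t [s0 t0 st ->]]]|_ [[x y] /= [+ +] <-]].
    have [st0|st0] := eqVneq (s + t) 0.
      have -> : s = 0 by lra.
      have -> : t = 0 by lra.
      exists (0, 0); first by split; rewrite /= in_itv /= lexx ler01.
      by rewrite /g /= !rmorph0 !mul0r !addr0.
    have st1 : 0 < s + t by lra.
    exists (s + t, t / (s + t)).
      split; rewrite /= in_itv /= ?addr_ge0//.
      by rewrite divr_ge0 ?addr_ge0//= ler_pdivrMr// mul1r lerDr.
    rewrite /g /= rmorphM fmorphV rmorphD /=; field.
    by rewrite -rmorphD /= -(rmorph0 (real_complex R)) (inj_eq (@complexI R)).
  rewrite /= !in_itv /= => /andP[x0 x1] /andP[y0 y1].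
  exists (x * (1 - y)), (x * y); split; [nra|nra|nra|].
  by rewrite /g /= !rmorphM rmorphB rmorph1 /=; ring.
apply: compact_closed; first exact: norm_hausdorff.
apply: continuous_compact; last by apply: compact_setX; exact: segment_compact.
apply: continuous_subspaceT => x.
have c1 : {for x, continuous (fun x : R * R => x.1%:C : C)}.
  by apply: (continuous_comp (@cvg_fst _ _ _ _ _)); exact: real_complex_continuous.
have c2 : {for x, continuous (fun x : R * R => x.2%:C : C)}.
  by apply: (continuous_comp (@cvg_snd _ _ _ _ _)); exact: real_complex_continuous.
apply: contD; first exact: cont_cst.
apply: contM; first exact: c1.
apply: contB; last exact: cont_cst.
apply: contD; first exact: cont_cst.
by apply: contM; [exact: c2|exact: cont_cst].
Qed.

Lemma segment_split p q z : segment p q z ->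
  segment p (midpoint p q) z \/ segment (midpoint p q) q z.
Proof.
move=> [s /andP[s0 s1] ->]; have [s2|s2] := leP s 2^-1; [left|right].
  exists (s * 2); first by lra.
  by rewrite midpoint_subl rmorphM rmorphD rmorph1; field.
exists (s * 2 - 1); first by lra.
by rewrite midpoint_subr rmorphB rmorphM rmorphD rmorph1 /midpoint; field.
Qed.

(** A property of segments that holds for a segment when it holds for its two
halves, and for all short segments near any given point. *)
Lemma segment_bisection (P : C -> C -> Prop) p q :
  (forall x y, P x (midpoint x y) -> P (midpoint x y) y -> P x y) ->
  (forall z, segment p q z -> exists2 d : R, 0 < d & forall x y,
     segment x y `<=` segment p q -> cabs (y - x) < d ->
     (forall w, segment x y w -> cabs (w - z) <= 3 * cabs (y - x)) -> P x y) ->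
  P p q.
Proof.
move=> Pmid Ploc.
pose child (b : bool) (s : C * C) := if b then (s.1, midpoint s.1 s.2)
  else (midpoint s.1 s.2, s.2).
apply: (@bisection R (C * C)%type bool (fun s => s.1)
  (fun s => cabs (s.2 - s.1)) child (segment p q)
  (fun s => segment s.1 s.2 `<=` segment p q) (fun s => P s.1 s.2)
  _ _ _ _ _ _ _ _ (p, q)).
- by rewrite segment_triangle; exact: triangle_closed.
- by move=> s; exact: cabs_ge0.
- by move=> s; apply; exact: segment_left.
- move=> [] [x y] /= sub z zs; apply: sub; first exact: segment_midl.
  exact: segment_midr.
- by move=> [] [x y] /=; rewrite ?midpoint_subl ?midpoint_subr cabs_half.
- move=> [] [x y] /=; first by rewrite subrr cabs0 cabs_ge0.
  by rewrite midpoint_subl cabs_half; have := cabs_ge0 (y - x); lra.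
- move=> [x y] _ Pxy; apply: Pmid; first exact: (Pxy true).
  exact: (Pxy false).
- move=> z /Ploc[d d0 dP]; exists d => // -[x y] /= sub xz xy.
  apply: dP => // w /segment_dist wx; rewrite -(subrKA x).
  by have := cabsD (w - x) (x - z); lra.
- by [].
Qed.

End segments.

Section integral.
Context {R : realType} {X : normedModType R[i]}.
Local Notation C := (R[i]^o).
Implicit Types (f g : C -> X) (p q z : C) (n : nat).

(** The dyadic midpoint rule. Being defined by halving, it is exactly additive
at midpoints and exactly symmetric, before any passage to the limit. *)
Fixpoint dyadic_mean f n p q : X :=
  if n is n'.+1 then
    2^-1 *: (dyadic_mean f n' p (midpoint p q) +
             dyadic_mean f n' (midpoint p q) q)
  else f (midpoint p q).

Definition cint f p q : X := (q - p) *: limn (fun n => dyadic_mean f n p q).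

Lemma scale_half2 (x : X) : 2^-1 *: (x + x) = x.
Proof. by rewrite -mulr2n -[x *+ 2]scaler_nat scalerA mulVf ?scale1r// pnatr_eq0. Qed.

Lemma dyadic_mean_near f n p q (x : X) (e : R) :
  (forall z, segment p q z -> rnorm (f z - x) <= e) ->
  rnorm (dyadic_mean f n p q - x) <= e.
Proof.
elim: n p q => [|n IH] p q fx /=; first by apply: fx; exact: segment_mid.
rewrite -[in X in _ - X](scale_half2 x) -scalerBr opprD addrACA.
rewrite rnormZ -half_complex cabs_real ger0_norm//.
have := IH p (midpoint p q) (fun z zs => fx z (segment_midl zs)).
have := IH (midpoint p q) q (fun z zs => fx z (segment_midr zs)).
set u := _ - x; set v := _ - x; have := rnormD v u; lra.
Qed.

Lemma dyadic_mean_sym f n p q : dyadic_mean f n p q = dyadic_mean f n q p.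
Proof.
elim: n p q => [|n IH] p q /=; first by rewrite midpointC.
by rewrite addrC (midpointC q) (IH (midpoint p q) q) (IH p).
Qed.

Lemma dyadic_mean_linear (a b : R[i]) f g n p q :
  dyadic_mean (fun z => a *: f z + b *: g z) n p q =
  a *: dyadic_mean f n p q + b *: dyadic_mean g n p q.
Proof.
elim: n p q => //= n IH p q; rewrite !IH.
by rewrite !scalerDr !scalerA !(mulrC 2^-1) addrACA.
Qed.

Lemma dyadic_mean_eq f g n p q : (forall z, segment p q z -> f z = g z) ->
  dyadic_mean f n p q = dyadic_mean g n p q.
Proof.
elim: n p q => [|n IH] p q fg /=; first by apply: fg; exact: segment_mid.
rewrite (IH p) ?(IH _ q)// => z zs; apply: fg; first exact: segment_midr.
exact: segment_midl.
Qed.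

(** For Goursat's theorem, where a function is compared with its affine
approximation. *)
Lemma dyadic_mean_affine (x y : X) n p q :
  dyadic_mean (fun z => x + z *: y) n p q = x + midpoint p q *: y.
Proof.
elim: n p q => //= n IH p q; rewrite !IH addrACA -scalerDl scalerDr scale_half2.
by rewrite scalerA; congr (_ + _ *: _); rewrite /midpoint; field.
Qed.

Definition continuous_along f p q := forall z, segment p q z -> {for z, continuous f}.

Hypothesis Xc : seq_complete X.

(** Near a point where [f] oscillates by less than [e], so do all its means; the
Cauchy property with tolerance [e] passes from the halves to the whole. *)
Lemma dyadic_mean_cvg f p q : continuous_along f p q ->
  cvgn (fun n => dyadic_mean f n p q).
Proof.
move=> fc; apply/cvg_ex; apply: (seq_complete_cvg Xc) => e e0.
apply: (segment_bisection (P := fun x y => exists n, forall i j,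
    (n <= i)%N -> (n <= j)%N ->
    rnorm (dyadic_mean f i x y - dyadic_mean f j x y) <= e)).
  move=> x y [n1 n1P] [n2 n2P].
  exists (maxn n1 n2).+1 => -[//|i] [//|j] /=.
  rewrite !ltnS !geq_max => /andP[i1 i2] /andP[j1 j2].
  rewrite -scalerBr opprD addrACA rnormZ -half_complex cabs_real ger0_norm//.
  have := n1P i j i1 j1; have := n2P i j i2 j2.
  set u := _ - _; set v := _ - _; have := rnormD v u; lra.
move=> z zs; have e2 : 0 < e / 2 by rewrite divr_gt0.
have /continuous_rnormP/(_ _ e2)[d d0 dP] := fc z zs.
exists (d / 3); first by rewrite divr_gt0.
move=> x y _ xy near; exists 0%N => i j _ _.
have nearz w : segment x y w -> rnorm (f w - f z) <= e / 2.
  by move=> /near wz; apply: dP; lra.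
have := dyadic_mean_near i nearz; have := dyadic_mean_near j nearz.
rewrite -[X in _ -> _ -> rnorm X <= _](subrKA (f z)) -(opprB (dyadic_mean f j x y)).
set u := _ - _; set v := _ - _; have := rnormB v u; lra.
Qed.

Lemma cint_cvg f p q : continuous_along f p q ->
  (q - p) *: dyadic_mean f n p q @[n --> \oo] --> cint f p q.
Proof. by move=> /dyadic_mean_cvg fc; apply: cvgZl_tmp. Qed.

Lemma cint_eqP f p q l : continuous_along f p q ->
  (q - p) *: dyadic_mean f n p q @[n --> \oo] --> l -> cint f p q = l.
Proof.
move=> fc fl.
exact: (cvg_unique (@norm_hausdorff _ X) (cint_cvg fc) fl).
Qed.

Lemma cint_near f p q x (e : R) : continuous_along f p q ->
  (forall z, segment p q z -> rnorm (f z - x) <= e) ->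
  rnorm (cint f p q - (q - p) *: x) <= cabs (q - p) * e.
Proof.
move=> fc fx; apply: (cvg_rnorm_le (u := fun n =>
   (q - p) *: dyadic_mean f n p q - (q - p) *: x)).
  move=> n; rewrite -scalerBr rnormZ ler_wpM2l ?cabs_ge0//.
  exact: dyadic_mean_near.
by apply: cvgB; [exact: cint_cvg|exact: cvg_cst].
Qed.

Lemma cint_bound f p q (M : R) : continuous_along f p q ->
  (forall z, segment p q z -> rnorm (f z) <= M) ->
  rnorm (cint f p q) <= cabs (q - p) * M.
Proof.
move=> fc fM; have := @cint_near f p q 0 M fc.
by rewrite scaler0 subr0; apply => z; rewrite subr0; exact: fM.
Qed.

Lemma cint_linear (a b : R[i]) f g p q :
  continuous_along f p q -> continuous_along g p q ->
  cint (fun z => a *: f z + b *: g z) p q = a *: cint f p q + b *: cint g p q.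
Proof.
move=> fc gc; apply: cint_eqP.
  move=> z zs; by apply: contD; (apply: contZ; first exact: cont_cst); [exact: fc|exact: gc].
under eq_fun do rewrite dyadic_mean_linear scalerDr !scalerA (mulrC _ a) (mulrC _ b) -!scalerA.
by apply: cvgD; apply: cvgZl_tmp; exact: cint_cvg.
Qed.

Lemma eq_cint f g p q : (forall z, segment p q z -> f z = g z) ->
  cint f p q = cint g p q.
Proof.
move=> fg; congr (_ *: limn _); apply/funext => n; exact: dyadic_mean_eq.
Qed.

Lemma cintD f g p q : continuous_along f p q -> continuous_along g p q ->
  cint (fun z => f z + g z) p q = cint f p q + cint g p q.
Proof.
move=> fc gc; rewrite -[cint f p q]scale1r -[cint g p q]scale1r -cint_linear//.
by apply: eq_cint => z _; rewrite !scale1r.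
Qed.

Lemma cintB f g p q : continuous_along f p q -> continuous_along g p q ->
  cint (fun z => f z - g z) p q = cint f p q - cint g p q.
Proof.
move=> fc gc; rewrite -[cint f p q]scale1r -[- cint g p q]scaleN1r -cint_linear//.
by apply: eq_cint => z _; rewrite scale1r scaleN1r.
Qed.

Lemma cintZ (a : R[i]) f p q : continuous_along f p q ->
  cint (fun z => a *: f z) p q = a *: cint f p q.
Proof.
move=> fc; rewrite -[RHS]addr0 -[X in _ + X](scale0r (cint f p q)) -cint_linear//.
by apply: eq_cint => z _; rewrite scale0r addr0.
Qed.

Lemma cint0 p q : cint (fun=> 0) p q = 0.
Proof.
rewrite -[RHS](scale0r (cint (fun=> 0) p q)) -cintZ => [|z _]; last exact: cont_cst.
by apply: eq_cint => z _; rewrite scaler0.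
Qed.

Lemma continuous_along_sum (n : nat) (F : nat -> C -> X) p q :
  (forall i, continuous_along (F i) p q) ->
  continuous_along (fun z => \sum_(i < n) F i z) p q.
Proof.
by move=> Fc z zs; apply: cont_sum => i; exact: Fc.
Qed.

Lemma cint_sum (n : nat) (F : nat -> C -> X) p q :
  (forall i, continuous_along (F i) p q) ->
  cint (fun z => \sum_(i < n) F i z) p q = \sum_(i < n) cint (F i) p q.
Proof.
move=> Fc; elim: n => [|n IH].
  by rewrite big_ord0 -[RHS](cint0 p q); apply: eq_cint => z _; rewrite big_ord0.
rewrite big_ord_recr /= -IH -cintD//; last exact: continuous_along_sum.
by apply: eq_cint => z _; rewrite big_ord_recr.
Qed.

Lemma cint_mid f p q : continuous_along f p q ->
  cint f p q = cint f p (midpoint p q) + cint f (midpoint p q) q.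
Proof.
move=> fc; have c1 : continuous_along f p (midpoint p q).
  by move=> z /segment_midl; exact: fc.
have c2 : continuous_along f (midpoint p q) q.
  by move=> z /segment_midr; exact: fc.
apply: cint_eqP => //; have := cint_cvg fc.
rewrite -(cvg_shiftS (fun n => (q - p) *: dyadic_mean f n p q)) /= => _.
rewrite -(cvg_shiftS (fun n => (q - p) *: dyadic_mean f n p q)) /=.
under eq_fun do rewrite scalerA mulrC scalerDr -{1}midpoint_subl -midpoint_subr.
by apply: cvgD; exact: cint_cvg.
Qed.

Lemma cint_sym f p q : cint f q p = - cint f p q.
Proof.
rewrite /cint -scaleNr opprB; congr (_ *: limn _).
by apply/funext => n; exact: dyadic_mean_sym.
Qed.

Lemma cint_affine (x y : X) p q :
  cint (fun z => x + z *: y) p q = (q - p) *: (x + midpoint p q *: y).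
Proof.
congr (_ *: _); under eq_fun do rewrite dyadic_mean_affine.
by rewrite lim_cst//; exact: norm_hausdorff.
Qed.

(** Boundedness passes from the halves of a segment to the whole. *)
Lemma continuous_along_bounded f p q : continuous_along f p q ->
  exists M : R, forall z, segment p q z -> rnorm (f z) <= M.
Proof.
move=> fc; apply: (segment_bisection (P := fun x y => exists M : R,
    forall z, segment x y z -> rnorm (f z) <= M)).
  move=> x y [M MP] [N NP]; exists (Num.max M N) => z /segment_split[/MP|/NP].
    by rewrite le_max => ->.
  by rewrite le_max orbC => ->.
move=> z /fc/continuous_rnormP/(_ 1 ltr01)[d d0 dP].
exists (d / 3); first by rewrite divr_gt0.
move=> x y _ xy near; exists (1 + rnorm (f z)) => w /near wz.
rewrite -(subrK (f z) (f w)) (le_trans (rnormD _ _))// lerD2r dP//; lra.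
Qed.

(** The defect of the formula is additive under halving, and on a short segment
it is small compared with the length. *)
Lemma cint_FTC f F p q : continuous_along f p q ->
  (forall z, segment p q z -> has_deriv F z (f z)) ->
  cint f p q = F q - F p.
Proof.
move=> fc Ff; apply/esym/eqP; rewrite -subr_eq0; apply/eqP.
apply: (rnorm_le_eps_eq0 (C := cabs (q - p))) => e e0.
have sub : segment p q `<=` segment p q by [].
move: sub; set Z := segment p q in fc Ff *; rewrite {1}/Z => sub.
suff : segment p q `<=` Z ->
    rnorm (F q - F p - cint f p q) <= e * cabs (q - p) by apply.
apply: (segment_bisection (P := fun x y => segment x y `<=` Z ->
    rnorm (F y - F x - cint f x y) <= e * cabs (y - x))).
  move=> x y P1 P2 sxy.
  have {P1} := P1 (fun z zs => sxy z (segment_midl zs)).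
  have {P2} := P2 (fun z zs => sxy z (segment_midr zs)).
  rewrite (cint_mid (fun z zs => fc z (sxy z zs))).
  rewrite midpoint_subl midpoint_subr !cabs_half.
  set m := midpoint x y.
  rewrite -[X in _ -> _ -> rnorm (X - _) <= _](subrKA (F m)).
  rewrite (addrC (cint f x m)) opprD addrACA.
  set u := F y - F m - _; set v := F m - F x - _; have := rnormD u v; lra.
move=> z zs; have e6 : 0 < e / 10 by rewrite divr_gt0.
have /has_derivP/(_ _ e6)[d1 d10 d1P] := Ff z zs.
have /continuous_rnormP/(_ _ e6)[d2 d20 d2P] := fc z zs.
exists (Num.min d1 d2 / 3); first by rewrite divr_gt0// lt_min d10.
move=> x y _; rewrite ltr_pdivlMr// mulrC lt_min => /andP[xy1 xy2] near sxy.
have := @cint_near f x y (f z) (e / 10) (fun z zs => fc z (sxy z zs)).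
move=> /(_ (fun w ws => d2P w (le_lt_trans (near w ws) xy2))).
have yz := near y (segment_right x y); have xz := near x (segment_left x y).
have := d1P _ (le_lt_trans yz xy1); have := d1P _ (le_lt_trans xz xy1).
have -> : F y - F x - cint f x y = (F y - F z - (y - z) *: f z) -
    (F x - F z - (x - z) *: f z) - (cint f x y - (y - x) *: f z).
  have -> : y - x = (y - z) - (x - z) by rewrite opprB subrKA.
  rewrite [(_ - _ - (_ - _)) *: _]scalerBl.
  set a := (y - z) *: _; set b := (x - z) *: _.
  have -> : F y - F z - a - (F x - F z - b) = F y - F x - (a - b).
    by rewrite opprD addrACA -opprD (opprD (F x)) addrACA subrr addr0.
  by rewrite [- (cint _ _ _ - _)]opprB subrKA.
set u := F y - F z - (y - z) *: _; set v := F x - F z - (x - z) *: _; set t := cint _ _ _ - _.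
have := ler_wpM2l (ltW e6) yz; have := ler_wpM2l (ltW e6) xz.
have := mulr_ge0 (ltW e0) (cabs_ge0 (y - x)).
have := rnormB (u - v) t; have := rnormB u v; lra.
Qed.

End integral.

(** * Cauchy's theorem *)

Section cauchy.
Context {R : realType} {X : normedModType R[i]}.
Local Notation C := (R[i]^o).
Implicit Types (f g : C -> X) (p q w z : C).

Definition cdiff f z := exists l, has_deriv f z l.

Lemma cdiff_cont f z : cdiff f z -> {for z, continuous f}.
Proof. by move=> [l]; exact: has_deriv_cont. Qed.

Lemma cdiffZ (a : C -> C) f z : (exists b : C, has_deriv a z b) ->
  cdiff f z -> cdiff (fun w => a w *: f w) z.
Proof. by move=> [b ab] [l fl]; eexists; exact: has_derivZ ab fl. Qed.

Hypothesis Xc : seq_complete X.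

Definition triangle_int f a b c := cint f a b + cint f b c + cint f c a.

(** Every edge of the central triangle is traversed in both directions. *)
Lemma triangle_int_quarter f (K : set C) a b c : convex_region K ->
  (forall z, K z -> cdiff f z) -> K a -> K b -> K c ->
  let ab := midpoint a b in let bc := midpoint b c in
  let ca := midpoint c a in
  triangle_int f a b c = triangle_int f a ab ca + triangle_int f ab b bc +
    (triangle_int f ca bc c + triangle_int f bc ca ab).
Proof.
move=> Kcv fK Ka Kb Kc ab bc ca.
have along p q : K p -> K q -> continuous_along f p q.
  by move=> Kp Kq z /(Kcv p q Kp Kq)/fK/cdiff_cont.
rewrite /triangle_int (cint_mid Xc (along a b Ka Kb)).
rewrite (cint_mid Xc (along b c Kb Kc)) (cint_mid Xc (along c a Kc Ka)).
rewrite -/ab -/bc -/ca (cint_sym f ca ab) (cint_sym f ab bc) (cint_sym f bc ca).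
move: (cint f a ab) (cint f ab b) (cint f b bc) (cint f bc c) (cint f c ca)
  (cint f ca a) (cint f ca ab) (cint f ab bc) (cint f bc ca) => x1 x2 y1 y2 z1 z2 u v t.
rewrite [in RHS](addrAC x1) [in RHS](addrC (- t)) [in RHS](addrAC y2) -(addrA t).
rewrite [in RHS]subrKA.
rewrite [X in _ = X + _]addrACA -opprD [X in _ = _ + X]addrC subrKA.
by rewrite -!addrA; congr (_ + _); rewrite [RHS]addrCA; congr (_ + _);
  rewrite [RHS]addrCA; congr (_ + _); rewrite [RHS]addrC -addrA.
Qed.

Lemma triangle_int_affine (x y : X) a b c :
  triangle_int (fun z => x + z *: y) a b c = 0.
Proof.
have E p q : cint (fun z => x + z *: y) p q =
    (q *: x + (2^-1 * q ^+ 2) *: y) - (p *: x + (2^-1 * p ^+ 2) *: y).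
  rewrite cint_affine scalerDr scalerA opprD addrACA -!scalerBl.
  by congr (_ + _ *: _); rewrite /midpoint; field.
by rewrite /triangle_int !E (addrC (_ - _) (_ - _)) !subrKA subrr.
Qed.

Definition perimeter a b c : R := cabs (b - a) + cabs (c - b) + cabs (a - c).

(** A triangle is cut by its midpoints into four similar ones; the
bound by the square of the perimeter is additive under this subdivision, and
near a point of differentiability it holds with an arbitrarily small constant. *)
Theorem goursat f (K : set C) a b c : closed K -> convex_region K ->
  (forall z, K z -> cdiff f z) -> K a -> K b -> K c -> triangle_int f a b c = 0.
Proof.
move=> Kcl Kcv fK Ka Kb Kc.
have along p q : K p -> K q -> continuous_along f p q.
  by move=> Kp Kq z /(Kcv p q Kp Kq)/fK/cdiff_cont.
apply: (rnorm_le_eps_eq0 (C := perimeter a b c ^+ 2)) => e e0.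
have Kmid p q : K p -> K q -> K (midpoint p q).
  by move=> Kp Kq; apply: (Kcv p q) => //; exact: segment_mid.
pose child (j : bool * bool) (s : C * C * C) : C * C * C :=
  let: (a, b, c) := s in
  let ab := midpoint a b in let bc := midpoint b c in let ca := midpoint c a in
  match j with
  | (true, true) => (a, ab, ca) | (true, false) => (ab, b, bc)
  | (false, true) => (ca, bc, c) | (false, false) => (bc, ca, ab)
  end.
have half (x y : C) : x = 2^-1 * y \/ x = 2^-1 * (- y) -> cabs x = cabs y / 2.
  by move=> [->|->]; rewrite cabs_half ?cabsN.
have childlen j x y t : let: (x', y', t') := child j (x, y, t) in
    perimeter x' y' t' = perimeter x y t / 2 /\ cabs (x' - x) <= perimeter x y t.
  have x0 := cabs_ge0 (y - x); have y0 := cabs_ge0 (t - y).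
  have t0 := cabs_ge0 (x - t).
  case: j => [[] []] /=; rewrite /perimeter; set xy := midpoint x y;
    set yt := midpoint y t; set tx := midpoint t x.
  - rewrite (half (xy - x) (y - x)) ?(half (tx - xy) (t - y)) ?(half (x - tx) (x - t));
      try by left; rewrite /xy /tx /midpoint; field.
    by rewrite subrr cabs0; lra.
  - rewrite (half (y - xy) (y - x)) ?(half (yt - y) (t - y)) ?(half (xy - yt) (x - t))
      ?(half (xy - x) (y - x)); try by left; rewrite /xy /yt /midpoint; field.
    lra.
  - rewrite (half (yt - tx) (y - x)) ?(half (t - yt) (t - y)) ?(half (tx - t) (x - t));
      try by left; rewrite /yt /tx /midpoint; field.
    rewrite (half (tx - x) (x - t)); first lra.
    by right; rewrite /tx /midpoint; field.
  - rewrite (half (tx - yt) (y - x)) ?(half (xy - tx) (t - y)) ?(half (yt - xy) (x - t));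
      try by right; rewrite /xy /yt /tx /midpoint; field.
    have := cabsD (yt - y) (y - x); rewrite addrA subrK.
    rewrite (half (yt - y) (t - y)); last by left; rewrite /yt /midpoint; field.
    lra.
have Echild j s : child j s = child j (s.1.1, s.1.2, s.2) by case: s => [[]].
apply: (@bisection R (C * C * C)%type (bool * bool)%type (fun s => s.1.1)
  (fun s => perimeter s.1.1 s.1.2 s.2) child K
  (fun s => [/\ K s.1.1, K s.1.2 & K s.2])
  (fun s => rnorm (triangle_int f s.1.1 s.1.2 s.2) <=
     e * perimeter s.1.1 s.1.2 s.2 ^+ 2) _ _ _ _ _ _ _ _ ((a, b), c)) => //.
- by move=> s; rewrite /perimeter !addr_ge0 ?cabs_ge0.
- by move=> s [].
- by move=> [[] []] [[x y] t] /= [Kx Ky Kt]; split=> //; exact: Kmid.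
- move=> j [[x y] t]; have := childlen j x y t.
  by case: (child j (x, y, t)) => -[x' y'] t' /= [-> _].
- move=> j [[x y] t]; have := childlen j x y t.
  by case: (child j (x, y, t)) => -[x' y'] t' /= [].
- move=> [[x y] t] /= [Kx Ky Kt] Pch.
  rewrite (triangle_int_quarter Kcv fK Kx Ky Kt).
  have := Pch (true, true); have := Pch (true, false).
  have := Pch (false, true); have := Pch (false, false).
  have := childlen (true, true) x y t; have := childlen (true, false) x y t.
  have := childlen (false, true) x y t; have := childlen (false, false) x y t.
  move=> /= [-> _] [-> _] [-> _] [-> _].
  set t1 := triangle_int f x _ _; set t2 := triangle_int f _ y _.
  set t3 := triangle_int f _ _ t; set t4 := triangle_int f _ _ _.
  have := rnormD (t1 + t2) (t3 + t4); have := rnormD t1 t2.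
  by have := rnormD t3 t4; rewrite expr_div_n; lra.
- move=> z Kz; have [l /has_derivP fl] := fK z Kz.
  have [|d d0 dP] := fl (e / 4); first by rewrite divr_gt0.
  exists (d / 4); first by rewrite divr_gt0.
  move=> [[x y] t] /= [Kx Ky Kt]; set L := perimeter x y t => xz Ld.
  pose c0 := f z - z *: l.
  have x0 := cabs_ge0 (y - x); have y0 := cabs_ge0 (t - y).
  have t0 := cabs_ge0 (x - t).
  have L0 : 0 <= L by rewrite /L /perimeter !addr_ge0.
  have edge p q : K p -> K q -> cabs (p - z) + cabs (q - p) <= 4 * L ->
      rnorm (cint f p q - cint (fun z => c0 + z *: l) p q) <=
      cabs (q - p) * (e * L).
    move=> Kp Kq pq.
    have ac : continuous_along (fun z => c0 + z *: l) p q.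
      move=> w _; apply: contD; first exact: cont_cst.
      by apply: contZ; [exact: cont_id|exact: cont_cst].
    rewrite -(cintB Xc (along p q Kp Kq) ac); apply: cint_bound => //.
      by move=> w ws; apply: contB; [exact: along ws|exact: ac ws].
    move=> w /segment_dist wp.
    have wz : cabs (w - z) <= 4 * L.
      by rewrite -(subrKA p); have := cabsD (w - p) (p - z); lra.
    have -> : f w - (c0 + w *: l) = f w - f z - (w - z) *: l.
      by rewrite /c0 scalerBl -(addrA (f z)) (addrC (- _)) opprD addrA.
    have wd : cabs (w - z) < d by lra.
    by have := dP w wd; have := ler_wpM2l (ltW e0) wz; lra.
  rewrite -[triangle_int f x y t]subr0 -(triangle_int_affine c0 l x y t).
  rewrite /triangle_int opprD addrACA opprD [X in rnorm (X + _)]addrACA.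
  have yz : cabs (y - z) <= cabs (y - x) + cabs (x - z).
    by rewrite -[y - z](subrKA x) cabsD.
  have tz : cabs (t - z) <= cabs (x - t) + cabs (x - z).
    by rewrite -[t - z](subrKA x) (cabsC x t) cabsD.
  have := edge x y Kx Ky; have := edge y t Ky Kt; have := edge t x Kt Kx.
  rewrite /L /perimeter in xz Ld L0 *.
  set u := cint f x y - _; set v := cint f y t - _; set r := cint f t x - _.
  have := rnormD (u + v) r; have := rnormD u v.
  move=> h1 h2 h3 h4 h5.
  have {}h3 : rnorm r <= _ := h3 ltac:(lra).
  have {}h4 : rnorm v <= _ := h4 ltac:(lra).
  have {}h5 : rnorm u <= _ := h5 ltac:(lra).
  set l1 := cabs (y - x) in h3 h4 h5 *; set l2 := cabs (t - y) in h3 h4 h5 *.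
  set l3 := cabs (x - t) in h3 h4 h5 *.
  have -> : e * (l1 + l2 + l3) ^+ 2 = l1 * (e * (l1 + l2 + l3)) +
    l2 * (e * (l1 + l2 + l3)) + l3 * (e * (l1 + l2 + l3)) by ring.
  have h6 := lerD (lerD h5 h4) h3.
  by rewrite (le_trans h2)// (le_trans _ h6)// lerD2r.
Qed.

End cauchy.

(** * Residues in star-shaped quadrilaterals *)

Section cross.
Context {R : realType}.
Implicit Types (u v : R[i]).

(** Twice the signed area of the triangle with vertices [0], [u], [v]. *)
Definition cross u v : R := Re u * Im v - Im u * Re v.

Lemma cross_le u v : cross u v <= 2 * cabs u * cabs v.
Proof.
have := norm_Re_le u; have := norm_Im_le u.
have := norm_Re_le v; have := norm_Im_le v; rewrite !ler_norml /cross.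
by move=> /andP[? ?] /andP[? ?] /andP[? ?] /andP[? ?]; nra.
Qed.

Lemma cross_comb0 u v (l m : R) : cross u v != 0 ->
  l%:C * u + m%:C * v = 0 -> l = 0 /\ m = 0.
Proof.
case: u v => a b [c d]; rewrite /cross /= => uv0 [] /= e1 e2.
have l0 : l * (a * d - b * c) = 0.
  transitivity ((l * a - 0 * b + (m * c - 0 * d)) * d -
    (l * b + 0 * a + (m * d + 0 * c)) * c); first ring.
  by rewrite e1 e2; ring.
have m0 : m * (a * d - b * c) = 0.
  transitivity ((l * b + 0 * a + (m * d + 0 * c)) * a -
    (l * a - 0 * b + (m * c - 0 * d)) * b); first ring.
  by rewrite e1 e2; ring.
move/eqP: l0; rewrite mulf_eq0 (negbTE uv0) orbF => /eqP ->.
by move/eqP: m0; rewrite mulf_eq0 (negbTE uv0) orbF => /eqP ->.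
Qed.

Lemma cross_segment u v (t : R) :
  cross (u + t%:C * (v - u)) (v - u) = cross u v.
Proof. by case: u v => a b [c d]; rewrite /cross /=; ring. Qed.

End cross.

Section star.
Context {R : realType} {X : normedModType R[i]} (Xc : seq_complete X).
Local Notation C := (R[i]^o).
Implicit Types (f g : C -> X) (a b c d p q w z : C).

Lemma triangle_vertices a b c :
  [/\ triangle a b c a, triangle a b c b & triangle a b c c].
Proof.
split; [exists 0, 0|exists 1, 0|exists 0, 1]; split;
  rewrite ?lexx ?ler01 ?addr0 ?add0r// ?rmorph0 ?rmorph1; ring.
Qed.

(** The homothety with centre [w] and ratio [s]. *)
Definition shrink w (s : R) p : C := w + s%:C * (p - w).

Lemma shrink_triangle w (s : R) p q z : 0 < s <= 1 ->
  0 < cross (p - w) (q - w) ->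
  triangle p q (shrink w s q) z \/ triangle p (shrink w s q) (shrink w s p) z ->
  triangle w p q z /\ z <> w.
Proof.
move=> /andP[s0 s1] pq.
have comb (l m : R) : 0 <= l -> 0 <= m -> 0 < l + m <= 1 ->
    z = w + l%:C * (p - w) + m%:C * (q - w) -> triangle w p q z /\ z <> w.
  move=> l0 m0 /andP[lm0 lm1] zE; split; first by exists l, m.
  move=> zw; have [|l00 m00] := @cross_comb0 R (p - w) (q - w) l m (lt0r_neq0 pq).
    by apply: (addrI w); rewrite addrA -zE zw addr0.
  by rewrite l00 m00 addr0 ltxx in lm0.
case=> -[x [y [x0 y0 xy zE]]].
  apply: (comb (1 - x - y) (x + y * s)); [lra|nra|nra|].
  by rewrite zE /shrink !(rmorphD, rmorphN, rmorphM, rmorph1); ring.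
apply: (comb (1 - x - y + y * s) (x * s)); [nra|nra|nra|].
by rewrite zE /shrink !(rmorphD, rmorphN, rmorphM, rmorph1); ring.
Qed.

(** The trapezoid between an edge and its contraction towards [w] consists of
two triangles that avoid [w]. *)
Lemma star_edge g w (s : R) p q : 0 < s <= 1 -> 0 < cross (p - w) (q - w) ->
  (forall z, triangle w p q z -> z <> w -> cdiff g z) ->
  cint g p q = cint g (shrink w s p) (shrink w s q) +
    (cint g p (shrink w s p) - cint g q (shrink w s q)).
Proof.
move=> s01 pq gd; set p' := shrink w s p; set q' := shrink w s q.
have [k1 k2 k3] := triangle_vertices p q q'.
have [l1 l2 l3] := triangle_vertices p q' p'.
have t1 : triangle_int g p q q' = 0.
  apply: (goursat Xc (K := triangle p q q')) => //.
  - exact: triangle_closed.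
  - exact: triangle_convex.
  - by move=> z zt; have [|? ?] := @shrink_triangle w s p q z s01 pq; [left|exact: gd].
have t2 : triangle_int g p q' p' = 0.
  apply: (goursat Xc (K := triangle p q' p')) => //.
  - exact: triangle_closed.
  - exact: triangle_convex.
  - by move=> z zt; have [|? ?] := @shrink_triangle w s p q z s01 pq; [right|exact: gd].
move: t1 t2; rewrite /triangle_int (cint_sym g p q') (cint_sym g p' q') (cint_sym g p p').
move=> /eqP; rewrite subr_eq0 => /eqP <-.
move=> /eqP; rewrite -addrA -opprD subr_eq0 => /eqP E.
by rewrite addrA -E addrK.
Qed.

Lemma shrink_segment w (s : R) p q z :
  segment (shrink w s p) (shrink w s q) z ->
  exists2 t, 0 <= t <= 1 & z - w = s%:C * (p - w + t%:C * (q - w - (p - w))).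
Proof. by move=> [t t01 ->]; exists t => //; rewrite /shrink; ring. Qed.

(** The contracted edge is shorter by the factor [s], and so is its distance
to [w]: this balances a pole of order one. *)
Lemma star_edge_small g w p q : 0 < cross (p - w) (q - w) ->
  (forall z, triangle w p q z -> z <> w -> cdiff g z) ->
  (forall e : R, 0 < e -> exists2 d : R, 0 < d & forall z, z != w ->
     cabs (z - w) < d -> rnorm (g z) * cabs (z - w) <= e) ->
  exists K : R, forall e : R, 0 < e -> exists2 s0 : R, 0 < s0 & forall s : R,
    0 < s < s0 -> rnorm (cint g (shrink w s p) (shrink w s q)) <= e * K.
Proof.
move=> pq gd gw; set u := p - w in pq; set v := q - w in pq.
have uv0 : 0 < cabs (v - u).
  rewrite cabs_gt0; apply: contraTneq pq => /subr0_eq ->.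
  by rewrite /cross mulrC subrr ltxx.
pose m := cross u v / (2 * cabs (v - u)).
have m0 : 0 < m by rewrite divr_gt0// mulr_gt0.
(* The area of the triangle bounds the distance of its edge from w. *)
have far (t : R) : m <= cabs (u + t%:C * (v - u)).
  rewrite ler_pdivrMr ?mulr_gt0// -(cross_segment u v t).
  by rewrite (le_trans (cross_le _ _))// mulrCA mulrA.
pose M := cabs u + cabs (v - u).
have close (t : R) : 0 <= t <= 1 -> cabs (u + t%:C * (v - u)) <= M.
  move=> /andP[t0 t1]; rewrite (le_trans (cabsD _ _))// lerD2l cabsM cabs_real.
  by rewrite ger0_norm// ler_piMl// ltW.
exists (cabs (v - u) / m) => e e0.
have [d d0 dP] := gw e e0.
have M0 : 0 < M by rewrite ltr_wpDl// cabs_ge0.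
exists (Num.min 1 (d / M)); first by rewrite lt_min ltr01 divr_gt0.
move=> s /andP[s0]; rewrite lt_min ltr_pdivlMr// => /andP[s1 sM].
have edge z : segment (shrink w s p) (shrink w s q) z ->
    triangle w p q z /\ z <> w.
  move=> zs; apply: (@shrink_triangle w s) => //; first by rewrite s0 ltW.
  right; move: z zs; apply: triangle_convex.
    by have [] := triangle_vertices p (shrink w s q) (shrink w s p).
  by have [] := triangle_vertices p (shrink w s q) (shrink w s p).
have dist z : segment (shrink w s p) (shrink w s q) z ->
    s * m <= cabs (z - w) <= s * M.
  move=> /shrink_segment[t t01 ->]; rewrite cabsM cabs_real gtr0_norm//.
  by rewrite !ler_pM2l// far close.
apply: (le_trans (cint_bound Xc (M := e / (s * m)) _ _)).
- by move=> z /edge[zt zw]; apply: cdiff_cont; exact: gd.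
- move=> z zs; have [zt /eqP zw] := edge z zs; have /andP[d1 d2] := dist z zs.
  have sm : 0 < s * m by rewrite mulr_gt0.
  rewrite ler_pdivlMr// (le_trans _ (dP z zw (le_lt_trans d2 sM)))//.
  by rewrite ler_wpM2l// rnorm_ge0.
- have -> : shrink w s q - shrink w s p = s%:C * (v - u).
    by rewrite /shrink /u /v; ring.
  rewrite cabsM cabs_real gtr0_norm// (_ : _ * _ = e * (cabs (v - u) / m))//.
  by field; rewrite !gt_eqF.
Qed.

Definition quad_int f a b c d := cint f a b + cint f b c + cint f c d + cint f d a.

(** The quadrilateral winds once around [w], counterclockwise, and every ray
from [w] meets it once. *)
Definition star w a b c d :=
  [/\ 0 < cross (a - w) (b - w), 0 < cross (b - w) (c - w),
      0 < cross (c - w) (d - w) & 0 < cross (d - w) (a - w)].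

Definition star_region w a b c d : set C := triangle w a b `|` triangle w b c `|`
  (triangle w c d `|` triangle w d a).

(** The integral does not change when the quadrilateral is contracted towards [w],
and it tends to zero because the singularity is weaker than a simple pole. *)
Theorem star_quad_eq0 g w a b c d : star w a b c d ->
  (forall z, star_region w a b c d z -> z <> w -> cdiff g z) ->
  (forall e : R, 0 < e -> exists2 r : R, 0 < r & forall z, z != w ->
     cabs (z - w) < r -> rnorm (g z) * cabs (z - w) <= e) ->
  quad_int g a b c d = 0.
Proof.
move=> [ab bc cd da] gd gw.
have gab z : triangle w a b z -> z <> w -> cdiff g z by move=> zt; apply: gd; left; left.
have gbc z : triangle w b c z -> z <> w -> cdiff g z by move=> zt; apply: gd; left; right.
have gcd z : triangle w c d z -> z <> w -> cdiff g z by move=> zt; apply: gd; right; left.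
have gda z : triangle w d a z -> z <> w -> cdiff g z by move=> zt; apply: gd; right; right.
have [K1 K1P] := star_edge_small ab gab gw.
have [K2 K2P] := star_edge_small bc gbc gw.
have [K3 K3P] := star_edge_small cd gcd gw.
have [K4 K4P] := star_edge_small da gda gw.
apply: (rnorm_le_eps_eq0 (C := K1 + K2 + K3 + K4)) => e e0.
have [s1 s10 s1P] := K1P e e0; have [s2 s20 s2P] := K2P e e0.
have [s3 s30 s3P] := K3P e e0; have [s4 s40 s4P] := K4P e e0.
pose s := Num.min (Num.min 1 (Num.min s1 s2)) (Num.min s3 s4) / 2.
have mins : 0 < Num.min (Num.min 1 (Num.min s1 s2)) (Num.min s3 s4).
  by rewrite !lt_min ltr01 s10 s20 s30 s40.
have s0 : 0 < s by rewrite divr_gt0.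
have : s < Num.min (Num.min 1 (Num.min s1 s2)) (Num.min s3 s4) by rewrite /s; lra.
rewrite !lt_min => /andP[/andP[sl1 /andP[ss1 ss2]] /andP[ss3 ss4]].
have s01 : 0 < s <= 1 by rewrite s0 ltW.
have b1 : rnorm _ <= _ := s1P s ltac:(by rewrite s0).
have b2 : rnorm _ <= _ := s2P s ltac:(by rewrite s0).
have b3 : rnorm _ <= _ := s3P s ltac:(by rewrite s0).
have b4 : rnorm _ <= _ := s4P s ltac:(by rewrite s0).
rewrite /quad_int (star_edge s01 ab gab) (star_edge s01 bc gbc).
rewrite (star_edge s01 cd gcd) (star_edge s01 da gda).
set r1 := cint g a _; set r2 := cint g b _; set r3 := cint g c _; set r4 := cint g d _.
set t1 := cint g _ (shrink w s b) in b1 *; set t2 := cint g _ (shrink w s c) in b2 *.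
set t3 := cint g _ (shrink w s d) in b3 *; set t4 := cint g _ (shrink w s a) in b4 *.
have -> : t1 + (r1 - r2) + (t2 + (r2 - r3)) + (t3 + (r3 - r4)) + (t4 + (r4 - r1)) =
    t1 + t2 + t3 + t4.
  rewrite (addrACA t1) subrKA (addrACA (t1 + t2)) subrKA.
  by rewrite (addrACA (t1 + t2 + t3)) subrKA subrr addr0.
have := rnormD (t1 + t2 + t3) t4; have := rnormD (t1 + t2) t3.
have := rnormD t1 t2; lra.
Qed.

End star.

Section scalar_integrals.
Context {R : realType} {X : normedModType R[i]}.
Local Notation C := (R[i]^o).
Implicit Types (p q w z : C).

Lemma cint_scale (a : C -> C) (x : X) p q : seq_complete X -> continuous_along a p q ->
  cint (fun z => a z *: x) p q = cint a p q *: x.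
Proof.
move=> Xc ac; apply: (cint_eqP Xc).
  by move=> z zs; apply: contZ; [exact: ac|exact: cont_cst].
have E n : dyadic_mean (fun z => a z *: x) n p q = dyadic_mean a n p q *: x.
  elim: n p q {ac} => //= n IH p q.
  by rewrite !IH -scalerDl scalerA.
under eq_fun do rewrite E scalerA.
exact: cvgZr_tmp (cint_cvg (@complex_seq_complete R) ac).
Qed.

Lemma dyadic_mean_Im_ge (a : C -> C) (k : R[i]) p q n (m : R) :
  (forall z, segment p q z -> m <= Im (k * a z)) ->
  m <= Im (k * dyadic_mean a n p q).
Proof.
elim: n p q => [|n IH] p q ka /=; first by apply: ka; exact: segment_mid.
have h1 := IH p _ (fun z zs => ka z (segment_midl zs)).
have h2 := IH _ q (fun z zs => ka z (segment_midr zs)).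
have -> : k * (2^-1 *: (dyadic_mean a n p (midpoint p q) +
    dyadic_mean a n (midpoint p q) q) : R[i]) =
    (2^-1 : R)%:C * (k * dyadic_mean a n p (midpoint p q) +
    k * dyadic_mean a n (midpoint p q) q).
  by rewrite half_complex -[_ *: _]/(_ * _) -mulrDr mulrCA.
move: h1 h2; case: (k * _) => ? x; case: (k * _) => ? y /=.
rewrite mul0r addr0; lra.
Qed.

Lemma cint_Im_ge (a : C -> C) p q (m : R) : continuous_along a p q ->
  (forall z, segment p q z -> m <= Im ((q - p) * a z)) -> m <= Im (cint a p q).
Proof.
move=> ac am; apply/ler_addgt0Pl => e e0.
have /cvg_rnormP/(_ e e0)[n /(_ n (leqnn n))] :=
  cint_cvg (@complex_seq_complete R) ac.
set x := _ *: _; rewrite -[rnorm _]/(cabs (x - cint a p q)) => xe.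
have : m <= Im x by exact: dyadic_mean_Im_ge.
have := le_trans (norm_Im_le _) xe; rewrite raddfB ler_norml => /andP[_]; lra.
Qed.

(** In the situation of [star] this is [2 * pi * 'i]. The sign of its imaginary part
separates it from zero without a computation of arguments. *)
Definition winding (w a b c d : C) : R[i] :=
  quad_int (fun z : C => (z - w)^-1 : C) a b c d.

Lemma segment_star w p q z : 0 < cross (p - w) (q - w) -> segment p q z ->
  triangle w p q z /\ z <> w.
Proof.
move=> pq zs; apply: (@shrink_triangle R w 1 p q) => //; first by rewrite ltr01 lexx.
by left; move: z zs; apply: triangle_convex;
  have [] := triangle_vertices p q (shrink w 1 q).
Qed.

Lemma cdiff_inv_shift w z : z != w -> cdiff (fun z : C => (z - w)^-1 : C) z.
Proof.
move=> zw; eexists; apply: (has_deriv_comp (a := fun z => z - w) (f := fun z : C => z^-1)).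
  by apply: has_derivB; [exact: has_deriv_id|exact: has_deriv_cst].
by apply: has_derivV; rewrite subr_eq0.
Qed.

Lemma Im_div (u v : R[i]) : u != 0 ->
  Im (v * u^-1) = cross u v / (Re u ^+ 2 + Im u ^+ 2).
Proof.
case: u v => a b [c d] u0; rewrite /cross /=.
have n0 : a ^+ 2 + b ^+ 2 != 0.
  apply: contraNneq u0; move/eqP; rewrite paddr_eq0 ?sqr_ge0// !sqrf_eq0.
  by move=> /andP[/eqP -> /eqP ->].
by field.
Qed.

(** The imaginary part is the angle under which the edge is seen from [w]. *)
Lemma winding_edge w p q : 0 < cross (p - w) (q - w) ->
  0 < Im (cint (fun z : C => (z - w)^-1 : C) p q).
Proof.
move=> pq; pose M := cabs (p - w) + cabs (q - p).
have M0 : 0 < M.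
  rewrite ltr_pwDl ?cabs_ge0// cabs_gt0; apply: contraTneq pq => ->.
  by rewrite /cross !mul0r subrr ltxx.
apply: (@lt_le_trans _ _ (cross (p - w) (q - w) / (2 * M ^+ 2))).
  by rewrite divr_gt0// mulr_gt0// exprn_gt0.
apply: cint_Im_ge.
  move=> z /(segment_star pq)[_ /eqP zw]; apply: cdiff_cont.
  exact: cdiff_inv_shift.
move=> z zs; have [_ /eqP zw] := segment_star pq zs.
rewrite Im_div ?subr_eq0//.
have -> : cross (z - w) (q - p) = cross (p - w) (q - w).
  case: zs => t _ ->; rewrite -[RHS](cross_segment _ _ t).
  by congr cross; ring.
rewrite ler_pM2l//.
have n0 : 0 < Re (z - w) ^+ 2 + Im (z - w) ^+ 2.
  rewrite -ltcR add_Re2_Im2 exprn_gt0// normr_gt0 subr_eq0//.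
rewrite lef_pV2 ?posrE//; last by rewrite mulr_gt0// exprn_gt0.
rewrite -lecR add_Re2_Im2 -cabsE -rmorphXn lecR (@le_trans _ _ (M ^+ 2))//.
  rewrite ler_sqr ?nnegrE ?cabs_ge0 ?(ltW M0)//.
  by have := segment_dist zs; have := cabsD (z - p) (p - w);
    rewrite addrA subrK /M; lra.
by rewrite ler_peMl// ?ler1n// exprn_ge0// ltW.
Qed.

Lemma winding_neq0 (w a b c d : C) : star w a b c d -> winding w a b c d != 0.
Proof.
move=> [ab bc cd da]; apply: contraTneq (winding_edge ab) => W0.
rewrite -leNgt; move: (congr1 (@complex.Im R) W0); rewrite /winding /quad_int !raddfD /=.
have := winding_edge bc; have := winding_edge cd; have := winding_edge da; lra.
Qed.

End scalar_integrals.

Section residue.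
Context {R : realType} {X : normedModType R[i]} (Xc : seq_complete X).
Local Notation C := (R[i]^o).
Implicit Types (f g : C -> X) (a b c d p q w z : C).

Lemma star_edges w a b c d (Q : C -> Prop) : star w a b c d ->
  (forall z, star_region w a b c d z -> z <> w -> Q z) ->
  [/\ forall z, segment a b z -> Q z, forall z, segment b c z -> Q z,
      forall z, segment c d z -> Q z & forall z, segment d a z -> Q z].
Proof.
move=> [ab bc cd da] QP; split=> z.
- by move=> /(segment_star ab)[? ?]; apply: QP => //; left; left.
- by move=> /(segment_star bc)[? ?]; apply: QP => //; left; right.
- by move=> /(segment_star cd)[? ?]; apply: QP => //; right; left.
- by move=> /(segment_star da)[? ?]; apply: QP => //; right; right.
Qed.

(** Subtracting the simple pole leaves a function to which [star_quad_eq0]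
applies. *)
Theorem star_residue g (L : X) w a b c d : star w a b c d ->
  (forall z, star_region w a b c d z -> z <> w -> cdiff g z) ->
  (forall e : R, 0 < e -> exists2 r : R, 0 < r & forall z, z != w ->
     cabs (z - w) < r -> rnorm ((z - w) *: g z - L) <= e) ->
  quad_int g a b c d = winding w a b c d *: L.
Proof.
move=> st gd gL; pose k z : C := (z - w)^-1.
have kd z : z <> w -> cdiff (fun z => k z *: L) z.
  move=> /eqP zw; apply: cdiffZ; first exact: cdiff_inv_shift.
  by exists 0; exact: has_deriv_cst.
have E : quad_int (fun z => g z - k z *: L) a b c d = 0.
  apply: (star_quad_eq0 Xc st).
    move=> z zr zw; have [l gl] := gd z zr zw; have [m km] := kd z zw.
    by exists (l - m); exact: has_derivB.
  move=> e e0; have [r r0 rP] := gL e e0; exists r => // z zw zr.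
  rewrite mulrC -rnormZ scalerBr scalerA divff ?subr_eq0// scale1r; exact: rP.
have [g1 g2 g3 g4] := star_edges st (fun z zr zw => cdiff_cont (gd z zr zw)).
have [k1 k2 k3 k4] := star_edges st (fun z zr zw => cdiff_cont (kd z zw)).
have [h1 h2 h3 h4] := star_edges st
  (fun z zr zw => cdiff_cont (cdiff_inv_shift (introN eqP zw))).
move: E; rewrite /quad_int !(cintB Xc)//.
rewrite (cint_scale L Xc h1) (cint_scale L Xc h2) (cint_scale L Xc h3).
rewrite (cint_scale L Xc h4) (addrACA (cint g a b)) (addrACA (cint g a b + _)).
rewrite (addrACA (cint g a b + _ + _)) -!opprD -!scalerDl.
by move/eqP; rewrite subr_eq0 => /eqP.
Qed.

Corollary cauchy_formula f w a b c d : star w a b c d ->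
  (forall z, star_region w a b c d z -> cdiff f z) -> cdiff f w ->
  quad_int (fun z => (z - w)^-1 *: f z) a b c d = winding w a b c d *: f w.
Proof.
move=> st fd fw; apply: star_residue => //.
  by move=> z zr /eqP zw; apply: cdiffZ; [exact: cdiff_inv_shift|exact: fd].
move=> e e0; have /cdiff_cont/continuous_rnormP/(_ e e0)[r r0 rP] := fw.
exists r => // z zw zr; rewrite scalerA divff ?subr_eq0// scale1r; exact: rP.
Qed.

(** * Uniqueness of analytic continuation *)

Definition zero_near f a := exists2 d : R, 0 < d &
  forall z, cabs (z - a) < d -> f z = 0.

Lemma triangle_ball a (r : R) w p q z : cabs (w - a) <= r -> cabs (p - a) <= r ->
  cabs (q - a) <= r -> triangle w p q z -> cabs (z - a) <= r.
Proof.
move=> wr pr qr [s [t [s0 t0 st ->]]].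
have -> : w + s%:C * (p - w) + t%:C * (q - w) - a =
    (1 - s - t)%:C * (w - a) + s%:C * (p - a) + t%:C * (q - a).
  by rewrite !rmorphB rmorph1 /=; ring.
have st1 : 0 <= 1 - s - t by lra.
rewrite (le_trans (cabsD _ _))//.
have := cabsD ((1 - s - t)%:C * (w - a)) (s%:C * (p - a)).
rewrite !cabsM !cabs_real !ger0_norm//.
have := ler_wpM2l st1 wr; have := ler_wpM2l s0 pr; have := ler_wpM2l t0 qr; lra.
Qed.

(** Dividing by [(z - a) ^+ n] keeps [f] holomorphic, because [f] vanishes near
[a]. Cauchy's formula on a diamond around [a] then bounds [f w] by a geometric
sequence. *)
Lemma zero_near_ball f a (r : R) : 0 < r ->
  (forall z, cabs (z - a) <= r -> cdiff f z) -> zero_near f a ->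
  forall w, cabs (w - a) < r / 4 -> f w = 0.
Proof.
move=> r0 fd [d d0 f0] w wa.
have [->|wa0] := eqVneq w a; first by apply: f0; rewrite subrr cabs0.
pose p0 := a + r%:C; pose p1 := a + 'i * r%:C.
pose p2 := a - r%:C; pose p3 := a - 'i * r%:C.
have pa : [/\ cabs (p0 - a) <= r, cabs (p1 - a) <= r, cabs (p2 - a) <= r &
    cabs (p3 - a) <= r].
  have cr : cabs (r%:C) <= r by rewrite cabs_real ger0_norm// ltW.
  have ci : cabs ('i * r%:C) <= r by rewrite cabsM cabs_i mul1r.
  have cancel (x : C) : a + x - a = x by rewrite addrAC subrr add0r.
  by split; rewrite cancel ?cabsN.
have st : star w p0 p1 p2 p3.
  have := norm_Re_le (w - a); have := norm_Im_le (w - a).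
  rewrite /p0 /p1 /p2 /p3; case: (a) (w) wa => a1 a2 [w1 w2] wa /=.
  rewrite !ler_norml => /andP[? ?] /andP[? ?].
  have pos (x : R) : - r < x -> 0 < r * (r + x) by move=> ?; apply: mulr_gt0; lra.
  split; rewrite /cross /=.
  - by have := pos (a1 - w1 + (a2 - w2)) ltac:(lra); nra.
  - by have := pos (w1 - a1 + (a2 - w2)) ltac:(lra); nra.
  - by have := pos (w1 - a1 + (w2 - a2)) ltac:(lra); nra.
  - by have := pos (a1 - w1 + (w2 - a2)) ltac:(lra); nra.
have wr : cabs (w - a) <= r by lra.
have reg z : star_region w p0 p1 p2 p3 z -> cabs (z - a) <= r.
  by move: pa => [? ? ? ?] [[]|[]]; apply: triangle_ball.
pose phi n z := ((w - a) * (z - a)^-1) ^+ n *: f z.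
have phid n z : cabs (z - a) <= r -> cdiff (phi n) z.
  have [->|za] := eqVneq z a => zr.
    exists 0; apply: (@has_deriv_near R X (fun=> 0)); last exact: has_deriv_cst.
    by exists d => // v /f0 fv; rewrite /phi fv scaler0.
  elim: n => [|n IH].
    have -> : phi 0 = f by apply/funext => v; rewrite /phi expr0 scale1r.
    exact: fd.
  have -> : phi n.+1 = fun v => ((w - a) * (v - a)^-1) *: phi n v.
    by apply/funext => v; rewrite /phi exprS scalerA.
  apply: cdiffZ => //; have [l la] := cdiff_inv_shift za.
  eexists; apply: (has_derivZ (X := C) (a := fun=> w - a) _ la).
  exact: has_deriv_cst.
have phiw n : phi n w = f w by rewrite /phi divff ?subr_eq0// expr1n scale1r.
have W0 := winding_neq0 st.
have far z : `|Re (z - a)| + `|Im (z - a)| = r ->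
    cabs ((w - a) * (z - a)^-1) <= 2^-1.
  move=> zr; rewrite cabsM cabsV ler_pdivrMr.
    have := norm_Re_le (z - a); have := norm_Im_le (z - a); lra.
  have := norm_Re_le (z - a); have := norm_Im_le (z - a); lra.
pose F z := (z - w)^-1 *: f z.
have Fd z : cabs (z - a) <= r -> z <> w -> cdiff F z.
  by move=> zr /eqP zw; apply: cdiffZ; [exact: cdiff_inv_shift|exact: fd].
have edge p q : (forall z, segment p q z -> cdiff F z) ->
    (forall n z, segment p q z -> cdiff (fun z => (z - w)^-1 *: phi n z) z) ->
    (forall z, segment p q z -> `|Re (z - a)| + `|Im (z - a)| = r) ->
    exists K, forall n, rnorm (cint (fun z => (z - w)^-1 *: phi n z) p q) <= K / 2 ^+ n.
  move=> Fp phip zr.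
  have Fc : continuous_along F p q by move=> z /Fp; exact: cdiff_cont.
  have [M MP] := continuous_along_bounded Fc.
  exists (cabs (q - p) * M) => n; rewrite -mulrA; apply: cint_bound => //.
    by move=> z /(phip n); exact: cdiff_cont.
  move=> z zs; rewrite /phi scalerA mulrC -scalerA rnormZ mulrC.
  apply: ler_pM; rewrite ?rnorm_ge0 ?cabs_ge0//; first exact: MP.
  by rewrite cabsX -exprVn lerXn2r ?nnegrE ?cabs_ge0 ?invr_ge0// far// zr.
have [F1 F2 F3 F4] := star_edges st (fun z zr => Fd z (reg z zr)).
have phis n z : star_region w p0 p1 p2 p3 z -> z <> w ->
    cdiff (fun z => (z - w)^-1 *: phi n z) z.
  by move=> /reg zr /eqP zw; apply: cdiffZ; [exact: cdiff_inv_shift|exact: phid].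
have ph n := star_edges st (phis n).
have onedge : [/\ forall z, segment p0 p1 z -> `|Re (z - a)| + `|Im (z - a)| = r,
    forall z, segment p1 p2 z -> `|Re (z - a)| + `|Im (z - a)| = r,
    forall z, segment p2 p3 z -> `|Re (z - a)| + `|Im (z - a)| = r &
    forall z, segment p3 p0 z -> `|Re (z - a)| + `|Im (z - a)| = r].
  have E x y z (t s : R) : 0 <= t -> 0 <= s -> t + s = r ->
      (x = t \/ x = - t) -> (y = s \/ y = - s) -> z - a = x +i* y ->
      `|Re (z - a)| + `|Im (z - a)| = r.
    by move=> t0 s0 ts [->|->] [->|->] -> /=; rewrite ?normrN !ger0_norm.
  split=> z [t /andP[t0 t1] ->].
  - apply: (E (r * (1 - t)) (r * t) _ (r * (1 - t)) (r * t)); [nra|nra|ring|by left|by left|].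
    by rewrite /p0 /p1 /p2 /p3; case: (a) => a1 a2; congr (_ +i* _); rewrite /=; ring.
  - apply: (E (- (r * t)) (r * (1 - t)) _ (r * t) (r * (1 - t))); [nra|nra|ring|by right|by left|].
    by rewrite /p0 /p1 /p2 /p3; case: (a) => a1 a2; congr (_ +i* _); rewrite /=; ring.
  - apply: (E (- (r * (1 - t))) (- (r * t)) _ (r * (1 - t)) (r * t)); [nra|nra|ring|by right|by right|].
    by rewrite /p0 /p1 /p2 /p3; case: (a) => a1 a2; congr (_ +i* _); rewrite /=; ring.
  - apply: (E (r * t) (- (r * (1 - t))) _ (r * t) (r * (1 - t))); [nra|nra|ring|by left|by right|].
    by rewrite /p0 /p1 /p2 /p3; case: (a) => a1 a2; congr (_ +i* _); rewrite /=; ring.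
have [e1 e2 e3 e4] := onedge.
have phi1 n : forall z, segment p0 p1 z -> cdiff (fun z => (z - w)^-1 *: phi n z) z.
  by have [] := ph n.
have phi2 n : forall z, segment p1 p2 z -> cdiff (fun z => (z - w)^-1 *: phi n z) z.
  by have [] := ph n.
have phi3 n : forall z, segment p2 p3 z -> cdiff (fun z => (z - w)^-1 *: phi n z) z.
  by have [] := ph n.
have phi4 n : forall z, segment p3 p0 z -> cdiff (fun z => (z - w)^-1 *: phi n z) z.
  by have [] := ph n.
have [K1 K1P] := edge p0 p1 F1 phi1 e1.
have [K2 K2P] := edge p1 p2 F2 phi2 e2.
have [K3 K3P] := edge p2 p3 F3 phi3 e3.
have [K4 K4P] := edge p3 p0 F4 phi4 e4.
suff fw0 : winding w p0 p1 p2 p3 *: f w = 0.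
  by move/eqP: fw0; rewrite scaler_eq0 (negbTE W0) => /eqP.
apply: (rnorm_le_eps_eq0 (C := 1)) => e e0; rewrite mulr1.
have [|n nP] := @geometric_small R `|K1 + K2 + K3 + K4| e e0; first by [].
rewrite (le_trans _ (ltW nP))//.
rewrite -(phiw n) -cauchy_formula//; last 2 first.
- by move=> z /reg; exact: phid.
- exact: phid.
rewrite (@le_trans _ _ ((K1 + K2 + K3 + K4) / 2 ^+ n))//; last first.
  by rewrite ler_wpM2r ?invr_ge0 ?exprn_ge0 ?ler_norm.
rewrite !mulrDl /quad_int.
have := K1P n; have := K2P n; have := K3P n; have := K4P n.
set u1 := cint _ _ _; set u2 := cint _ p2 _; set u3 := cint _ p1 _; set u4 := cint _ p0 _.
have := rnormD (u4 + u3 + u2) u1; have := rnormD (u4 + u3) u2; have := rnormD u4 u3.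
lra.
Qed.

(** By bisection it suffices to pass from a point to nearby ones. *)
Lemma zero_near_segment f p q :
  (forall z, segment p q z -> exists2 r : R, 0 < r &
     forall w, cabs (w - z) < r -> cdiff f w) ->
  zero_near f p -> f q = 0.
Proof.
move=> fd fp; suff : zero_near f p -> zero_near f q.
  by move=> /(_ fp)[d d0]; apply; rewrite subrr cabs0.
apply: (segment_bisection (P := fun x y => zero_near f x -> zero_near f y)).
  by move=> x y xm my /xm/my.
move=> z /fd[r r0 rP]; exists (r / 100); first by rewrite divr_gt0.
move=> x y _ xy near fx; exists (r / 100); first by rewrite divr_gt0.
move=> v vy; have xz := near x (segment_left x y).
apply: (@zero_near_ball f x (r / 2)) => //; first by rewrite divr_gt0.
  move=> w wx; apply: rP; have := cabsD (w - x) (x - z).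
  by rewrite addrA subrK; lra.
by have := cabsD (v - y) (y - x); rewrite addrA subrK; lra.
Qed.

End residue.

(** * The complex exponential *)

Section cexp.
Context {R : realType}.
Local Notation C := (R[i]^o).
Implicit Types (z w : R[i]).

Definition cexp z : R[i] := (expR (Re z))%:C * (cos (Im z) +i* sin (Im z)).

Lemma cexpD z w : cexp (z + w) = cexp z * cexp w.
Proof.
case: z w => a b [c d]; rewrite /cexp /= expRD cosD sinD rmorphM /=.
rewrite mulrACA; congr (_ * _); rewrite [RHS]/GRing.mul /=.
by congr (_ +i* _); rewrite addrC.
Qed.

Lemma cexp0 : cexp 0 = 1.
Proof. by rewrite /cexp /= expR0 cos0 sin0 mul1r. Qed.

Lemma cabs_cexp z : cabs (cexp z) = expR (Re z).
Proof.
rewrite /cexp cabsM cabs_real ger0_norm ?expR_ge0// (_ : cabs _ = 1) ?mulr1//.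
by rewrite /cabs normc_def /= cos2Dsin2 sqrtr1.
Qed.

Lemma cexp_neq0 z : cexp z != 0.
Proof. by rewrite -cabs_eq0 cabs_cexp gt_eqF// expR_gt0. Qed.

Lemma cexpMn z n : cexp (n%:R * z) = cexp z ^+ n.
Proof.
elim: n => [|n IH]; first by rewrite mul0r cexp0 expr0.
by rewrite -natr1 mulrDl mul1r cexpD IH exprSr.
Qed.

(** The modulus forces [Re z = 0], and the half-angle formula [sin (Im z / 2) = 0]. *)
Lemma cexp_eq1 z : cexp z = 1 -> `|Im z| <= 2 -> z = 0.
Proof.
case: z => x y z1; have x0 : x = 0.
  by have := cabs_cexp (x +i* y); rewrite z1 cabs1 -expR0 => /expR_inj.
move: z1; rewrite x0 /cexp /= expR0 mul1r => -[cy sy] y2.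
suff -> : y = 0 by [].
have s2 : sin (y / 2) ^+ 2 = 0.
  have := cosD (y / 2) (y / 2); rewrite -splitr cy.
  have := cos2Dsin2 (y / 2); rewrite expr2 -expr2; rewrite !expr2; lra.
move/eqP: s2; rewrite sqrf_eq0 => /eqP s2; have pi2 := pi_ge2 R.
move: y2; rewrite ler_norml => /andP[y1 y2].
have [y0|y0|//] := ltgtP y 0.
  by have := @sin_gt0_pi R (- (y / 2)); rewrite sinN s2 oppr0 ltxx => /(_ ltac:(lra)).
by have := @sin_gt0_pi R (y / 2); rewrite s2 ltxx => /(_ ltac:(lra)).
Qed.

Lemma real_derive0_small (f : R -> R) (l e : R) : is_derive (0 : R) 1 f l -> 0 < e ->
  exists2 d : R, 0 < d & forall x, `|x| < d -> `|f x - f 0 - l * x| <= e * `|x|.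
Proof.
move=> [fd <-] e0; move: fd => /cvgrPdist_le/(_ e e0)[d /= d0 dP].
exists d => // x xd; have [->|x0] := eqVneq x 0.
  by rewrite subrr mulr0 subr0 normr0 mulr0.
have := dP x; rewrite /= sub0r normrN => /(_ xd x0).
rewrite -[_ *: _]/(_ * _) -[x *: 1]/(x * 1) mulr1 addr0 => h.
rewrite -(@ler_pM2l _ `|x|^-1) ?invr_gt0 ?normr_gt0// mulrCA mulVf ?normr_eq0// mulr1.
rewrite -normfV -normrM mulrBr mulrCA mulVf// mulr1 distrC.
exact: h.
Qed.

Lemma has_deriv_cexp0 : has_deriv (X := C) cexp 0 1.
Proof.
apply/has_derivP => e e0.
have [a [a0 a1 ae]] : exists a : R, [/\ 0 < a, a <= 1 & a <= e / 20].
  exists (Num.min 1 (e / 20)).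
  by rewrite lt_min ltr01 divr_gt0//; split=> //; rewrite ge_min lexx ?orbT.
have ed : is_derive (0 : R) 1 expR 1 by have := is_derive_expR (0 : R); rewrite expR0.
have sd : is_derive (0 : R) 1 sin 1 by have := is_derive_sin (0 : R); rewrite cos0.
have cd : is_derive (0 : R) 1 cos 0 by have := is_derive_cos (0 : R); rewrite sin0 oppr0.
have [d1 d10 d1P] := real_derive0_small ed a0.
have [d2 d20 d2P] := real_derive0_small sd a0.
have [d3 d30 d3P] := real_derive0_small cd a0.
exists (Num.min a (Num.min d1 (Num.min d2 d3))); first by rewrite !lt_min a0 d10 d20 d30.
move=> h; rewrite subr0 cexp0 !lt_min => /andP[ha /andP[h1 /andP[h2 h3]]].
rewrite -[rnorm _]/(cabs (cexp h - 1 - h * 1)) mulr1.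
have xh := norm_Re_le h; have yh := norm_Im_le h.
have {d1P} := d1P _ (le_lt_trans xh h1); have {d2P} := d2P _ (le_lt_trans yh h2).
have {d3P} := d3P _ (le_lt_trans yh h3).
rewrite expR0 sin0 cos0 mul0r !mul1r !subr0.
move: ha xh yh; set c := cabs h; set x := Re h; set y := Im h => ha xh yh B3 B2 B1.
have c0 : 0 <= c := cabs_ge0 h.
rewrite (le_trans (cabs_le _))//.
have -> : Re (cexp h - 1 - h) = (expR x - 1 - x) * cos y + (1 + x) * (cos y - 1).
  by rewrite !raddfB /cexp /= -/x -/y; ring.
have -> : Im (cexp h - 1 - h) = (expR x - 1 - x) * sin y + x * sin y + (sin y - y).
  by rewrite !raddfB /cexp /= -/x -/y; ring.
have sy1 : `|sin y| <= 1 by rewrite ler_norml sin_geN1 sin_le1.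
have cy1 : `|cos y| <= 1 by rewrite ler_norml cos_geN1 cos_le1.
have ac : a * c <= e / 20 * c by rewrite ler_wpM2r.
have T1 : `|(expR x - 1 - x) * cos y| <= a * c.
  rewrite normrM -[leRHS]mulr1 ler_pM// (le_trans B1)// ler_pM2l//.
have T2 : `|(1 + x) * (cos y - 1)| <= 2 * (a * c).
  rewrite normrM ler_pM//; last by rewrite (le_trans B3)// ler_pM2l.
  by rewrite (le_trans (ler_normD _ _))// normr1; lra.
have T3 : `|(expR x - 1 - x) * sin y| <= a * c.
  by rewrite normrM -[leRHS]mulr1 ler_pM// (le_trans B1)// ler_pM2l.
have T5 : `|sin y - y| <= a * c by rewrite (le_trans B2)// ler_pM2l.
have T4 : `|x * sin y| <= 2 * (a * c).
  rewrite normrM mulrCA ler_pM//; first lra.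
  have := ler_normD (sin y - y) y; rewrite subrK.
  have : a * c <= c by rewrite ler_piMl.
  lra.
have := ler_normD ((expR x - 1 - x) * cos y) ((1 + x) * (cos y - 1)).
have := ler_normD ((expR x - 1 - x) * sin y + x * sin y) (sin y - y).
have := ler_normD ((expR x - 1 - x) * sin y) (x * sin y).
have := mulr_ge0 (ltW e0) c0; lra.
Qed.

Lemma has_deriv_cexp z : has_deriv (X := C) cexp z (cexp z).
Proof.
have sh : has_deriv (X := C) (fun w : C => cexp (w - z)) z 1.
  rewrite -[X in has_deriv _ _ X](mulr1 (1 : R[i])).
  apply: (@has_deriv_comp _ C (fun w : C => w - z) cexp z 1 1); last first.
    by rewrite subrr; exact: has_deriv_cexp0.
  rewrite -[X in has_deriv _ _ X](subr0 (1 : R[i])).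
  by apply: has_derivB; [exact: has_deriv_id|exact: has_deriv_cst].
have := @has_derivZ _ C (fun=> cexp z) (fun w : C => cexp (w - z)) z 0 1
  (has_deriv_cst _ _) sh.
rewrite scale0r add0r -[_ *: 1]/(_ * _) mulr1.
by apply: has_deriv_near; exists 1 => // w _; rewrite -[_ *: _]/(_ * _) -cexpD subrKC.
Qed.

Lemma has_deriv_cexpM (t : R[i]) (z : C) :
  has_deriv (X := C) (fun w : C => cexp (t * w)) z (t * cexp (t * z)).
Proof.
apply: (@has_deriv_comp _ C (fun w : C => t * w) cexp z t _); last exact: has_deriv_cexp.
have := @has_derivZ _ C (fun=> t) id z 0 1 (has_deriv_cst _ _) (has_deriv_id z).
by rewrite scale0r add0r -[t *: 1]/(t * 1) mulr1.
Qed.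

Lemma has_deriv_cexpNM (t : R[i]) (z : C) :
  has_deriv (X := C) (fun w : C => cexp (- (t * w))) z (- t * cexp (- (t * z))).
Proof.
have := has_deriv_cexpM (- t) z; rewrite (mulNr t z).
by apply: has_deriv_near; exists 1 => // w _; rewrite mulNr.
Qed.

End cexp.

(** * Integrals and series depending on a parameter *)

Section parameter.
Context {R : realType} {X : normedModType R[i]} (Xc : seq_complete X).
Local Notation C := (R[i]^o).
Implicit Types (a : C -> C) (v : C -> X) (p q w z x y : C).

(** Its integrals depend on [x] rationally under the integral sign, hence can be
differentiated by hand; with [a z = exp (- z)] and [x = exp w] it is the kernel
[1 / (1 - exp (w - z))]. *)
Definition resolvent_kernel a x z : C := (1 - a z * x)^-1.

Lemma resolvent_kernel_cont a x z : 1 - a z * x != 0 ->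
  {for z, continuous a} -> {for z, continuous (resolvent_kernel a x)}.
Proof.
move=> ax ac; apply: contV; first exact: ax.
apply: contB; first exact: cont_cst.
by apply: contM; [exact: ac|exact: cont_cst].
Qed.

(** The remainder of the first order expansion of the kernel is
[h ^+ 2 * a ^+ 2 * k x ^+ 2 * k (x + h)], uniformly quadratic in [h]. *)
Lemma has_deriv_cint_kernel a v p q x : continuous_along a p q ->
  continuous_along v p q -> (forall z, segment p q z -> 1 - a z * x != 0) ->
  has_deriv (fun y => cint (fun z => resolvent_kernel a y z *: v z) p q) x
    (cint (fun z => (a z * resolvent_kernel a x z ^+ 2) *: v z) p q).
Proof.
move=> ac vc ax; set k := resolvent_kernel a x.
have kc : continuous_along k p q.
  by move=> z zs; apply: resolvent_kernel_cont; [exact: ax|exact: ac].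
have [A' A'P] := continuous_along_bounded ac.
have [K' K'P] := continuous_along_bounded kc.
have [V' V'P] := continuous_along_bounded vc.
pose A := `|A'| + 1; pose K := `|K'| + 1; pose V := `|V'| + 1.
have A0 : 0 < A by rewrite ltr_wpDl.
have K0 : 0 < K by rewrite ltr_wpDl.
have V0 : 0 < V by rewrite ltr_wpDl.
have up (u : R) : u <= `|u| + 1.
  by rewrite (le_trans (ler_norm u))// lerDl.
have aP z : segment p q z -> cabs (a z) <= A by move=> /A'P/le_trans; apply; exact: up.
have kP z : segment p q z -> cabs (k z) <= K by move=> /K'P/le_trans; apply; exact: up.
have vP z : segment p q z -> rnorm (v z) <= V by move=> /V'P/le_trans; apply; exact: up.
apply/has_derivP => e e0.
pose M := cabs (q - p) * (2 * A ^+ 2 * K ^+ 3 * V) + 1.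
have M0 : 0 < M.
  by rewrite ltr_wpDl// !mulr_ge0 ?cabs_ge0 ?exprn_ge0// ltW.
exists (Num.min (2 * A * K)^-1 (e / M)).
  by rewrite lt_min invr_gt0 divr_gt0// andbT !mulr_gt0.
move=> y; rewrite lt_min => /andP[]; set h := y - x => hAK heM.
have small z : segment p q z -> cabs (a z * h * k z) <= 2^-1.
  move=> zs; have h1 : cabs (a z) * cabs (k z) <= A * K.
    by rewrite ler_pM ?cabs_ge0 ?aP ?kP.
  have h2 : cabs h * (2 * A * K) < 1.
    by rewrite -ltr_pdivlMr ?mul1r// !mulr_gt0.
  have := ler_wpM2l (cabs_ge0 h) h1; rewrite !cabsM; lra.
have ky z : segment p q z -> [/\ 1 - a z * y != 0,
    resolvent_kernel a y z = k z * (1 - a z * h * k z)^-1 &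
    cabs (resolvent_kernel a y z) <= 2 * K].
  move=> zs; have B := small z zs; have ax0 := ax z zs.
  have n0 : 2^-1 <= cabs (1 - a z * h * k z).
    have := cabsB_ge 1 (a z * h * k z); rewrite cabs1; lra.
  have n1 : 1 - a z * h * k z != 0 by rewrite -cabs_gt0; lra.
  have E : 1 - a z * y = (1 - a z * x) * (1 - a z * h * k z).
    rewrite /k /resolvent_kernel mulrBr mulr1 mulrCA divff// mulr1 /h.
    by ring.
  have kyE : resolvent_kernel a y z = k z * (1 - a z * h * k z)^-1.
    by rewrite /resolvent_kernel E invfM.
  split=> //; first by rewrite E mulf_neq0.
  have n2 : cabs (1 - a z * h * k z)^-1 <= 2.
    have n3 : 0 < cabs (1 - a z * h * k z) by lra.
    by rewrite cabsV -[leLHS]mul1r ler_pdivrMr//; lra.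
  by rewrite kyE cabsM mulrC ler_pM ?cabs_ge0 ?kP.
have vkc : continuous_along (fun z => k z *: v z) p q.
  by move=> z zs; apply: contZ; [exact: kc|exact: vc].
have vyc : continuous_along (fun z => resolvent_kernel a y z *: v z) p q.
  move=> z zs; apply: contZ; last exact: vc.
  by apply: resolvent_kernel_cont; [have [] := ky z zs|exact: ac].
have dkc : continuous_along (fun z => (a z * k z ^+ 2) *: v z) p q.
  move=> z zs; apply: contZ; last exact: vc.
  apply: contM; first exact: ac.
  by apply: contX; exact: kc.
have c1 : continuous_along (fun z => resolvent_kernel a y z *: v z - k z *: v z) p q.
  by move=> z zs; apply: contB; [exact: vyc|exact: vkc].
have c2 : continuous_along (fun z => h *: ((a z * k z ^+ 2) *: v z)) p q.
  by move=> z zs; apply: contZ; [exact: cont_cst|exact: dkc].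
rewrite -(cintZ Xc h dkc) -(cintB Xc vyc vkc) -(cintB Xc c1 c2).
have B : rnorm (cint (fun z => resolvent_kernel a y z *: v z - k z *: v z -
    h *: ((a z * k z ^+ 2) *: v z)) p q) <=
    cabs (q - p) * (cabs h ^+ 2 * (2 * A ^+ 2 * K ^+ 3 * V)).
  apply: cint_bound => //; first by move=> z zs; apply: contB; [exact: c1|exact: c2].
  move=> z zs; have [ay0 kyE kyP] := ky z zs; have ax0 := ax z zs.
  rewrite scalerA -!scalerBl rnormZ.
  have -> : resolvent_kernel a y z - k z - h * (a z * k z ^+ 2) =
      h ^+ 2 * (a z ^+ 2 * (k z ^+ 2 * resolvent_kernel a y z)).
    by rewrite /k /resolvent_kernel /h; field; rewrite ax0 ay0.
  rewrite cabsM cabsX -mulrA ler_wpM2l ?exprn_ge0 ?cabs_ge0//.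
  have -> : 2 * A ^+ 2 * K ^+ 3 * V = A ^+ 2 * (K ^+ 2 * (2 * K)) * V by ring.
  rewrite ler_pM ?cabs_ge0 ?rnorm_ge0 ?vP// cabsM cabsX cabsM cabsX.
  rewrite ler_pM ?mulr_ge0 ?exprn_ge0 ?cabs_ge0//.
    by rewrite lerXn2r ?nnegrE ?cabs_ge0 ?(ltW A0) ?aP.
  rewrite ler_pM ?mulr_ge0 ?exprn_ge0 ?cabs_ge0//.
  by rewrite lerXn2r ?nnegrE ?cabs_ge0 ?(ltW K0) ?kP.
apply: (le_trans B); rewrite ltr_pdivlMr// in heM.
rewrite {}/M in M0 heM; set G := 2 * A ^+ 2 * K ^+ 3 * V in M0 heM *.
have -> : cabs (q - p) * (cabs h ^+ 2 * G) = cabs h * (cabs (q - p) * G) * cabs h.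
  by ring.
by rewrite ler_wpM2r ?cabs_ge0//; have := cabs_ge0 h; lra.
Qed.

Definition series_sum (F : nat -> X) : X := limn (fun n => \sum_(i < n) F i).

Lemma geometric_tail (K m e : R) : 0 <= m < 1 -> 0 < e ->
  exists n, K * m ^+ n / (1 - m) <= e.
Proof.
move=> /andP[m0 m1] e0; have mcv : `|m| < 1 by rewrite ger0_norm.
have := @cvg_geometric R (K / (1 - m)) m mcv.
move=> /cvgrPdist_le/(_ e e0)[n _ /(_ n (leqnn n))].
rewrite /= sub0r normrN mulrAC => /(le_trans (ler_norm _)); by exists n.
Qed.

Lemma geometric_cvg (F : nat -> X) (K m : R) : 0 <= m < 1 ->
  (forall n, rnorm (F n) <= K * m ^+ n) ->
  \sum_(i < n) F i @[n --> \oo] --> series_sum F /\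
  forall n, rnorm (series_sum F - \sum_(i < n) F i) <= K * m ^+ n / (1 - m).
Proof.
move=> /andP[m0 m1] FK; have d0 : 0 < 1 - m by rewrite subr_gt0.
have K0 : 0 <= K by have := le_trans (rnorm_ge0 _) (FK 0%N); rewrite expr0 mulr1.
have tail n k : rnorm (\sum_(i < n + k) F i - \sum_(i < n) F i) <=
    K * (m ^+ n - m ^+ (n + k)) / (1 - m).
  elim: k => [|k IH]; first by rewrite addn0 !subrr rnorm0 mulr0 mul0r.
  rewrite addnS big_ord_recr /= addrAC (le_trans (rnormD _ _))//.
  rewrite (le_trans (lerD IH (FK _)))//.
  have -> : K * m ^+ (n + k) = K * m ^+ (n + k) * (1 - m) / (1 - m).
    by rewrite mulfK// gt_eqF.
  rewrite -mulrDl ler_pM2r ?invr_gt0// exprS; lra.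
have tail2 n k : rnorm (\sum_(i < n + k) F i - \sum_(i < n) F i) <=
    K * m ^+ n / (1 - m).
  apply: (le_trans (tail n k)); rewrite ler_pM2r ?invr_gt0// ler_wpM2l//.
  by rewrite gerBl exprn_ge0.
have cv : cvgn (fun n => \sum_(i < n) F i).
  apply/cvg_ex; apply: (seq_complete_cvg Xc) => e e0.
  have [||n nP] := @geometric_tail K m (e / 2); rewrite ?m0 ?divr_gt0//.
  exists n => i j /subnKC <- /subnKC <-.
  rewrite -[X in rnorm X](subrKA (\sum_(i < n) F i)) -[X in _ + X]opprB.
  rewrite (le_trans (rnormB _ _))//.
  have := tail2 n (i - n)%N; have := tail2 n (j - n)%N; lra.
split=> // n; apply: (cvg_rnorm_le (u := fun k => \sum_(i < n + k) F i - \sum_(i < n) F i)).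
  exact: tail2.
apply: cvgB; last exact: cvg_cst.
have := cv; rewrite -(cvg_shiftn n (fun k => \sum_(i < k) F i)).
by under eq_fun do rewrite addnC.
Qed.

Lemma series_sum_cont (F : nat -> C -> X) (K m d : R) z : 0 <= m < 1 -> 0 < d ->
  (forall n w, cabs (w - z) < d -> rnorm (F n w) <= K * m ^+ n) ->
  (forall n, {for z, continuous (F n)}) ->
  {for z, continuous (fun w => series_sum (F ^~ w))}.
Proof.
move=> /andP[m0 m1] d0 FK Fc; apply/continuous_rnormP => e e0.
have [||n ne] := @geometric_tail K m (e / 3); rewrite ?m0 ?divr_gt0//.
have := @cont_sum R C X n F z Fc.
have e3 : 0 < e / 3 by rewrite divr_gt0.
move/continuous_rnormP => /(_ _ e3)[d' d'0 d'P].
exists (Num.min d d'); first by rewrite lt_min d0.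
move=> w; rewrite lt_min => /andP[wd wd'].
have zd : cabs (z - z) < d by rewrite subrr cabs0.
have [|_ /(_ n) h1] := @geometric_cvg (F ^~ w) K m _ (fun n => FK n w wd).
  by rewrite m0.
have [|_ /(_ n) h2] := @geometric_cvg (F ^~ z) K m _ (fun n => FK n z zd).
  by rewrite m0.
have h3 := d'P w wd'; move: h1 h2 h3.
set s1 := series_sum _; set s2 := series_sum _.
set t1 := \sum_(i < n) F i w; set t2 := \sum_(i < n) F i z => h1 h2 h3.
have -> : s1 - s2 = (s1 - t1) + (t1 - t2) - (s2 - t2).
  by rewrite !addrA subrK opprB addrA subrK.
have := rnormB (s1 - t1 + (t1 - t2)) (s2 - t2); have := rnormD (s1 - t1) (t1 - t2).
lra.
Qed.

(** The difference quotient of [y ^+ n] is a polynomial in the increment; the series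
of these quotients converges uniformly, so its sum is continuous, and
Carathéodory's form of the derivative applies. *)
Lemma cdiff_power_series (U : nat -> X) (K m : R) x : 0 < m -> cabs x * m < 1 ->
  (forall n, rnorm (U n) <= K * m ^+ n) ->
  cdiff (fun y => series_sum (fun n => y ^+ n *: U n)) x.
Proof.
move=> m0 xm UK.
have K0 : 0 <= K by have := le_trans (rnorm_ge0 _) (UK 0%N); rewrite expr0 mulr1.
(* The factor n of the derived series is absorbed by passing from b * m to
   the slightly larger ratio (1 + t) * (b * m). *)
have [b [xb b0 bm]] : exists b : R, [/\ cabs x < b, 0 < b & b * m < 1].
  have xm' : cabs x < m^-1 by rewrite -[m^-1]mul1r ltr_pdivlMr.
  exists ((cabs x + m^-1) / 2); split; first lra.
    by have := cabs_ge0 x; lra.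
  by rewrite -ltr_pdivlMr// mul1r; lra.
have bm0 : 0 < b * m by rewrite mulr_gt0.
have [t t0 th1] : exists2 t : R, 0 < t & (1 + t) * (b * m) < 1.
  by exists ((1 - b * m) / 2); [lra|nra].
pose th := (1 + t) * (b * m).
have th01 : 0 <= th < 1 by rewrite th1 andbT mulr_ge0 ?(ltW bm0)//; lra.
have bern n : n%:R * t <= (1 + t) ^+ n.
  elim: n => [|n IH]; first by rewrite mul0r expr0.
  rewrite exprS -natr1 mulrDl mul1r mulrDl mul1r.
  have : 1 <= (1 + t) ^+ n by rewrite exprn_ege1//; lra.
  nra.
pose q n h := \sum_(i < n) (x + h) ^+ (n.-1 - i) * x ^+ i : R[i].
have qE n h : (x + h) ^+ n = x ^+ n + h * q n h.
  by have := subrXX (x + h) x n; rewrite addrAC subrr add0r -/(q n h) => <-; rewrite subrKC.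
pose d := b - cabs x; have d0 : 0 < d by rewrite subr_gt0.
have xhb h : cabs h < d -> cabs (x + h) <= b.
  by move=> hd; rewrite (le_trans (cabsD _ _))// -lerBrDl ltW.
have qb n h : cabs h < d -> cabs (q n h) <= n%:R * b ^+ n.-1.
  move=> hd; rewrite -[cabs _]/(rnorm (q n h : C)) (le_trans (rnorm_sum _ _))//.
  have -> : n%:R * b ^+ n.-1 = \sum_(i < n) b ^+ n.-1.
    by rewrite sumr_const card_ord mulr_natl.
  apply: ler_sum => i _; rewrite -[rnorm _]/(cabs _) cabsM !cabsX.
  have -> : b ^+ n.-1 = b ^+ (n.-1 - i) * b ^+ i.
    by rewrite -exprD subnK//; case: n i => [[]//|n i]; rewrite -ltnS.
  rewrite ler_pM ?exprn_ge0 ?cabs_ge0// lerXn2r ?nnegrE ?cabs_ge0 ?(ltW b0) ?xhb//.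
  exact: ltW.
pose K' := K / t / b.
have K'0 : 0 <= K' by exact: divr_ge0 (divr_ge0 K0 (ltW t0)) (ltW b0).
have Fb n h : cabs (h - 0) < d -> rnorm (q n h *: U n) <= K' * th ^+ n.
  rewrite subr0 => hd; rewrite rnormZ.
  apply: (@le_trans _ _ (n%:R * b ^+ n.-1 * (K * m ^+ n))).
    by rewrite ler_pM ?cabs_ge0 ?rnorm_ge0 ?qb.
  case: n => [|n]; first by rewrite !mul0r expr0 mulr1.
  rewrite /K' /th !exprMn -[n.+1.-1]/n.
  have -> : n.+1%:R * b ^+ n * (K * m ^+ n.+1) = n.+1%:R * t * (K / t / b * (b ^+ n.+1 * m ^+ n.+1)).
    by rewrite [b ^+ n.+1]exprS; field; rewrite !gt_eqF.
  rewrite [leRHS]mulrCA ler_wpM2r ?bern//.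
  by rewrite -exprMn mulr_ge0 ?exprn_ge0 ?(ltW bm0).
have Ub h : cabs h < d -> forall n, rnorm ((x + h) ^+ n *: U n) <= K * (b * m) ^+ n.
  move=> hd n; rewrite rnormZ cabsX exprMn mulrCA.
  by rewrite ler_pM ?exprn_ge0 ?cabs_ge0 ?rnorm_ge0 ?UK// lerXn2r ?nnegrE ?cabs_ge0 ?(ltW b0) ?xhb.
have bm01 : 0 <= b * m < 1 by rewrite bm ltW.
have Ux n : rnorm (x ^+ n *: U n) <= K * (b * m) ^+ n.
  by have := Ub 0 ltac:(by rewrite cabs0) n; rewrite addr0.
have [S0 _] := geometric_cvg bm01 Ux.
have Sphi h : cabs h < d -> series_sum (fun n => (x + h) ^+ n *: U n) =
    series_sum (fun n => x ^+ n *: U n) + h *: series_sum (fun n => q n h *: U n).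
  move=> hd; have [S1 _] := geometric_cvg bm01 (Ub h hd).
  have [S2 _] := geometric_cvg th01 (fun n => Fb n h ltac:(by rewrite subr0)).
  apply: (cvg_unique (@norm_hausdorff _ X) S1).
  have -> : (fun n => \sum_(i < n) (x + h) ^+ i *: U i) = (fun n =>
      \sum_(i < n) x ^+ i *: U i + h *: \sum_(i < n) q i h *: U i).
    apply/funext => n; rewrite scaler_sumr -big_split /=; apply: eq_bigr => i _.
    by rewrite scalerA -scalerDl -qE.
  by apply: cvgD; [exact: S0|exact: cvgZl_tmp S2].
pose phi h := series_sum (fun n => q n h *: U n).
have phic : {for 0, continuous (phi : C -> X)}.
  apply: (series_sum_cont (K := K') (m := th) (d := d)) => // n.
  apply: contZ; last exact: cont_cst.
  have xc : {for 0, continuous (fun h : C => x + h)}.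
    by apply: contD; [exact: cont_cst|exact: cont_id].
  apply: (@cont_sum R C C n (fun i h => (x + h) ^+ (n.-1 - i) * x ^+ i)) => i.
  by apply: contM; [exact: contX|exact: cont_cst].
exists (phi 0); have := @has_deriv_expansion R X phi
  (series_sum (fun n => x ^+ n *: U n)) x phic.
apply: has_deriv_near; exists d => // y yd.
by have := Sphi (y - x) yd; rewrite subrKC.
Qed.

End parameter.

(** * Extension across the slit *)

Section regions.
Context {R : realType}.
Local Notation C := (R[i]^o).
Implicit Types (z w : C) (T : R).

Lemma slit_plane_open z : slit_plane z ->
  exists2 r : R, 0 < r & forall w, cabs (w - z) < r -> slit_plane w.
Proof.
move=> sz; have [Iz|Iz] := eqVneq (Im z) 0.
  have Rz : Re z < 0 by rewrite ltNge; apply/negP => Rz; apply: sz.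
  exists (- Re z); first by lra.
  move=> w wz [_ Rw]; have := le_lt_trans (norm_Re_le (w - z)) wz.
  by rewrite raddfB ltr_norml => /andP[]; lra.
exists `|Im z|; first by rewrite normr_gt0.
move=> w wz [Iw _]; have := le_lt_trans (norm_Im_le (w - z)) wz.
by rewrite raddfB /= Iw sub0r normrN ltxx.
Qed.

(** The interior of the triangle with vertices [vout], [vtop T] and [vbot T]. *)
Definition sector T : set C :=
  [set w | Re w < T /\ (T + 3) * `|Im w| < Re w + 3].

Lemma sector_open T w : 0 < T -> sector T w ->
  exists2 r : R, 0 < r & forall z, cabs (z - w) < r -> sector T z.
Proof.
move=> T0 [wT wI].
pose r := Num.min (T - Re w) ((Re w + 3 - (T + 3) * `|Im w|) / (T + 4)).
have T4 : 0 < T + 4 by lra.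
exists r; first by rewrite lt_min subr_gt0 wT divr_gt0// subr_gt0.
move=> z; rewrite lt_min ltr_pdivlMr// => /andP[z1 z2].
have := norm_Re_le (z - w); have := norm_Im_le (z - w).
rewrite !raddfB !ler_norml => /andP[i1 i2] /andP[r1 r2]; split; first lra.
have : `|Im z| <= `|Im w| + cabs (z - w).
  by have := ler_normD (Im w) (Im z - Im w); rewrite subrKC => /le_trans; apply;
    rewrite lerD2l ler_norml i1.
nra.
Qed.

(** The contour [vtop], [vout], [vbot], [vin] is an arrowhead around [base_point]
with its notch at [vin]: the inner sides, through [vin], pass between
[base_point] and the slit, while the slit up to [T] lies inside the outer
triangle. *)
Definition vtop T : C := T +i* 1.
Definition vbot T : C := T +i* (- 1).
Definition vout : C := (- 3) +i* 0.
Definition vin : C := (- 1) +i* 0.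
Definition base_point : C := (- 2) +i* 0.

(** A neighbourhood of [base_point] from whose points the contour is star-shaped;
the triangles which they span with its sides avoid the slit. *)
Definition near_base T : set C :=
  [set w | `|Re w + 2| < 4^-1 /\ (T + 3) * `|Im w| < 2^-1].

Lemma near_base_bounds T w : 0 < T -> near_base T w ->
  [/\ - 2 - 4^-1 < Re w, Re w < - 2 + 4^-1,
      - 2^-1 < (T + 3) * Im w & (T + 3) * Im w < 2^-1].
Proof.
move=> T0 [+ wI]; rewrite ltr_norml => /andP[? ?].
have : `|(T + 3) * Im w| < 2^-1.
  by rewrite normrM (@ger0_norm _ (T + 3))//; lra.
by rewrite ltr_norml => /andP[? ?]; split; lra.
Qed.

Lemma near_base_Im T w : 0 < T -> near_base T w -> `|Im w| <= 1.
Proof. by move=> T0 [_ wI]; have := normr_ge0 (Im w); nra. Qed.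

Lemma near_base_star T w : 0 < T -> near_base T w ->
  star w (vtop T) vout (vbot T) vin.
Proof.
move=> T0 /(near_base_bounds T0)[]; case: w => x y /= h1 h2 h3 h4.
by split; rewrite /cross /=; nra.
Qed.

(** A convex combination of [w] and two consecutive vertices that lies on the real
axis has negative real part. *)
Lemma near_base_region T w : 0 < T -> near_base T w ->
  star_region w (vtop T) vout (vbot T) vin `<=`
  [set z | slit_plane z /\ `|Im z| <= 1].
Proof.
move=> T0 wn; have := near_base_Im T0 wn; have := near_base_bounds T0 wn.
case: w wn => x y wn /= [h1 h2 h3 h4]; rewrite ler_norml => /andP[y1 y2].
have slit (l s t : R) : 0 <= l -> 0 <= s -> 0 <= t -> l + s + t = 1 ->
    (forall e, e = 1 \/ e = - 1 -> l * y + s * e = 0 -> 0 <= l * x + s * T - t ->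
    False).
  move=> l0 s0 t0 lst e e1 E.
  have ly : - 2^-1 * l <= l * ((T + 3) * y) by rewrite mulrC; apply: ler_wpM2l => //; lra.
  have ly' : l * ((T + 3) * y) <= 2^-1 * l by rewrite [leRHS]mulrC; apply: ler_wpM2l => //; lra.
  have lx : l * x <= l * (- 2 + 4^-1) by apply: ler_wpM2l => //; lra.
  have sT : s * (T + 3) <= 2^-1 * l.
    by case: e1 E => ->; nra.
  have sT0 : 0 <= s * T by rewrite mulr_ge0// ltW.
  move=> P.
  have l00 : l = 0 by lra.
  move: E sT; rewrite l00; case: e1 => ->; nra.
have im1 (l s t a b : R) : 0 <= l -> 0 <= s -> 0 <= t -> l + s + t = 1 ->
    -1 <= a <= 1 -> -1 <= b <= 1 -> `|l * y + s * a + t * b| <= 1.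
  move=> l0 s0 t0 lst /andP[a1 a2] /andP[b1 b2]; rewrite ler_norml.
  have := ler_wpM2l l0 y1; have := ler_wpM2l l0 y2; have := ler_wpM2l s0 a1.
  have := ler_wpM2l s0 a2; have := ler_wpM2l t0 b1; have := ler_wpM2l t0 b2.
  lra.
have gen (z : C) (l s t e d : R) : 0 <= l -> 0 <= s -> 0 <= t -> l + s + t = 1 ->
    e = 1 \/ e = - 1 -> 1 <= d ->
    z = (l * x + s * T - t * d) +i* (l * y + s * e) ->
    slit_plane z /\ `|Im z| <= 1.
  move=> l0 s0 t0 lst e1 d1 ->; split=> /= [[E P]|].
    by rewrite /= in E P; apply: (slit l s t l0 s0 t0 lst e e1 E); have := ler_wpM2l t0 d1; lra.
  have := im1 l s t e 0 l0 s0 t0 lst; rewrite mulr0 addr0; apply; last lra.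
  by case: e1 => ->; lra.
move=> z [[]|[]] [s [t [s0 t0 st ->]]].
- apply: (gen _ (1 - s - t) s t 1 3); [lra|lra|lra|lra|by left|lra|].
  by congr (_ +i* _); rewrite /=; ring.
- apply: (gen _ (1 - s - t) t s (- 1) 3); [lra|lra|lra|lra|by right|lra|].
  by congr (_ +i* _); rewrite /=; ring.
- apply: (gen _ (1 - s - t) s t (- 1) 1); [lra|lra|lra|lra|by right|lra|].
  by congr (_ +i* _); rewrite /=; ring.
- apply: (gen _ (1 - s - t) t s 1 1); [lra|lra|lra|lra|by left|lra|].
  by congr (_ +i* _); rewrite /=; ring.
Qed.

Lemma segment_base w z : segment base_point w z -> exists2 s : R, 0 <= s <= 1 &
  z = (- 2 + s * (Re w + 2)) +i* (s * Im w).
Proof.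
case: w => x y [s s01 ->]; exists s => //.
by congr (_ +i* _); rewrite /=; ring.
Qed.

Lemma near_base_segment T w : 0 < T -> near_base T w ->
  segment base_point w `<=` near_base T.
Proof.
move=> T0 [wR wI] _ /segment_base[s /andP[s0 s1] ->].
rewrite /near_base /=; split.
  rewrite addrAC addNr add0r normrM (ger0_norm s0).
  by rewrite (le_lt_trans _ wR)// ler_piMl.
rewrite normrM (ger0_norm s0) (le_lt_trans _ wI)// ler_wpM2l//; first lra.
by rewrite ler_piMl.
Qed.

Lemma base_point_near T : near_base T base_point.
Proof.
rewrite /near_base /= normr0 mulr0 addNr normr0; split; lra.
Qed.

Lemma near_base_nbhs T : 0 < T -> exists2 d : R, 0 < d &
  forall w, cabs (w - base_point) < d -> near_base T w.
Proof.
move=> T0; exists (4^-1 / (T + 3)); first by rewrite divr_gt0//; lra.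
have T3 : 0 < T + 3 by lra.
move=> [x y]; rewrite ltr_pdivlMr// => wd.
have := norm_Re_le ((x +i* y : C) - base_point).
have := norm_Im_le ((x +i* y : C) - base_point).
move: wd; set c := cabs _; rewrite /base_point /= opprK subr0 /near_base /= => wd ci cr.
have c0 : 0 <= c := le_trans (normr_ge0 _) cr.
have := mulr_ge0 c0 (ltW T0); have := ler_wpM2l (ltW T3) ci; split; lra.
Qed.

Lemma segment_slit w z : slit_plane w -> segment base_point w z -> slit_plane z.
Proof.
move=> sw /segment_base[s /andP[s0 s1] ->] [/= /eqP]; rewrite mulf_eq0.
case/orP=> /eqP E; first by rewrite E; lra.
move=> h; apply: sw; split=> //; nra.
Qed.

Lemma segment_sector T w z : 0 < T -> sector T w -> segment base_point w z ->
  sector T z.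
Proof.
move=> T0 [wT wI] /segment_base[s /andP[s0 s1] ->].
rewrite /sector /= normrM (ger0_norm s0).
have := ler_wpM2l s0 (ltW wI); have := ler_wpM2l s0 (ltW wT).
have [->|s1'] := eqVneq s 1; first by split; lra.
have sl : 0 < 1 - s by rewrite subr_gt0 lt_neqAle s1'.
have := mulr_gt0 sl T0; split; lra.
Qed.

(** The sides through [vout] bound the sector. *)
Lemma outer_edges T w z : 0 < T -> sector T w ->
  segment (vtop T) vout z \/ segment vout (vbot T) z ->
  [/\ slit_plane z, z != w & `|Im (w - z)| <= 2].
Proof.
move=> T0 [wT wI] E.
have [x [y [-> y1 yE yx]]] : exists x y : R, [/\ z = x +i* y, `|y| <= 1,
    (T + 3) * `|y| = x + 3 & 0 <= x -> y != 0].
  case: E => -[s /andP[s0 s1] ->].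
    exists (T - s * (T + 3)), (1 - s).
    have n1 : `|1 - s| = 1 - s by rewrite ger0_norm//; lra.
    split; [|by rewrite n1; lra|by rewrite n1; ring|].
      by congr (_ +i* _); rewrite /=; ring.
    by move=> h; apply/eqP => s1'; nra.
  exists (- 3 + s * (T + 3)), (- s).
  split; [|by rewrite normrN ger0_norm//|by rewrite normrN ger0_norm//; ring|].
    by congr (_ +i* _); rewrite /=; ring.
  by move=> h; apply/eqP => s1'; nra.
split.
- by move=> /= [y0 x0]; have := yx x0; rewrite y0 eqxx.
- by apply: contraTneq wI => <- /=; rewrite yE ltxx.
- rewrite raddfB /= (le_trans (ler_normB _ _))//.
  have := normr_ge0 (Im w); nra.
Qed.

End regions.

Section extension.
Context {R : realType} {X : normedModType R[i]} (Xc : seq_complete X).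
Local Notation C := (R[i]^o).
Implicit Types (z w : C) (T : R).

(** A substitute for [1 / (z - w)] with the same residue that is a geometric series
in [exp (w - z)]: it produces the values of the Laplace transform at the
natural numbers only. *)
Definition ekernel w : C -> C := resolvent_kernel (fun z => cexp (- z)) (cexp w).

Lemma ekernelE w z : ekernel w z = (1 - cexp (w - z))^-1.
Proof. by rewrite /ekernel /resolvent_kernel -cexpD [- z + w]addrC. Qed.

Lemma ekernel_den w z : z != w -> `|Im (w - z)| <= 2 -> 1 - cexp (- z) * cexp w != 0.
Proof.
move=> zw I2; rewrite -cexpD [- z + w]addrC subr_eq0; apply: contra_neq zw => E.
by apply/esym/eqP; rewrite -subr_eq0; apply/eqP; apply: cexp_eq1.
Qed.

Lemma has_deriv_cexpN z : has_deriv (X := C) (fun w => cexp (- w)) z (- cexp (- z)).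
Proof.
have := has_deriv_cexpM (-1) z; rewrite !mulN1r.
by apply: has_deriv_near; exists 1 => // w _; rewrite mulN1r.
Qed.

Lemma has_deriv_kernel (x : C) z : 1 - cexp (- z) * x != 0 ->
  has_deriv (X := C) (resolvent_kernel (fun z => cexp (- z)) x) z
    (- (cexp (- z) * x) * resolvent_kernel (fun z => cexp (- z)) x z ^+ 2).
Proof.
move=> n0; have d1 : has_deriv (X := C) (fun z => 1 - cexp (- z) * x) z (cexp (- z) * x).
  have := @has_derivZ _ C _ (fun=> x) z _ 0 (has_deriv_cexpN z) (has_deriv_cst _ _).
  rewrite scaler0 addr0 => /(has_derivB (has_deriv_cst (1 : C) z)).
  by rewrite -[- _ *: x]/(- _ * x) sub0r mulNr opprK.
have := has_deriv_comp d1 (has_derivV n0).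
by rewrite -[_ *: _]/(_ * _) mulrN mulNr.
Qed.

(** [(z - w) * ekernel w z] tends to 1, the inverse of the derivative of [cexp] at
0; the other poles of the kernel are at distance [2 * pi] from [w]. *)
Lemma kernel_residue (v : C -> X) w a b c d : star w a b c d ->
  (forall z, star_region w a b c d z -> cdiff v z /\ `|Im (w - z)| <= 2) ->
  cdiff v w ->
  quad_int (fun z => ekernel w z *: v z) a b c d = winding w a b c d *: v w.
Proof.
move=> st vr vw; apply: (star_residue Xc st).
  move=> z /vr[vz I2] /eqP zw; apply: cdiffZ => //.
  by eexists; apply: has_deriv_kernel; exact: ekernel_den.
have [phi [phi0 phic phiE]] := @has_deriv_cexp0 R.
have psic : {for w, continuous (fun z => (phi (w - z))^-1 *: v z)}.
  apply: contZ; last exact: cdiff_cont.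
  have wc : {for w, continuous (fun z => w - z : C)}.
    by apply: contB; [exact: cont_cst|exact: cont_id].
  apply: contV; first by rewrite subrr phi0 oner_neq0.
  apply: (continuous_comp (g := phi) wc); rewrite subrr; exact: phic.
move=> e e0; move/continuous_rnormP: psic => /(_ e e0)[r r0 rP].
exists r => // z zw zr; have := rP z zr; rewrite subrr phi0 invr1 scale1r.
rewrite ekernelE -[w - z]add0r phiE cexp0 opprD addNKr scalerA.
rewrite add0r -[_ *: phi _]/(_ * phi _) -mulNr opprB invfM mulrA divff ?subr_eq0//.
by rewrite mul1r.
Qed.

Lemma quad_int_FTC (f F : C -> X) a b c d :
  continuous_along f a b -> continuous_along f b c ->
  continuous_along f c d -> continuous_along f d a ->
  (forall z, segment a b z \/ segment b c z \/ segment c d z \/ segment d a z ->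
     has_deriv F z (f z)) -> quad_int f a b c d = 0.
Proof.
move=> c1 c2 c3 c4 Ff; rewrite /quad_int.
rewrite (cint_FTC Xc c1 (F := F)); last by move=> z zs; apply: Ff; left.
rewrite (cint_FTC Xc c2 (F := F)); last by move=> z zs; apply: Ff; right; left.
rewrite (cint_FTC Xc c3 (F := F)); last by move=> z zs; apply: Ff; do 2 right; left.
rewrite (cint_FTC Xc c4 (F := F)); last by move=> z zs; apply: Ff; do 3 right.
by rewrite (addrC (F b - F a)) subrKA (addrC (F c - F a)) subrKA
  (addrC (F d - F a)) subrKA subrr.
Qed.

End extension.

Section kernel_mass.
Context {R : realType}.
Local Notation C := (R[i]^o).
Implicit Types (z w : C) (T : R).

Definition kernel_mass T w : C :=
  quad_int (fun z => ekernel w z *: (1 : C) : C) (vtop T) vout (vbot T) vin.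

Lemma near_base_quad T w z : 0 < T -> near_base T w ->
  segment (vtop T) vout z \/ segment vout (vbot T) z \/
  segment (vbot T) vin z \/ segment vin (vtop T) z ->
  [/\ slit_plane z, z != w & `|Im (w - z)| <= 2].
Proof.
move=> T0 wn.
have [|s1 s2 s3 s4] := @star_edges R w (vtop T) vout (vbot T) vin
    (fun z => [/\ slit_plane z, z != w & `|Im (w - z)| <= 2]) (near_base_star T0 wn).
  move=> y /(near_base_region T0 wn)[sy Iy] /eqP yw; split=> //.
  rewrite raddfB (le_trans (ler_normB _ _))//.
  by have := near_base_Im T0 wn; lra.
by move=> [|[|[]]]; [exact: s1|exact: s2|exact: s3|exact: s4].
Qed.

Lemma kernel_massE T w : 0 < T -> near_base T w ->
  kernel_mass T w = winding w (vtop T) vout (vbot T) vin.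
Proof.
move=> T0 wn.
have C1 z : cdiff (fun=> 1 : C) z by exists 0; exact: has_deriv_cst.
rewrite /kernel_mass (kernel_residue (@complex_seq_complete R) (v := fun=> 1 : C)).
- by rewrite -[_ *: _]/(_ * _) mulr1.
- exact: near_base_star.
- move=> z /(near_base_region T0 wn)[_ Iz]; split; first exact: C1.
  rewrite raddfB (le_trans (ler_normB _ _))//.
  by have := near_base_Im T0 wn; lra.
- exact: C1.
Qed.

Lemma kernel_cont T w z : 0 < T -> near_base T w ->
  segment (vtop T) vout z \/ segment vout (vbot T) z \/
  segment (vbot T) vin z \/ segment vin (vtop T) z ->
  {for z, continuous (ekernel w)}.
Proof.
move=> T0 wn /(near_base_quad T0 wn)[_ zw I2].
exact: has_deriv_cont (has_deriv_kernel (ekernel_den zw I2)).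
Qed.

(** The derivative vanishes: differentiating the kernel in the parameter
gives, up to a factor, its derivative in the variable of integration, whose
integral along a closed contour vanishes. *)
Lemma kernel_mass_cst T w : 0 < T -> near_base T w ->
  kernel_mass T w = kernel_mass T base_point.
Proof.
move=> T0 wn; have Cc := @complex_seq_complete R.
pose k x := resolvent_kernel (fun z : C => cexp (- z)) x.
have ac p q : continuous_along (fun z : C => cexp (- z) : C) p q.
  by move=> z _; exact: has_deriv_cont (has_deriv_cexpN z).
have onec p q : continuous_along (fun=> 1 : C) p q.
  by move=> z _; exact: cont_cst.
have dm v : near_base T v -> has_deriv (X := C) (kernel_mass T) v 0.
  move=> vn; set x := cexp v.
  have den z : segment (vtop T) vout z \/ segment vout (vbot T) z \/
      segment (vbot T) vin z \/ segment vin (vtop T) z -> 1 - cexp (- z) * x != 0.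
    by move=> /(near_base_quad T0 vn)[_ zv I2]; exact: ekernel_den.
  pose dk z : C := (cexp (- z) * k x z ^+ 2) *: (1 : C).
  have dkc z : segment (vtop T) vout z \/ segment vout (vbot T) z \/
      segment (vbot T) vin z \/ segment vin (vtop T) z -> {for z, continuous dk}.
    move=> zs; apply: contZ; last exact: cont_cst.
    apply: contM; first exact: has_deriv_cont (has_deriv_cexpN z).
    by apply: contX; exact: (kernel_cont T0 vn zs).
  pose N y : C := quad_int (fun z => k y z *: (1 : C) : C) (vtop T) vout (vbot T) vin.
  have dN : has_deriv (X := C) N x (quad_int dk (vtop T) vout (vbot T) vin).
    apply: has_derivD; [apply: has_derivD; [apply: has_derivD|]|];
      apply: (has_deriv_cint_kernel Cc) => // z zs; apply: den.
    - by left.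
    - by right; left.
    - by do 2 right; left.
    - by do 3 right.
  have N0 : quad_int dk (vtop T) vout (vbot T) vin = 0.
    apply: (quad_int_FTC Cc (F := fun z => - x^-1 *: (k x z : C))).
    - by move=> z zs; apply: dkc; left.
    - by move=> z zs; apply: dkc; right; left.
    - by move=> z zs; apply: dkc; do 2 right; left.
    - by move=> z zs; apply: dkc; do 3 right.
    move=> z /den n0; have x0 : x != 0 := cexp_neq0 _.
    have := has_derivZ (has_deriv_cst (- x^-1 : C) z) (has_deriv_kernel n0).
    rewrite scale0r add0r /dk -[_ *: 1]/(_ * 1) mulr1.
    rewrite -[- x^-1 *: _]/(- x^-1 * _).
    set u := cexp (- z); set y := resolvent_kernel _ _ _.
    have -> : - x^-1 * (- (u * x) * y ^+ 2) = u * y ^+ 2 by field; exact: x0.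
    exact.
  rewrite N0 in dN; rewrite -(scaler0 C (cexp v)).
  exact: (has_deriv_comp (has_deriv_cexp v) dN).
have : cint (X := C) (fun=> 0) base_point w = kernel_mass T w - kernel_mass T base_point.
  apply: (cint_FTC Cc); first by move=> z _; exact: cont_cst.
  by move=> z /(near_base_segment T0 wn); exact: dm.
by rewrite (cint0 Cc) => /esym/eqP; rewrite subr_eq0 => /eqP.
Qed.

End kernel_mass.

Section extension_theorem.
Context {R : realType} {X : normedModType R[i]} (Xc : seq_complete X).
Local Notation C := (R[i]^o).
Implicit Types (z w : C) (T : R).

(** The Laplace transform at [n], over a path around the origin that is cut off at
[Re z = T]. *)
Definition laplace (v : C -> X) T (n : nat) : X :=
  cint (fun z => cexp (- (n%:R * z)) *: v z) (vbot T) vin +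
  cint (fun z => cexp (- (n%:R * z)) *: v z) vin (vtop T).

Lemma cexp_scale_cont (v : C -> X) (t : R[i]) p q : continuous_along v p q ->
  continuous_along (fun z => cexp (- (t * z)) *: v z) p q.
Proof.
move=> vc z zs; apply: contZ; last exact: vc.
exact: has_deriv_cont (has_deriv_cexpNM t z).
Qed.

(** On an edge to the right of [w] the kernel is the sum of a geometric series. *)
Lemma kernel_series (v : C -> X) w p q (th : R) : continuous_along v p q ->
  0 <= th < 1 ->
  (forall z, segment p q z -> cabs (cexp w * cexp (- z)) <= th) ->
  (forall z, segment p q z -> 1 - cexp (- z) * cexp w != 0) ->
  \sum_(i < n) cexp w ^+ i *: cint (fun z => cexp (- (i%:R * z)) *: v z) p q
    @[n --> \oo] --> cint (fun z => ekernel w z *: v z) p q.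
Proof.
move=> vc /andP[th0 th1] wth den.
have kvc : continuous_along (fun z => ekernel w z *: v z) p q.
  move=> z zs; apply: contZ; last exact: vc.
  exact: has_deriv_cont (has_deriv_kernel (den z zs)).
have ec i : continuous_along (fun z => cexp (- (i%:R * z)) *: v z) p q.
  exact: cexp_scale_cont.
have tc i : continuous_along (fun z => cexp w ^+ i *: (cexp (- (i%:R * z)) *: v z)) p q.
  by move=> z zs; apply: contZ; [exact: cont_cst|exact: ec].
have [M MP] := continuous_along_bounded kvc.
apply/cvg_rnormP => e e0.
have th01 : 0 <= th < 1 by rewrite th0.
have [n nP] : exists n, forall i, (n <= i)%N -> cabs (q - p) * (`|M| * th ^+ i) <= e.
  have mcv : `|th| < 1 by rewrite ger0_norm.
  have := @cvg_geometric R (cabs (q - p) * `|M|) th mcv.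
  move=> /cvgrPdist_le/(_ e e0)[n _ nP]; exists n => i ni.
  have := nP i ni; rewrite /= sub0r normrN mulrA => /(le_trans (ler_norm _)).
  exact.
exists n => i ni.
have -> : \sum_(j < i) cexp w ^+ j *: cint (fun z => cexp (- (j%:R * z)) *: v z) p q =
    cint (fun z => \sum_(j < i) cexp w ^+ j *: (cexp (- (j%:R * z)) *: v z)) p q.
  by rewrite (cint_sum Xc i tc); apply: eq_bigr => j _; rewrite (cintZ Xc _ (ec j)).
have sc : continuous_along
    (fun z => \sum_(j < i) cexp w ^+ j *: (cexp (- (j%:R * z)) *: v z)) p q.
  exact: (@continuous_along_sum R X i _ p q tc).
rewrite -(cintB Xc sc kvc); apply: le_trans (nP i ni).
apply: (cint_bound Xc).
  by move=> z zs; apply: contB; [exact: sc|exact: kvc].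
move=> z zs; pose x := cexp w * cexp (- z).
have -> : \sum_(j < i) cexp w ^+ j *: (cexp (- (j%:R * z)) *: v z) =
    (\sum_(j < i) x ^+ j) *: v z.
  rewrite scaler_suml; apply: eq_bigr => j _.
  by rewrite scalerA -mulrN cexpMn -exprMn.
have den' : 1 - x != 0 by rewrite /x mulrC den.
have -> : \sum_(j < i) x ^+ j = (1 - x ^+ i) * ekernel w z.
  apply: (mulfI den'); rewrite /ekernel /resolvent_kernel (mulrC (cexp (- z))) -/x.
  rewrite mulrCA divff// mulr1; have := subrX1 x i.
  by rewrite -[1 - x]opprB mulNr => <-; rewrite opprB.
rewrite -scalerBl mulrBl mul1r addrAC subrr add0r -mulNr -scalerA rnormZ cabsN cabsX.
rewrite mulrC ler_pM ?rnorm_ge0 ?exprn_ge0 ?cabs_ge0//.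
  by rewrite (le_trans (MP z zs))// ler_norm.
by rewrite lerXn2r ?nnegrE ?cabs_ge0// wth.
Qed.

(** Cauchy's formula around the contour splits [v] near [base_point] into an
integral over the two outer edges, holomorphic in the whole sector, and one
over the two inner edges, which is a power series in [cexp w] with coefficients
[laplace v T n]. Their decay makes the series converge in the sector. *)
Theorem laplace_extension (v : C -> X) T (K : R) : 0 < T ->
  (forall z, slit_plane z -> cdiff v z) ->
  (forall n, rnorm (laplace v T n) <= K * expR (- T) ^+ n) ->
  exists V : C -> X, (forall w, sector T w -> cdiff V w) /\
    (forall w, sector T w -> slit_plane w -> V w = v w).
Proof.
move=> T0 vd vK.
have vc p q : (forall z, segment p q z -> slit_plane z) -> continuous_along v p q.
  by move=> sl z /sl/vd/cdiff_cont.
have bn := base_point_near T.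
have sedge := near_base_quad T0 bn.
have v1 : continuous_along v (vtop T) vout.
  by apply: vc => z zs; have [] := sedge z (or_introl zs).
have v2 : continuous_along v vout (vbot T).
  by apply: vc => z zs; have [] := sedge z (or_intror (or_introl zs)).
have v3 : continuous_along v (vbot T) vin.
  by apply: vc => z zs; have [] := sedge z (or_intror (or_intror (or_introl zs))).
have v4 : continuous_along v vin (vtop T).
  by apply: vc => z zs; have [] := sedge z (or_intror (or_intror (or_intror zs))).
pose k x := resolvent_kernel (fun z : C => cexp (- z)) x.
pose out x := cint (fun z => k x z *: v z) (vtop T) vout +
  cint (fun z => k x z *: v z) vout (vbot T).
pose inn x := series_sum (fun n => x ^+ n *: laplace v T n).
have ac p q : continuous_along (fun z : C => cexp (- z) : C) p q.
  by move=> z _; exact: has_deriv_cont (has_deriv_cexpN z).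
pose V w := (kernel_mass T base_point)^-1 *: (out (cexp w) + inn (cexp w)).
have Vd w : sector T w -> cdiff V w.
  move=> ws; have edge z zs := outer_edges T0 ws (z := z) zs.
  have [l1 d1] : cdiff out (cexp w).
    have e1 z : segment (vtop T) vout z -> 1 - cexp (- z) * cexp w != 0.
      by move=> zs; have [_ zw I2] := edge z (or_introl zs); exact: ekernel_den.
    have e2 z : segment vout (vbot T) z -> 1 - cexp (- z) * cexp w != 0.
      by move=> zs; have [_ zw I2] := edge z (or_intror zs); exact: ekernel_den.
    eexists; apply: has_derivD.
      exact: (has_deriv_cint_kernel Xc (ac _ _) v1 e1).
    exact: (has_deriv_cint_kernel Xc (ac _ _) v2 e2).
  have [l2 d2] : cdiff inn (cexp w).
    apply: (cdiff_power_series Xc (m := expR (- T)) (K := K)) => //.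
      exact: expR_gt0.
    rewrite cabs_cexp -expRD -expR0 ltr_expR.
    by case: ws; lra.
  have d3 := has_deriv_comp (has_deriv_cexp w) d1.
  have d4 := has_deriv_comp (has_deriv_cexp w) d2.
  eexists; exact: (has_derivZ (has_deriv_cst _ w) (has_derivD d3 d4)).
have c0 : kernel_mass T base_point != 0.
  by rewrite kernel_massE//; apply: winding_neq0; exact: near_base_star.
have Vv w : near_base T w -> V w = v w.
  move=> wn.
  have E : quad_int (fun z => ekernel w z *: v z) (vtop T) vout (vbot T) vin =
      kernel_mass T base_point *: v w.
    rewrite -(kernel_mass_cst T0 wn) (kernel_massE T0 wn).
    have slw : slit_plane w.
      by move=> [_ Rw]; have [] := near_base_bounds T0 wn; lra.
    apply: (kernel_residue Xc); [exact: near_base_star| |exact: vd].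
    move=> z /(near_base_region T0 wn)[sz Iz]; split; first exact: vd.
    rewrite raddfB (le_trans (ler_normB _ _))//.
    by have := near_base_Im T0 wn; lra.
  rewrite /V -[RHS]scale1r -(mulVf c0) -scalerA -E; congr (_ *: _).
  rewrite /out /quad_int -/(ekernel w) -[RHS]addrA; congr (_ + _).
  have edge z zs := near_base_quad T0 wn (z := z) zs.
  have inner z : segment (vbot T) vin z \/ segment vin (vtop T) z -> - 1 <= Re z.
    by case=> -[s /andP[s0 s1] ->]; rewrite /vbot /vtop /vin /=; nra.
  pose th := expR (- 2^-1 : R).
  have th01 : 0 <= th < 1.
    by rewrite expR_ge0 /th -[ltRHS]expR0 ltr_expR /=; lra.
  have thP z : - 1 <= Re z -> cabs (cexp w * cexp (- z)) <= th.
    move=> Rz; rewrite -cexpD cabs_cexp ler_expR raddfD raddfN /=.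
    by have [_ + _ _] := near_base_bounds T0 wn; lra.
  have s3 := @kernel_series v w (vbot T) vin th v3 th01
    (fun z zs => thP z (inner z (or_introl zs)))
    (fun z zs => let: And3 _ zw I2 := edge z (or_intror (or_intror (or_introl zs))) in
       ekernel_den zw I2).
  have s4 := @kernel_series v w vin (vtop T) th v4 th01
    (fun z zs => thP z (inner z (or_intror zs)))
    (fun z zs => let: And3 _ zw I2 := edge z (or_intror (or_intror (or_intror zs))) in
       ekernel_den zw I2).
  rewrite /inn /series_sum.
  have -> : (fun n => \sum_(i < n) cexp w ^+ i *: laplace v T i) =
    (fun n => \sum_(i < n) cexp w ^+ i *: cint (fun z => cexp (- (i%:R * z)) *: v z) (vbot T) vin +
     \sum_(i < n) cexp w ^+ i *: cint (fun z => cexp (- (i%:R * z)) *: v z) vin (vtop T)).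
    apply/funext => n; rewrite -big_split /=; apply: eq_bigr => i _.
    by rewrite -scalerDr.
  by apply: (cvg_lim (@norm_hausdorff _ X)); exact: cvgD s3 s4.
exists V; split=> // w ws sw; apply/eqP; rewrite -subr_eq0; apply/eqP.
apply: (zero_near_segment Xc (f := fun w => V w - v w) (p := base_point)).
  move=> z zs; have [r1 r10 r1P] := sector_open T0 (segment_sector T0 ws zs).
  have [r2 r20 r2P] := slit_plane_open (segment_slit sw zs).
  exists (Num.min r1 r2); first by rewrite lt_min r10.
  move=> y; rewrite lt_min => /andP[y1 y2].
  have [l1 d1] := Vd y (r1P y y1); have [l2 d2] := vd y (r2P y y2).
  by exists (l1 - l2); exact: has_derivB.
have [d d0 dP] := near_base_nbhs T0; exists d => // z /dP/Vv ->.
by rewrite subrr.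
Qed.

End extension_theorem.

(** * Locally convex spaces *)

Section unbundled_linear.
Context {K : pzRingType} {U V : lmodType K} (L : U -> V).
Hypothesis Ll : linear L.

Lemma linear_fun0 : L 0 = 0.
Proof.
have := Ll 1 0 0; rewrite scaler0 addr0 scale1r => /eqP.
by rewrite -[X in X == _]addr0 (inj_eq (addrI _)) eq_sym => /eqP.
Qed.

Lemma linear_funZ t x : L (t *: x) = t *: L x.
Proof. by rewrite -[t *: x]addr0 Ll linear_fun0 addr0. Qed.

Lemma linear_funB x y : L (x - y) = L x - L y.
Proof. by rewrite addrC -scaleN1r Ll scaleN1r addrC. Qed.

End unbundled_linear.

Section generated.
Context {R : realType} {I : Type} {W : tvsType R[i]} (Q : seminorm_system I W).
Hypothesis gen : seminorms_generate W Q.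
Local Notation C := (R[i]^o).
Implicit Types (f g : C -> W) (z w : C) (l : W) (u : nat -> W).

Lemma seminorm_cvgP u l : u @ \oo --> l <-> forall a (e : R), 0 < e ->
  exists n, forall i, (n <= i)%N -> Q a (u i - l) < e.
Proof.
split=> [ul a e e0|ul V].
  have /ul[n _ nP] : nbhs l [set y | Q a (y - l) < e] by rewrite gen; exists a, e.
  by exists n => i /nP.
rewrite gen => -[a [e e0 eV]]; have [n nP] := ul a e e0.
by exists n => // i /= /nP; exact: eV.
Qed.

Lemma seminorm_seq_complete u : seq_complete W ->
  (forall a (e : R), 0 < e -> exists n, forall i j, (n <= i)%N -> (n <= j)%N ->
     Q a (u i - u j) < e) ->
  exists l, u @ \oo --> l.
Proof.
move=> Wc cu; apply: Wc => V; rewrite gen => -[a [e e0 eV]].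
have [n nP] := cu a e e0.
by apply/double_tailP; exists n => i j ni nj; apply: eV; rewrite subr0; exact: nP.
Qed.

Lemma seq_complete_seminorm : (forall u,
    (forall a (e : R), 0 < e -> exists n, forall i j, (n <= i)%N -> (n <= j)%N ->
       Q a (u i - u j) < e) ->
    exists l, u @ \oo --> l) -> seq_complete W.
Proof.
move=> H u cu; apply: H => a e e0.
have /cu/double_tailP[n nP] : nbhs (0 : W) [set y | Q a (y - 0) < e].
  by rewrite gen; exists a, e.
by exists n => i j ni nj; have := nP i j ni nj; rewrite /= subr0.
Qed.

(** The seminorms give one description of derivatives in [E] and in the graph
space. *)
Lemma is_cderiveP f z l : is_cderive f z l <-> forall a (e : R), 0 < e ->
  exists2 d : R, 0 < d & forall w, w != z -> cabs (w - z) < d ->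
    Q a ((w - z)^-1 *: (f w - f z) - l) < e.
Proof.
split=> [fl a e e0|fl V].
  have /fl : nbhs l [set y | Q a (y - l) < e] by rewrite gen; exists a, e.
  move=> /nbhs_ballP[d /= d0 dP]; exists (Re d); first by rewrite -ltcR ReK// ltW.
  move=> w wz wd; have := dP (w - z); rewrite subrKC; apply.
    by rewrite -ball_normE /= sub0r normrN -cabsE -(ReK (ltW d0)) ltcR.
  by rewrite /= subr_eq0.
rewrite gen => -[a [e e0 eV]]; have [d d0 dP] := fl a e e0.
apply: (nbhs_ballP (0 : C) _).2; exists d%:C; first by rewrite /= ltcR.
move=> h; rewrite -ball_normE /= sub0r normrN -cabsE ltcR => hd h0.
have := dP (z + h); rewrite addrAC subrr add0r => h'; apply/eV/h' => //.
by rewrite -subr_eq0 addrAC subrr add0r.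
Qed.

Lemma is_cderiveD f g z l m : is_cderive f z l -> is_cderive g z m ->
  is_cderive (fun w => f w + g w) z (l + m).
Proof.
move=> /is_cderiveP fl /is_cderiveP gm; apply/is_cderiveP => a e e0.
have e2 : 0 < e / 2 by rewrite divr_gt0.
have [d1 d10 d1P] := fl a _ e2; have [d2 d20 d2P] := gm a _ e2.
exists (Num.min d1 d2); first by rewrite lt_min d10.
move=> w wz; rewrite lt_min => /andP[w1 w2].
rewrite opprD addrACA scalerDr opprD addrACA (le_lt_trans (seminormD _ _ _))//.
by have := d1P w wz w1; have := d2P w wz w2; lra.
Qed.

Lemma is_cderiveN f z l : is_cderive f z l -> is_cderive (fun w => - f w) z (- l).
Proof.
move=> /is_cderiveP fl; apply/is_cderiveP => a e /(fl a)[d d0 dP].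
exists d => // w wz wd; rewrite -opprD scalerN -opprD seminormN; exact: dP.
Qed.

Lemma is_cderive_cst (x : W) z : is_cderive (fun=> x) z 0.
Proof.
apply/is_cderiveP => a e e0; exists 1 => // w _ _.
by rewrite subrr scaler0 subr0 seminorm0.
Qed.

Lemma is_cderive_linear (X : normedModType R[i]) (L : W -> X) (K : R) b f z l :
  linear L -> (forall x, rnorm (L x) <= K * Q b x) -> is_cderive f z l ->
  has_deriv (fun w => L (f w)) z (L l).
Proof.
move=> Ll LK /is_cderiveP fl; apply/has_derivP => e e0.
have LD := linear_funB Ll; have LZ := linear_funZ Ll.
have K0 : 0 < `|K| + 1 by rewrite ltr_wpDl.
have [d d0 dP] := fl b _ (divr_gt0 e0 K0).
exists d => // w wd; have [->|wz] := eqVneq w z.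
  by rewrite !subrr scale0r subrr rnorm0 cabs0 mulr0.
have wz0 : w - z != 0 by rewrite subr_eq0.
have -> : L (f w) - L (f z) - (w - z) *: L l =
    (w - z) *: L ((w - z)^-1 *: (f w - f z) - l).
  by rewrite LD LZ LD [RHS]scalerBr scalerA divff// scale1r.
rewrite rnormZ mulrC ler_wpM2r ?cabs_ge0// (le_trans (LK _))//.
have := dP w wz wd; rewrite ltr_pdivlMr//; set x := Q b _ => xe.
have x0 : 0 <= x := seminorm_ge0 _ _.
have := ler_wpM2r x0 (ler_norm K); lra.
Qed.

(** The difference quotients form a Cauchy family for each seminorm, hence
converge in [W]; the local derivatives identify the limit. *)
Lemma cderivable_local (X : I -> normedModType R[i]) (k : forall a, W -> X a) f z :
  seq_complete W -> (forall a, linear (k a)) ->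
  (forall a x, rnorm (k a x) = Q a x) ->
  (forall a, cdiff (fun w => k a (f w)) z) -> cderivable f z.
Proof.
move=> Wc kl kQ fd; pose q w := (w - z)^-1 *: (f w - f z).
have kB a := linear_funB (kl a); have kZ a := linear_funZ (kl a).
have lim a : exists m : X a, forall e : R, 0 < e -> exists2 d : R, 0 < d &
    forall w, w != z -> cabs (w - z) < d -> rnorm (k a (q w) - m) <= e.
  have [m /has_derivP fm] := fd a; exists m => e e0; have [d d0 dP] := fm e e0.
  exists d => // w wz wd; have := dP w wd; have wz0 : w - z != 0 by rewrite subr_eq0.
  have -> : k a (f w) - k a (f z) - (w - z) *: m = (w - z) *: (k a (q w) - m).
    by rewrite /q kZ kB [RHS]scalerBr scalerA divff// scale1r.
  by rewrite rnormZ mulrC ler_pM2r// cabs_gt0.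
pose s n : C := z + (n.+1%:R^-1 : R)%:C.
have sz n : s n != z.
  rewrite -subr_eq0 /s addrAC subrr add0r -cabs_gt0 cabs_real normr_gt0.
  by rewrite gt_eqF// invr_gt0.
have sd (d : R) : 0 < d -> exists n, forall i, (n <= i)%N -> cabs (s i - z) < d.
  move=> d0; have [n _ nP] : \forall n \near \oo, n.+1%:R^-1 < d.
    by apply: (cvgr_lt 0) => //; exact: cvg_harmonic.
  exists n => i ni; rewrite /s addrAC subrr add0r cabs_real ger0_norm ?invr_ge0//.
  exact: nP.
have [l /seminorm_cvgP ql] : exists l, q (s n) @[n --> \oo] --> l.
  apply: seminorm_seq_complete => // a e e0; have [m mP] := lim a.
  have [|d d0 dP] := mP (e / 3); first by rewrite divr_gt0.
  have [n nP] := sd d d0; exists n => i j ni nj; rewrite -kQ kB.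
  rewrite -[X in rnorm X](subrKA m) -(opprB (k a (q (s j)))).
  rewrite (le_lt_trans (rnormB _ _))//.
  by have := dP _ (sz i) (nP i ni); have := dP _ (sz j) (nP j nj); lra.
exists l; apply/is_cderiveP => a e e0; have [m mP] := lim a.
have e3 : 0 < e / 4 by rewrite divr_gt0.
have [d d0 dP] := mP _ e3; have [n1 n1P] := sd d d0; have [n2 n2P] := ql a _ e3.
exists d => // w wz wd; rewrite -/(q w) -kQ kB.
have h1 := dP w wz wd.
have h2 := dP _ (sz (maxn n1 n2)) (n1P _ (leq_maxl _ _)).
have h3 := n2P _ (leq_maxr n1 n2); rewrite -kQ kB in h3.
rewrite -[X in rnorm X](subrKA m) (le_lt_trans (rnormD _ _))//.
rewrite -(subrKA (k a (q (s (maxn n1 n2)))) m).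
have := rnormD (m - k a (q (s (maxn n1 n2)))) (k a (q (s (maxn n1 n2))) - k a l).
by rewrite rdistC in h2; lra.
Qed.

Lemma hausdorff_separated (x : W) : hausdorff_space W ->
  (forall a, Q a x = 0) -> x = 0.
Proof.
move=> Wh x0; apply: Wh => U V Ux; rewrite gen => -[a [e e0 eV]].
exists x; split; first exact: nbhs_singleton.
by apply: eV; rewrite subr0 x0.
Qed.

End generated.

Section local_maps.
Context {R : realType} {V : lmodType R[i]} (p : seminorm V).

Lemma local_map_linear : linear (local_map p).
Proof. by move=> a x y; rewrite /local_map linearP /= linearP. Qed.

Lemma rnorm_local_map x : rnorm (local_map p x) = p x.
Proof. by rewrite /local_map rnorm_to_completion rnorm_normed_quot_pi. Qed.

End local_maps.

Lemma opnorm_bound (R : realType) (X Y : normedModType R[i]) (L : X -> Y) (M : R) x :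
  linear L -> (opnorm L <= M%:E)%E -> rnorm (L x) <= M * rnorm x.
Proof.
move=> Ll LM.
have LZ := linear_funZ Ll.
have [x0|x0] := eqVneq (rnorm x) 0.
  by rewrite x0 mulr0 (rnorm0_eq0 x0) -(scale0r 0) LZ scale0r rnorm0.
have xp : 0 < rnorm x by rewrite lt_neqAle eq_sym x0 rnorm_ge0.
have cx : cabs (rnorm x)^-1%:C = (rnorm x)^-1.
  by rewrite cabs_real ger0_norm// invr_ge0 rnorm_ge0.
have : ((rnorm (L ((rnorm x)^-1%:C *: x)))%:E <= M%:E)%E.
  apply: le_trans LM; apply: ereal_sup_ubound; exists ((rnorm x)^-1%:C *: x) => //=.
  by rewrite rnormZ cx mulVf.
by rewrite lee_fin LZ rnormZ cx mulrC ler_pdivrMr.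
Qed.

Section graph_space.
Context {R : realType} {I : Type} {E : tvsType R[i]} (P : seminorm_system I E).
Context {D : submodClosed E} (A : {linear opdom D -> E}).
Hypothesis Egen : seminorms_generate E P.

(** A Cauchy sequence for the graph topology converges together with its image
under [A]; closedness relates the two limits. *)
Lemma graph_seq_complete : seq_complete E -> seq_closed_op A ->
  seq_complete (graph_space P A).
Proof.
move=> Ec Acl; have Fgen := @graph_system_generate R I E P D A.
apply: (seq_complete_seminorm Fgen) => u cu.
have part (L : opdom D -> E) : (forall a x, P a (L x) <= graph_seminorm A (P a) x) ->
    (forall x y, L (x - y) = L x - L y) -> exists l : E, L (u n) @[n --> \oo] --> l.
  move=> LP LB; apply: (seminorm_seq_complete Egen (u := fun n => L (u n)) Ec) => a e e0.
  have [n nP] := cu a e e0; exists n => i j ni nj.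
  by rewrite -LB (le_lt_trans (LP a _))//; exact: nP.
have [|//|x ux] := part (@opval R E D).
  by move=> a v; rewrite /= /graph_seminorm_fun lerDl seminorm_ge0.
have [||y uy] := part A.
- by move=> a v; rewrite /= /graph_seminorm_fun lerDr seminorm_ge0.
- by move=> v w; rewrite linearB.
have [v vx vy] := Acl u x y ux uy; exists v.
apply/(seminorm_cvgP Fgen) => a e e0; have e2 : 0 < e / 2 by rewrite divr_gt0.
have [n1 n1P] := (seminorm_cvgP Egen _ _).1 ux a _ e2.
have [n2 n2P] := (seminorm_cvgP Egen _ _).1 uy a _ e2.
exists (maxn n1 n2) => i; rewrite geq_max => /andP[i1 i2].
have := n1P i i1; have := n2P i i2; rewrite -vx -vy -linearB.
rewrite /= /graph_seminorm_fun -[opval (u i) - opval v]/(opval (u i - v)); lra.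
Qed.

Lemma graph_separated (x : opdom D) : hausdorff_space E ->
  (forall a, graph_seminorm A (P a) x = 0) -> x = 0.
Proof.
move=> Eh x0; apply: val_inj; apply: (hausdorff_separated Egen Eh) => a.
apply/eqP; rewrite eq_le seminorm_ge0 andbT -(x0 a).
by rewrite /= /graph_seminorm_fun lerDl seminorm_ge0.
Qed.

End graph_space.

(** * Decay of the Laplace transform *)

Section decay.
Context {R : realType}.
Local Notation C := (R[i]^o).
Implicit Types (z p q : C) (T : R).

Lemma cabs_cexpMn (n : nat) z : cabs (cexp (- (n%:R * z))) = expR (- (n%:R * Re z)).
Proof.
by rewrite -mulrN cexpMn cabsX cabs_cexp raddfN /= -expRM_natl mulrN.
Qed.

(** The decay [e ^ (- N n)] of the defect absorbs the growth [e ^ n] along the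
contour. *)
Lemma exponent_le (n T N : R) : 0 <= n -> T + 1 <= N ->
  - (n * -1) + - (N * n) <= - (n * T).
Proof. by move=> n0 TN; nra. Qed.

Lemma cint_exp_bound (X : normedModType R[i]) (Xc : seq_complete X) (f : C -> X)
    (n : nat) p q (m M : R) : continuous_along f p q ->
  (forall z, segment p q z -> m <= Re z) ->
  (forall z, segment p q z -> rnorm (f z) <= M) ->
  rnorm (cint (fun z => cexp (- (n%:R * z)) *: f z) p q) <=
    cabs (q - p) * (expR (- (n%:R * m)) * M).
Proof.
move=> fc pm fM; apply: (cint_bound Xc); first exact: cexp_scale_cont.
move=> z zs; rewrite rnormZ cabs_cexpMn ler_pM ?expR_ge0 ?rnorm_ge0 ?fM//.
by rewrite ler_expR lerN2 ler_wpM2l// pm.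
Qed.

Lemma cint_FTC_solve (X : normedModType R[i]) (Xc : seq_complete X) (f g h F : C -> X) p q :
  continuous_along g p q -> continuous_along f p q -> continuous_along h p q ->
  (forall z, segment p q z -> has_deriv F z (g z - f z - h z)) ->
  cint f p q = cint g p q - cint h p q - (F q - F p).
Proof.
move=> gc fc hc dF.
have c1 : continuous_along (fun z => g z - f z) p q.
  by move=> z zs; apply: contB; [exact: gc|exact: fc].
have c2 : continuous_along (fun z => g z - f z - h z) p q.
  by move=> z zs; apply: contB; [exact: c1|exact: hc].
rewrite -(cint_FTC Xc c2 dF) (cintB Xc c1 hc) (cintB Xc gc fc) [X in _ - X]addrAC.
by rewrite opprB subrKC.
Qed.

Lemma boundary_terms_bound (X : normedModType R[i]) (g1 g2 h1 h2 f1 f2 f3 : X) :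
  rnorm (g1 - h1 - (f2 - f1) + (g2 - h2 - (f3 - f2))) <=
  rnorm (g1 + g2) + (rnorm h1 + rnorm h2) + (rnorm f3 + rnorm f1).
Proof.
have -> : g1 - h1 - (f2 - f1) + (g2 - h2 - (f3 - f2)) =
    (g1 + g2) - (h1 + h2) - (f3 - f1).
  rewrite addrACA -opprD (addrC (f2 - f1)) subrKA; congr (_ - _).
  by rewrite addrACA -opprD.
rewrite (le_trans (rnormB _ _))// lerD// ?rnormB//.
by rewrite (le_trans (rnormB _ _))// lerD2l rnormD.
Qed.

(** If [g - f - h] is a derivative and [g] is entire, the integral of [f] along a
path reduces to that of [h], boundary terms, and the integral of [g] along the
chord. *)
Lemma contour_estimate (X : normedModType R[i]) (Xc : seq_complete X)
    (f g h F : C -> X) p q r : (forall z, cdiff g z) ->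
  continuous_along f p q -> continuous_along f q r ->
  continuous_along h p q -> continuous_along h q r ->
  (forall z, segment p q z \/ segment q r z -> has_deriv F z (g z - f z - h z)) ->
  rnorm (cint f p q + cint f q r) <= rnorm (cint g r p) +
    (rnorm (cint h p q) + rnorm (cint h q r)) + (rnorm (F r) + rnorm (F p)).
Proof.
move=> gd f1 f2 h1 h2 dF.
have gc x y : continuous_along g x y by move=> z _; exact: cdiff_cont.
rewrite (cint_FTC_solve Xc (gc p q) f1 h1 (fun z zs => dF z (or_introl zs))).
rewrite (cint_FTC_solve Xc (gc q r) f2 h2 (fun z zs => dF z (or_intror zs))).
rewrite (le_trans (boundary_terms_bound _ _ _ _ _ _ _))//.
have -> // : cint g p q + cint g q r = - cint g r p; last by rewrite rnormN.
apply/eqP; rewrite -addr_eq0; apply/eqP.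
by apply: (goursat Xc (K := setT)) => //; exact: closedT.
Qed.

(** Finitely many terms only affect the constant. *)
Lemma eventually_geometric (b : nat -> R) (q M : R) (n0 : nat) : 0 < q ->
  (forall n, 0 <= b n) -> (forall n, (n0 <= n)%N -> b n <= M * q ^+ n) ->
  exists K, forall n, b n <= K * q ^+ n.
Proof.
move=> q0 b0 bM; exists (`|M| + \sum_(i < n0) b i / q ^+ i) => n.
have S0 : 0 <= \sum_(i < n0) b i / q ^+ i.
  by apply: sumr_ge0 => i _; rewrite divr_ge0// exprn_ge0// ltW.
have qn : 0 < q ^+ n by rewrite exprn_gt0.
rewrite -ler_pdivrMr//; have [nn0|nn0] := leqP n0 n.
  rewrite ler_pdivrMr// (le_trans (bM n nn0))// ler_wpM2r ?(ltW qn)//.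
  by rewrite (le_trans (ler_norm M))// lerDl.
rewrite (bigD1 (Ordinal nn0))//= addrCA lerDl addr_ge0//.
by apply: sumr_ge0 => i _; rewrite divr_ge0// exprn_ge0// ltW.
Qed.

End decay.

Section solution_decay.
Context {R : realType} {I : Type} {E : tvsType R[i]} (P : seminorm_system I E).
Context {D : submodClosed E} (A : {linear opdom D -> E}).
Hypothesis Egen : seminorms_generate E P.
Local Notation C := (R[i]^o).
Local Notation pA a := (graph_seminorm A (P a)).
Local Notation F := (graph_space P A).

Variables (Res : forall a : I, R -> E -> local_banach (pA a)) (t_ : I -> R).
Hypothesis ResA : asymptotic_left_resolvent Res t_.

Lemma resolvent_defect_linear a t : t_ a <= t -> linear (resolvent_defect Res a t).
Proof.
have [_ Rl _] := ResA a; move=> /Rl[Resl _] k x y.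
rewrite /resolvent_defect local_map_linear.
have -> : t%:C *: opval (k *: x + y) - A (k *: x + y) =
    k *: (t%:C *: opval x - A x) + (t%:C *: opval y - A y).
  rewrite -[opval (k *: x + y)]/(k *: opval x + opval y) (linearP A) scalerDr opprD addrACA.
  by rewrite scalerBr !scalerA (mulrC k).
by rewrite Resl scalerBr opprD addrACA.
Qed.

(** Integration by parts, with the equation [u' = A u + h] and
[R(t) (t - A) = kappa + S(t)] inserted. *)
Lemma has_deriv_resolvent (u : C -> F) (h : C -> E) (u' : F) z a c (n : nat) (K : R) :
  t_ a <= n%:R -> (forall x, rnorm (Res a n%:R x) <= K * P c x) -> 0 <= K ->
  is_cderive u z u' -> opval (u' : opdom D) - A (u z) = h z ->
  has_deriv (fun w => cexp (- (n%:R * w)) *: Res a n%:R (opval (u w : opdom D))) z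
    (cexp (- (n%:R * z)) *: Res a n%:R (h z) -
     cexp (- (n%:R * z)) *: local_map (pA a) (u z) -
     cexp (- (n%:R * z)) *: resolvent_defect Res a n%:R (u z)).
Proof.
move=> tn RK K0 du eqh; have [_ Rl _] := ResA a; have [Resl _] := Rl _ tn.
have dr : has_deriv (fun w => Res a n%:R (opval (u w : opdom D))) z
    (Res a n%:R (opval (u' : opdom D))).
  apply: (is_cderive_linear (@graph_system_generate R I E P D A) (K := K) (b := c)
    (L := fun x : F => Res a n%:R (opval (x : opdom D)))) du.
    by move=> k x y; rewrite -Resl.
  move=> x; rewrite (le_trans (RK _))// ler_wpM2l//.
  by rewrite /= /graph_seminorm_fun lerDl seminorm_ge0.
have de := has_deriv_cexpNM n%:R z.
have := has_derivZ de dr; set e := cexp _.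
set r := Res a _ (opval (u z : opdom D)).
have <- : Res a n%:R (h z) + Res a n%:R (A (u z)) = Res a n%:R (opval (u' : opdom D)).
  by rewrite -eqh (linear_funB Resl) subrK.
have -> : resolvent_defect Res a n%:R (u z) =
    n%:R *: r - Res a n%:R (A (u z)) - local_map (pA a) (u z).
  by rewrite /resolvent_defect (linear_funB Resl) (linear_funZ Resl) rmorph_nat.
move=> d; have -> // : e *: Res a n%:R (h z) - e *: local_map (pA a) (u z) -
    e *: (n%:R *: r - Res a n%:R (A (u z)) - local_map (pA a) (u z)) =
    (- n%:R * e) *: r + e *: (Res a n%:R (h z) + Res a n%:R (A (u z))).
rewrite -!scalerBr mulNr scaleNr (mulrC n%:R) -(scalerA e) -[X in _ = X + _]scalerN -scalerDr.
congr (_ *: _); move: (Res a _ (h z)) (Res a _ (A _)) (local_map _ _) (_ *: r).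
by move=> x1 x2 x3 x4; rewrite opprB addrA subrK opprB addrA addrC addrA.
Qed.

Hypothesis Resb : forall a, exists c, exists2 K : R, 0 < K & forall t, t_ a <= t ->
  forall x, rnorm (Res a t x) <= K * P c x.

Lemma defect_bound a t b (M : R) (S : local_banach (pA b) -> local_banach (pA a)) x :
  continuous_extension (resolvent_defect Res a t) S -> (opnorm S <= M%:E)%E ->
  rnorm (resolvent_defect Res a t x) <= M * pA b x.
Proof.
move=> [[Sl _] SE] SM; rewrite -SE -(rnorm_local_map (pA b)).
exact: opnorm_bound.
Qed.

(** The three sources of decay are the chord [Re z = T] for [h], the end points of
the contour, and the defect of the resolvent. *)
Theorem laplace_decay (u : C -> F) (h : C -> E) a T : 0 < T ->
  (forall z, slit_plane z -> is_cderive u z (cderive u z)) ->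
  holomorphic setT h ->
  (forall z, slit_plane z -> opval (cderive u z : opdom D) - A (u z) = h z) ->
  exists K : R, forall n, rnorm (laplace (fun z => local_map (pA a) (u z)) T n) <=
    K * expR (- T) ^+ n.
Proof.
move=> T0 du dh eqh; have Xc := @banach_seq_complete R (local_banach (pA a)).
have [c [C3 C30 RC]] := Resb a.
have [ta0 Rl asy] := ResA a.
(* Degree N of the decay of the defect: it has to beat the growth e ^ n of the
   exponential along the contour, whose points have real part at least -1. *)
pose N := (Num.truncn (T + 1)).+1.
have NT : T + 1 <= N%:R.
  by apply: ltW; rewrite /N; apply: truncnS_gt.
have [b [tn [C1 [C2 [ttn C10 C20 SP]]]]] := asy N isT.
pose n0 := (Num.truncn tn).+1.
have n0P n : (n0 <= n)%N -> tn <= n%:R.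
  move=> nn; apply: ltW; apply: lt_le_trans (truncnS_gt tn) _.
  by rewrite ler_nat.
have bn := base_point_near T.
have sedge := near_base_quad T0 bn.
have sl1 z : segment (vbot T) vin z -> slit_plane z.
  by move=> zs; have [] := sedge z (or_intror (or_intror (or_introl zs))).
have sl2 z : segment vin (vtop T) z -> slit_plane z.
  by move=> zs; have [] := sedge z (or_intror (or_intror (or_intror zs))).
have re1 z : segment (vbot T) vin z -> - 1 <= Re z.
  by case=> s /andP[s0 s1] ->; rewrite /vbot /vin /=; nra.
have re2 z : segment vin (vtop T) z -> - 1 <= Re z.
  by case=> s /andP[s0 s1] ->; rewrite /vtop /vin /=; nra.
have re3 z : segment (vtop T) (vbot T) z -> T <= Re z.
  by case=> s /andP[s0 s1] ->; rewrite /vbot /vtop /=; nra.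
have Fgen := @graph_system_generate R I E P D A.
pose kappa (d : I) z := local_map (pA d) (u z).
have kd d z : slit_plane z -> cdiff (kappa d) z.
  move=> /du duz; eexists.
  apply: (is_cderive_linear Fgen (K := 1) (b := d) (@local_map_linear _ _ (pA d))) duz.
  by move=> x; rewrite rnorm_local_map mul1r.
have kc d p q : (forall z, segment p q z -> slit_plane z) -> continuous_along (kappa d) p q.
  by move=> sl z /sl/kd/cdiff_cont.
have [M1 M1P] := continuous_along_bounded (kc b _ _ sl1).
have [M2 M2P] := continuous_along_bounded (kc b _ _ sl2).
have hc : continuous_along (fun z => local_map (P c) (h z)) (vtop T) (vbot T).
  move=> z _; have [l dl] := dh z Logic.I; apply: has_deriv_cont.
  apply: (is_cderive_linear Egen (K := 1) (b := c) (@local_map_linear _ _ (P c))) dl.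
  by move=> x; rewrite rnorm_local_map mul1r.
have [M3 M3P] := continuous_along_bounded hc.
pose r z := C3 * P c (opval (u z : opdom D)).
pose B : R := cabs (vbot T - vtop T) * (C3 * M3) +
  (cabs (vin - vbot T) * (C2 * M1) + cabs (vtop T - vin) * (C2 * M2)) +
  (r (vtop T) + r (vbot T)).
apply: (@eventually_geometric R _ (expR (- T)) B n0); first exact: expR_gt0.
  by move=> n; exact: rnorm_ge0.
move=> n nn0; have tnn := n0P n nn0; have tan := le_trans ttn tnn.
have [Sb [S SE SM]] := SP _ tnn; have RC3 := RC _ tan.
have [Resl _] := Rl _ tan.
pose ex (z : C) : C := cexp (- (n%:R * z)).
pose G z := Res a n%:R (h z); pose H z := resolvent_defect Res a n%:R (u z).
pose Fz z := ex z *: Res a n%:R (opval (u z : opdom D)).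
have Gd z : cdiff G z.
  have [l dl] := dh z Logic.I; eexists.
  exact: (is_cderive_linear Egen Resl RC3 dl).
have Gc p q : continuous_along G p q by move=> z _; exact: cdiff_cont.
have Hc p q : (forall z, segment p q z -> slit_plane z) -> continuous_along H p q.
  move=> sl z /sl/du duz; apply: has_deriv_cont.
  exact: (is_cderive_linear Fgen (resolvent_defect_linear tan) Sb duz).
have dF z : slit_plane z ->
    has_deriv Fz z (ex z *: G z - ex z *: kappa a z - ex z *: H z).
  move=> sz; exact: (has_deriv_resolvent tan RC3 (ltW C30) (du z sz) (eqh z sz)).
have qn : expR (- T) ^+ n = expR (- (n%:R * T)) by rewrite -expRM_natl mulrN.
have Hb p q M : (forall z, segment p q z -> slit_plane z) ->
    (forall z, segment p q z -> - 1 <= Re z) ->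
    (forall z, segment p q z -> rnorm (kappa b z) <= M) ->
    rnorm (cint (fun z => ex z *: H z) p q) <= cabs (q - p) * (C2 * M) * expR (- T) ^+ n.
  move=> sl re kM.
  have e0 : 0 < C2 * expR (- (N%:R * n%:R)) by rewrite mulr_gt0 ?expR_gt0.
  have HM z : segment p q z -> rnorm (H z) <= C2 * expR (- (N%:R * n%:R)) * M.
    move=> zs; rewrite (le_trans (defect_bound (u z) SE SM))//.
    by rewrite -(rnorm_local_map (pA b)) ler_pM2l// kM.
  refine (le_trans (@cint_exp_bound R _ Xc _ n _ _ _ _ (Hc p q sl) re HM) _).
  have M0 : 0 <= M by apply: le_trans (kM p (segment_left p q)); exact: rnorm_ge0.
  set k := cabs _; have k0 : 0 <= k by exact: cabs_ge0.
  have -> : k * (expR (- (n%:R * -1)) * (C2 * expR (- (N%:R * n%:R)) * M)) =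
      k * (C2 * M) * (expR (- (n%:R * -1)) * expR (- (N%:R * n%:R))) by ring.
  rewrite ler_wpM2l ?mulr_ge0 ?(ltW C20)// -expRD qn ler_expR.
  exact: exponent_le.
have Fb z : Re z = T -> rnorm (Fz z) <= r z * expR (- T) ^+ n.
  by move=> zT; rewrite rnormZ cabs_cexpMn zT qn mulrC ler_wpM2r ?expR_ge0.
have Gb : rnorm (cint (fun z => ex z *: G z) (vtop T) (vbot T)) <=
    cabs (vbot T - vtop T) * (C3 * M3) * expR (- T) ^+ n.
  rewrite -mulrA (mulrC _ (expR _ ^+ n)) qn; refine (@cint_exp_bound R _ Xc _ n _ _ _ _ (Gc _ _) re3 _).
  move=> z zs; rewrite (le_trans (RC3 _))// ler_pM2l//.
  by rewrite -(rnorm_local_map (P c)) M3P.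
have Hb1 := Hb _ _ _ sl1 re1 M1P; have Hb2 := Hb _ _ _ sl2 re2 M2P.
have Fb1 := Fb (vtop T) erefl; have Fb2 := Fb (vbot T) erefl.
have eGd z : cdiff (fun z => ex z *: G z) z.
  by apply: cdiffZ; [eexists; exact: has_deriv_cexpNM|exact: Gd].
have edF z : segment (vbot T) vin z \/ segment vin (vtop T) z ->
    has_deriv Fz z (ex z *: G z - ex z *: kappa a z - ex z *: H z).
  by move=> [/sl1|/sl2]; exact: dF.
have CE := contour_estimate Xc eGd
  (@cexp_scale_cont R _ _ n%:R _ _ (kc a _ _ sl1))
  (@cexp_scale_cont R _ _ n%:R _ _ (kc a _ _ sl2))
  (@cexp_scale_cont R _ _ n%:R _ _ (Hc _ _ sl1))
  (@cexp_scale_cont R _ _ n%:R _ _ (Hc _ _ sl2)) edF.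
refine (le_trans CE (le_trans (lerD (lerD Gb (lerD Hb1 Hb2)) (lerD Fb1 Fb2)) _)).
by rewrite -!mulrDl.
Qed.

End solution_decay.

(** * Entire extension of solutions *)

Section gluing.
Context {R : realType} {I : Type} {W : tvsType R[i]} (Q : seminorm_system I W).
Hypothesis gen : seminorms_generate W Q.
Local Notation C := (R[i]^o).
Context (X : I -> normedModType R[i]) (k : forall a, W -> X a).
Hypotheses (kl : forall a, linear (k a)) (kQ : forall a x, rnorm (k a x) = Q a x).

Lemma off_slit_sector (z : C) : ~ slit_plane z ->
  0 < Re z + 1 /\ sector (Re z + 1) z.
Proof.
move=> /contrapT[z0 z1]; split; first by lra.
by rewrite /sector /= z0 normr0 mulr0; split; lra.
Qed.

(** The value at a point of the slit is the limit along a vertical sequence: it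
exists in [W] because it exists in every local space. *)
Lemma slit_value (u : C -> W) (z : C) : seq_complete W -> ~ slit_plane z ->
  (forall a, exists V : C -> X a, {for z, continuous V} /\
     exists2 d : R, 0 < d & forall w, cabs (w - z) < d -> slit_plane w ->
       V w = k a (u w)) ->
  exists y : W, forall a (V : C -> X a), {for z, continuous V} ->
    (exists2 d : R, 0 < d & forall w, cabs (w - z) < d -> slit_plane w ->
       V w = k a (u w)) -> k a y = V z.
Proof.
move=> Wc nz ex; pose s n : C := z + 'i * (n.+1%:R^-1 : R)%:C.
have sE n : s n - z = 'i * (n.+1%:R^-1 : R)%:C by rewrite /s addrAC subrr add0r.
have ss n : slit_plane (s n).
  move: nz => /contrapT[]; rewrite /s; case: (z) => x y /= y0 _ [+ _].
  rewrite /= y0 add0r mul0r mul1r add0r => /eqP.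
  by rewrite invr_eq0 pnatr_eq0.
have sd (d : R) : 0 < d -> exists n, forall i, (n <= i)%N -> cabs (s i - z) < d.
  move=> d0; have [n _ nP] : \forall n \near \oo, n.+1%:R^-1 < d.
    by apply: (cvgr_lt 0) => //; exact: cvg_harmonic.
  exists n => i ni; rewrite sE cabsM cabs_i mul1r cabs_real ger0_norm ?invr_ge0//.
  exact: nP.
have lim a (V : C -> X a) : {for z, continuous V} ->
    (exists2 d : R, 0 < d & forall w, cabs (w - z) < d -> slit_plane w ->
       V w = k a (u w)) ->
    forall e : R, 0 < e -> exists n, forall i, (n <= i)%N ->
      rnorm (k a (u (s i)) - V z) <= e.
  move=> Vc [d d0 dP] e e0; move/continuous_rnormP: Vc => /(_ e e0)[d' d'0 d'P].
  have [|n nP] := sd (Num.min d d'); first by rewrite lt_min d0.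
  exists n => i /nP; rewrite lt_min => /andP[i1 i2].
  by rewrite -(dP _ i1 (ss i)); exact: d'P.
have [y /(seminorm_cvgP gen) yP] : exists y : W, u (s n) @[n --> \oo] --> y.
  apply: (seminorm_seq_complete gen (u := fun n => u (s n)) Wc) => a e e0.
  have [V [Vc VP]] := ex a.
  have [|n nP] := lim a V Vc VP (e / 3); first by rewrite divr_gt0.
  exists n => i j /nP h1 /nP h2; rewrite -kQ (linear_funB (kl a)).
  rewrite -[X in rnorm X](subrKA (V z)) -(opprB (k a (u (s j)))).
  by rewrite (le_lt_trans (rnormB _ _))//; lra.
exists y => a V Vc VP; apply/eqP; rewrite -subr_eq0; apply/eqP.
apply: (rnorm_le_eps_eq0 (C := 2)) => e e0.
have [n1 n1P] := lim a V Vc VP e e0; have [n2 n2P] := yP a e e0.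
have h1 := n1P _ (leq_maxl n1 n2); have h2 := n2P _ (leq_maxr n1 n2).
rewrite -kQ (linear_funB (kl a)) rdistC in h2.
rewrite -[X in rnorm X](subrKA (k a (u (s (maxn n1 n2))))).
rewrite (le_trans (rnormD _ _))//; lra.
Qed.

(** The local extensions determine a value in [W] at every point of the slit, and
differentiability can be checked in the local spaces. *)
Lemma entire_extension (u : C -> W) : seq_complete W ->
  (forall z, slit_plane z -> cderivable u z) ->
  (forall a T, 0 < T -> exists V : C -> X a,
     (forall w, sector T w -> cdiff V w) /\
     (forall w, sector T w -> slit_plane w -> V w = k a (u w))) ->
  exists U : C -> W, holomorphic setT U /\ forall z, slit_plane z -> U z = u z.
Proof.
move=> Wc ud Vex.
have near T w (a : I) (V : C -> X a) : 0 < T -> sector T w ->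
    (forall v, sector T v -> slit_plane v -> V v = k a (u v)) ->
    exists2 d : R, 0 < d & forall v, cabs (v - w) < d -> slit_plane v -> V v = k a (u v).
  move=> T0 sw VP; have [d d0 dP] := sector_open T0 sw.
  by exists d => // v /dP sv; exact: VP.
have /choice[y yP] (z : C) : exists y : W, (slit_plane z -> y = u z) /\
    (~ slit_plane z -> forall a (V : C -> X a), {for z, continuous V} ->
      (exists2 d : R, 0 < d & forall w, cabs (w - z) < d -> slit_plane w ->
         V w = k a (u w)) -> k a y = V z).
  have [sz|nz] := pselect (slit_plane z); first by exists (u z).
  have [T0 sT] := off_slit_sector nz.
  have [|y yP] := slit_value (u := u) Wc nz.
    move=> a; have [V [Vd VP]] := Vex a _ T0; exists V; split.
      exact: cdiff_cont (Vd z sT).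
    exact: (near _ _ _ _ T0 sT VP).
  by exists y.
have yV a T V w : 0 < T -> (forall v, sector T v -> cdiff V v) ->
    (forall v, sector T v -> slit_plane v -> V v = k a (u v)) ->
    sector T w -> k a (y w) = V w.
  move=> T0 Vd VP sw; have [sl|nsl] := pselect (slit_plane w).
    by rewrite (yP w).1// VP.
  apply: (yP w).2 => //; first exact: cdiff_cont (Vd w sw).
  exact: (near _ _ _ _ T0 sw VP).
exists y; split=> [z _|z sz]; last exact: (yP z).1.
apply: (cderivable_local gen Wc kl kQ) => a.
have [sz|nz] := pselect (slit_plane z).
  have [r r0 rP] := slit_plane_open sz; have [l ul] := ud z sz.
  exists (k a l); apply: (@has_deriv_near R (X a) (fun w => k a (u w))).
    by exists r => // w /rP sw; rewrite (yP w).1.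
  apply: (is_cderive_linear gen (K := 1) (b := a) (kl a)) ul.
  by move=> x; rewrite kQ mul1r.
have [T0 sT] := off_slit_sector nz; have [V [Vd VP]] := Vex a _ T0.
have [l Vl] := Vd z sT; exists l; apply: has_deriv_near Vl.
have [d d0 dP] := sector_open T0 sT; exists d => // w /dP sw.
exact: (yV a _ V w T0 Vd VP sw).
Qed.

End gluing.

Section solutions.
Context {R : realType} {I : Type} {E : tvsType R[i]} (P : seminorm_system I E).
Context {D : submodClosed E} (A : {linear opdom D -> E}).
Hypothesis Egen : seminorms_generate E P.
Local Notation C := (R[i]^o).
Local Notation F := (graph_space P A).

Lemma cderiveE (W : tvsType R[i]) (f : C -> W) z : cderivable f z ->
  is_cderive f z (cderive f z).
Proof. exact: xgetPex. Qed.

Lemma hyperclass_zero (W : tvsType R[i]) (Q : seminorm_system I W) (u U : C -> W) :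
  seminorms_generate W Q -> holomorphic setT U ->
  (forall z, slit_plane z -> U z = u z) -> hyperclass u = hyperclass (fun=> 0).
Proof.
move=> gen Ud Uu; apply/seteqP; split=> g [h hd gE].
  exists (fun z => U z + h z) => [z _|z sz].
    have [l Ul] := Ud z Logic.I; have [m hm] := hd z Logic.I.
    by exists (l + m); exact: (is_cderiveD gen).
  by rewrite gE// add0r Uu.
exists (fun z => h z - U z) => [z _|z sz].
  have [l Ul] := Ud z Logic.I; have [m hm] := hd z Logic.I.
  by exists (m - l); apply: (is_cderiveD gen) => //; exact: (is_cderiveN gen).
by rewrite gE// add0r Uu// addrC subrK.
Qed.

Lemma solution_equation (u : C -> F) :
  hyperclass (fun z => opval (cderive u z : opdom D) - A (u z) : E) =
    hyperclass (fun z => - (2 * pi%:C * 'i * z)^-1 *: (0 : E)) ->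
  exists2 h : C -> E, holomorphic setT h &
    forall z, slit_plane z -> opval (cderive u z : opdom D) - A (u z) = h z.
Proof.
move=> eqc.
pose f z : E := opval (cderive u z : opdom D) - A (u z).
have : hyperclass f f.
  exists (fun=> 0) => [z _|z _]; last by rewrite addr0.
  by exists 0; exact: (is_cderive_cst Egen).
rewrite /f eqc => -[h hd hE]; exists h => // z /hE ->.
by rewrite scaler0 add0r.
Qed.

Lemma zero_solution : hausdorff_space E ->
  @acp_solution R I E P D A 0 (hyperclass (fun=> 0 : F)).
Proof.
move=> Eh; have Fgen := @graph_system_generate R I E P D A.
exists (fun=> 0) => //; split.
  by move=> z _; exists 0; exact: (is_cderive_cst Fgen).
congr hyperclass; apply/funext => z; rewrite scaler0.
have dz : is_cderive (fun=> 0 : F) z (cderive (fun=> 0 : F) z).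
  by apply: cderiveE; exists 0; exact: (is_cderive_cst Fgen).
have -> : cderive (fun=> 0 : F) z = 0.
  apply: (graph_separated Egen Eh) => a; apply/eqP; rewrite eq_le seminorm_ge0 andbT.
  apply/ler_addgt0Pr => e e0; rewrite add0r.
  have [d d0 dP] := (is_cderiveP Fgen _ _ _).1 dz a e e0.
  have d2 : 0 < d / 2 by rewrite divr_gt0.
  have := dP (z + (d / 2)%:C); rewrite addrAC subrr add0r cabs_real gtr0_norm//.
  have -> : z + (d / 2)%:C != z.
    by rewrite -subr_eq0 addrAC subrr add0r -cabs_gt0 cabs_real gtr0_norm.
  move=> /(_ isT)-/(_ ltac:(lra)); rewrite subrr scaler0 sub0r seminormN.
  exact: ltW.
by rewrite linear0 subr0.
Qed.

End solutions.

Theorem theorem3p3 (R : realType) (I : Type) (E : tvsType R[i])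
  (P : seminorm_system I E) (Egen : seminorms_generate E P)
  (Ehaus : hausdorff_space E) (Ecompl : seq_complete E)
  (Eadm : admissible E P)
  (D : submodClosed E) (A : {linear opdom D -> E})
  (Aclosed : seq_closed_op A)
  (Fadm : admissible (graph_space P A) (graph_system P A)) :
  (exists (Res : forall a : I, R -> E -> local_banach (graph_seminorm A (P a)))
          (t_ : I -> R),
     asymptotic_left_resolvent Res t_ /\
     forall a : I, exists (c : I) (k : nat) (C3 C4 : R),
       [/\ (0 < k)%N, 0 < C3, 0 < C4 & forall t : R, t_ a <= t ->
         (forall x : E, rnorm (Res a t x) <= C3 * P c x) /\
         exists2 T : local_banach (P c) -> local_banach (graph_seminorm A (P a)),
           continuous_extension (Res a t) T &
           (opnorm T <= (C4 * expR (k%:R * t))%:E)%E]) ->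
  acp_uniqueness P A.
Proof.
move=> [Res [t_ [ResA Resb]]].
have Fgen := @graph_system_generate R I E P D A.
apply/seteqP; split=> [_ [u [ud eqc] <-]|_ ->]; last exact: zero_solution.
have [h hd hE] := solution_equation Egen eqc.
have RC a : exists c, exists2 K : R, 0 < K & forall t, t_ a <= t ->
    forall x, rnorm (Res a t x) <= K * P c x.
  have [c [k [C3 [C4 [_ C30 _ RC]]]]] := Resb a.
  by exists c, C3 => // t /RC[].
have du z : slit_plane z -> is_cderive u z (cderive u z).
  by move=> /ud; exact: cderiveE.
have [U [Ud Uu]] : exists U : R[i]^o -> graph_space P A,
    holomorphic setT U /\ forall z, slit_plane z -> U z = u z.
  apply: (entire_extension Fgen (X := fun a => local_banach (graph_seminorm A (P a)))
    (k := fun a => local_map (graph_seminorm A (P a)))).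
  - by move=> a; exact: local_map_linear.
  - by move=> a x; exact: rnorm_local_map.
  - exact: (graph_seq_complete Egen Ecompl Aclosed).
  - exact: ud.
  move=> a T T0; have [K KP] := laplace_decay Egen ResA RC a T0 du hd hE.
  apply: (laplace_extension _ T0 _ KP); first exact: banach_seq_complete.
  move=> z /du duz; eexists.
  apply: (is_cderive_linear Fgen (K := 1) (b := a)
    (@local_map_linear _ _ (graph_seminorm A (P a)))) duz.
  by move=> x; rewrite rnorm_local_map mul1r.
exact: (hyperclass_zero Fgen Ud Uu).
Qed.
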